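(* Let $\widetilde\varphi:\widetilde K\to\mathbb{R}$ be a continuous function on the self-affine Sierpinski carpet $\widetilde K\subset\mathbb{T}^2$ satisfying the Dini condition $$\int_{[0,1]}\ \sup_{\substack{z,z'\in\widetilde K\\ \delta(z,z')\le r}}|\widetilde\varphi(z)-\widetilde\varphi(z')|\,\frac{dr}{r}<\infty .$$ Let $\varphi=\widetilde\varphi\circ\widetilde\pi:K\to\mathbb{R}$ and, for $n\ge 1$ and $(w_1,w_2)\in A_1^n\times A_2^n$, let $$\psi([w_1]\times[w_2])=\sup_{z\in K\cap([w_1]\times[w_2])}\exp\Big(\sum_{k=0}^{n-1}\varphi(\sigma^kz)\Big)$$ (the supremum over the empty set being $0$). Assume that $\widetilde\varphi$ is normalized so that the topological pressure $P(\log\psi)=\lim_{n\to\infty}\frac1n\log\sum_{(w_1,w_2)\in A_1^n\times A_2^n}\psi([w_1]\times[w_2])$ equals $0$. For $q\in\mathbb{R}$ let $$\mathcal{T}_\psi(q)=-\frac{1}{\log r_1}\lim_{n\to\infty}\frac1n\log\sum_{w_1\in A_1^n}\Big(\sum_{w_2\in A_2^n}\psi([w_1]\times[w_2])^q\Big)^s,\qquad s=\frac{\log r_1}{\log r_2},$$ let $\mathcal{T}_\psi^*(\alpha)=\inf_{q\in\mathbb{R}}(\alpha q-\mathcal{T}_\psi(q))$, and for $\beta\in\mathbb{R}$ let $$F_{\widetilde\varphi}(\beta)=\Big\{z\in\widetilde K:\ \lim_{n\to\infty}\frac{1}{n}\sum_{k=0}^{n-1}\widetilde\varphi(T^kz)=\beta\Big\}.$$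 Then for all $\beta\in\mathbb{R}$, $\dim F_{\widetilde\varphi}(\beta)=\mathcal{T}_\psi^*(-\beta/\log r_2)$ if $\mathcal{T}_\psi^*(-\beta/\log r_2)>0$, and $F_{\widetilde\varphi}(\beta)=\emptyset$ if $\mathcal{T}_\psi^*(-\beta/\log r_2)<0$.
   Context: $2\le r_1\le r_2$ are integers; for $i\in\{1,2\}$, $A_i=\{0,\dots,r_i-1\}$ and $\mathbb{A}_i=A_i^{\mathbb{N}^*}$, with shift $\sigma_i$; $\sigma=(\sigma_1,\sigma_2)$ is the shift on $\mathbb{A}_1\times\mathbb{A}_2$, which is identified with $(A_1\times A_2)^{\mathbb{N}^*}$. For a finite word $w$, $[w]$ is the cylinder of infinite words with prefix $w$. Fix $A\subset A_1\times A_2$ with $\#A\ge 2$ and let $K\subset\mathbb{A}_1\times\mathbb{A}_2$ be the $\sigma$-invariant compact set of all $(x,y)$ with $(x_k,y_k)\in A$ for every $k\ge 1$. $\mathbb{T}=\mathbb{R}/\mathbb{Z}$; $\mathbb{T}^2$ is endowed with its canonical metric $\delta$ and the transformation $T(x,y)=(r_1x,r_2y)$. For $i\in\{1,2\}$, $\widetilde\pi_i:\mathbb{A}_i\to\mathbb{T}$ is $\widetilde\pi_i(z)=\sum_{k\ge 1}z_kr_i^{-k}$, and $\widetilde\pi=(\widetilde\pi_1,\widetilde\pi_2)$. The self-affine Sierpinski carpet is $\widetilde K=\widetilde\pi(K)$, i.e. the attractor in $\mathbb{T}^2$ of the maps $(x,y)\mapsto(a_1r_1^{-1}+r_1^{-1}x,\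 a_2r_2^{-1}+r_2^{-1}y)$, $(a_1,a_2)\in A$; it satisfies $T(\widetilde K)\subset\widetilde K$. $\dim$ denotes Hausdorff dimension with respect to $\delta$. Convention: $0^\gamma=0$ for all $\gamma\in\mathbb{R}$. (The limits defining $P(\log\psi)$ and $\mathcal{T}_\psi(q)$ exist.) *)

(* Defs.v *)
From HB Require Import structures.
From mathcomp Require Import all_boot all_order all_algebra.
From mathcomp Require Import all_classical all_reals all_analysis.
From mathcomp Require Import ring lra.

Set Implicit Arguments.
Unset Strict Implicit.
Unset Printing Implicit Defensive.

Import Order.TTheory GRing.Theory Num.Theory.
Import numFieldNormedType.Exports.

Local Open Scope classical_set_scope.
Local Open Scope ring_scope.
Local Open Scope quotient_scope.

Definition int_pred (R : realType) : {pred R} := fun x => x \is a Num.int.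

Lemma int_pred_zmod_closed (R : realType) : zmod_closed (@int_pred R).
Proof.
split; first by rewrite unfold_in; exact: rpred0.
by move=> x y; rewrite !unfold_in; exact: rpredB.
Qed.

HB.instance Definition _ (R : realType) :=
  GRing.isZmodClosed.Build R (@int_pred R) (@int_pred_zmod_closed R).

Definition circle (R : realType) := Quotient.quot (@int_pred R).
HB.instance Definition _ (R : realType) := GRing.Zmodule.on (circle R).

Lemma pi_circle0 (R : realType) : \pi_(circle R) 0 = 0.
Proof. exact: raddf0. Qed.

Lemma pi_circleD (R : realType) (t u : R) :
  \pi_(circle R) (t + u) = \pi_(circle R) t + \pi_(circle R) u.
Proof. exact: raddfD. Qed.

Lemma pi_circleN (R : realType) (t : R) :
  \pi_(circle R) (- t) = - \pi_(circle R) t.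
Proof. exact: raddfN. Qed.

(* Quotient distance: the infimum of |u - v| over representatives u of x and
   v of y, i.e. of |t| over representatives t of x - y. *)
Definition circle_dist (R : realType) (x y : circle R) : R :=
  inf [set `|t| | t in [set t : R | \pi_(circle R) t = x - y]].

Lemma circle_dist_has_inf (R : realType) (x y : circle R) :
  has_inf [set `|t| | t in [set t : R | \pi_(circle R) t = x - y]].
Proof.
split; last by exists 0 => _ [t _ <-].
by exists `|repr (x - y)|, (repr (x - y)) => //=; rewrite reprK.
Qed.

Lemma circle_dist_ge0 (R : realType) (x y : circle R) : 0 <= circle_dist x y.
Proof.
by apply: lb_le_inf => [|_ [t _ <-]//]; case: (circle_dist_has_inf x y).
Qed.

Lemma circle_dist_le (R : realType) (x y : circle R) (t : R) :
  \pi_(circle R) t = x - y -> circle_dist x y <= `|t|.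
Proof.
by move=> xyt; apply: ge_inf; [case: (circle_dist_has_inf x y)|exists t].
Qed.

Lemma circle_dist_adherent (R : realType) (x y : circle R) (e : R) : 0 < e ->
  exists2 t : R, \pi_(circle R) t = x - y & `|t| < circle_dist x y + e.
Proof.
move=> e0; have [_ [t xyt <-] te] := inf_adherent e0 (circle_dist_has_inf x y).
by exists t.
Qed.

Lemma circle_distxx (R : realType) (x : circle R) : circle_dist x x = 0.
Proof.
apply/eqP; rewrite eq_le circle_dist_ge0 andbT -(normr0 R).
by apply: circle_dist_le; rewrite pi_circle0 subrr.
Qed.

Lemma circle_dist_positivity (R : realType) (x y : circle R) :
  circle_dist x y = 0 -> x = y.
Proof.
move=> xy0; apply/eqP; rewrite -subr_eq0; apply/eqP.
have [t xyt] := circle_dist_adherent x y (ltr0Sn R 1 : 0 < 2).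
have [|t1 xyt1] := @circle_dist_adherent R x y 2^-1; first by rewrite invr_gt0.
rewrite xy0 add0r => t1lt _.
have [t10|t10] := eqVneq t1 0; first by rewrite -xyt1 t10 pi_circle0.
have [|t2 xyt2] := @circle_dist_adherent R x y (`|t1| / 2).
  by rewrite divr_gt0// normr_gt0.
rewrite xy0 add0r => t2lt.
have : t1 - t2 \is a Num.int.
  have /eqP : \pi_(circle R) t1 = \pi_(circle R) t2 by rewrite xyt1 xyt2.
  by rewrite -Quotient.idealrBE.
move=> t12; exfalso; clear t xyt xyt1 xyt2 xy0.
have [/eqP|t12n0] := eqVneq (t1 - t2) 0.
  rewrite subr_eq0 => /eqP E; move: t2lt; rewrite -E.
  by have := normr_ge0 t1; clear; lra.
have := norm_intr_ge1 t12 t12n0; have := ler_normB t1 t2.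
by have := normr_ge0 t1; move: t1lt t2lt; clear; lra.
Qed.

Lemma circle_dist_sym (R : realType) (x y : circle R) :
  circle_dist x y = circle_dist y x.
Proof.
suff H : forall a b : circle R, circle_dist a b <= circle_dist b a.
  by apply/eqP; rewrite eq_le !H.
move=> a b; apply/ler_addgt0Pr => e /(circle_dist_adherent b a)[t bat te].
rewrite (le_trans _ (ltW te))// -normrN; apply: circle_dist_le.
by rewrite pi_circleN bat opprB.
Qed.

Lemma circle_dist_triangle (R : realType) (y x z : circle R) :
  circle_dist x z <= circle_dist x y + circle_dist y z.
Proof.
apply/ler_addgt0Pr => e e0; have e20 : 0 < e / 2 by rewrite divr_gt0.
have [t xyt te] := circle_dist_adherent x y e20.
have [u yzu ue] := circle_dist_adherent y z e20.
have : circle_dist x z <= `|t + u|.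
  by apply: circle_dist_le; rewrite pi_circleD xyt yzu addrA subrK.
by have := ler_normD t u; move: te ue; clear; lra.
Qed.

HB.instance Definition _ (R : realType) :=
  @isMetric.Build R (circle R) (@circle_dist R) (@circle_distxx R)
    (@circle_dist_positivity R) (@circle_dist_sym R) (@circle_dist_triangle R).

(* The alias keeps the Euclidean metric apart from the sup metric that the
   product circle R * circle R carries canonically. *)
Definition torus (R : realType) : Type := (circle R * circle R)%type.
HB.instance Definition _ (R : realType) := Choice.on (torus R).

Definition torus_dist (R : realType) (z z' : torus R) : R :=
  Num.sqrt (mdist z.1 z'.1 ^+ 2 + mdist z.2 z'.2 ^+ 2).

Lemma torus_distxx (R : realType) (z : torus R) : torus_dist z z = 0.
Proof. by rewrite /torus_dist !mdistxx expr0n addr0 sqrtr0. Qed.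

Lemma torus_dist_positivity (R : realType) (z z' : torus R) :
  torus_dist z z' = 0 -> z = z'.
Proof.
move=> /eqP; rewrite sqrtr_eq0 => le0.
have := le_anti (introT andP (conj le0 (addr_ge0 (sqr_ge0 _) (sqr_ge0 _)))).
move=> /eqP; rewrite paddr_eq0 ?sqr_ge0// !sqrf_eq0 => /andP[/eqP d1 /eqP d2].
case: z z' {le0} d1 d2 => [a b] [a' b'] /= d1 d2.
by rewrite (mdist_positivity _ _ d1) (mdist_positivity _ _ d2).
Qed.

Lemma torus_dist_sym (R : realType) (z z' : torus R) :
  torus_dist z z' = torus_dist z' z.
Proof. by congr (Num.sqrt (_ ^+ 2 + _ ^+ 2)); exact: metric_sym. Qed.

Lemma torus_dist_triangle (R : realType) (y x z : torus R) :
  torus_dist x z <= torus_dist x y + torus_dist y z.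
Proof.
rewrite /torus_dist.
have := metric_triangle x.1 y.1 z.1; have := metric_triangle x.2 y.2 z.2.
have := mdist_ge0 x.1 z.1; have := mdist_ge0 x.2 z.2.
have := mdist_ge0 x.1 y.1; have := mdist_ge0 x.2 y.2.
have := mdist_ge0 y.1 z.1; have := mdist_ge0 y.2 z.2.
move: (mdist x.1 z.1) (mdist x.2 z.2) (mdist x.1 y.1) (mdist x.2 y.2)
  (mdist y.1 z.1) (mdist y.2 z.2) => a b a1 b1 a2 b2.
move=> b20 a20 b10 a10 b0 a0 bb aa.
have S1 := sqr_sqrtr (addr_ge0 (sqr_ge0 a1) (sqr_ge0 b1)).
have S2 := sqr_sqrtr (addr_ge0 (sqr_ge0 a2) (sqr_ge0 b2)).
have s10 := sqrtr_ge0 (a1 ^+ 2 + b1 ^+ 2).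
have s20 := sqrtr_ge0 (a2 ^+ 2 + b2 ^+ 2).
move: (Num.sqrt (a1 ^+ 2 + b1 ^+ 2)) (Num.sqrt (a2 ^+ 2 + b2 ^+ 2))
  S1 S2 s10 s20 => s1 s2 S1 S2 s10 s20.
have cs : a1 * a2 + b1 * b2 <= s1 * s2.
  rewrite -(@ler_pXn2r _ 2)// ?nnegrE ?addr_ge0 ?mulr_ge0//.
  rewrite exprMn S1 S2; have := sqr_ge0 (a1 * b2 - a2 * b1); nra.
rewrite -(@ler_pXn2r _ 2)// ?nnegrE ?addr_ge0//.
rewrite sqr_sqrtr ?addr_ge0 ?sqr_ge0//.
have aa2 : a ^+ 2 <= (a1 + a2) ^+ 2 by rewrite ler_pXn2r// nnegrE addr_ge0.
have bb2 : b ^+ 2 <= (b1 + b2) ^+ 2 by rewrite ler_pXn2r// nnegrE addr_ge0.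
nra.
Qed.
HB.instance Definition _ (R : realType) :=
  @isMetric.Build R (torus R) (@torus_dist R) (@torus_distxx R)
    (@torus_dist_positivity R) (@torus_dist_sym R) (@torus_dist_triangle R).

Definition torus_map (R : realType) (r1 r2 : nat) (z : torus R) : torus R :=
  (z.1 *+ r1, z.2 *+ r2).

Definition diameter (R : realType) (X : metricType R) (U : set X) : \bar R :=
  ereal_sup [set (mdist p.1 p.2)%:E | p in U `*` U].

(* The empty set weighs 0 even when s = 0; a nonempty set of diameter 0 weighs
   0 for s > 0 and 1 for s = 0, since poweR is 1 at exponent 0. *)
Definition hausdorff_gauge (R : realType) (X : metricType R) (s : R)
    (U : set X) : \bar R :=
  if U == set0 then 0%E else (diameter U `^ s)%E.

Definition hausdorff_premeasure (R : realType) (X : metricType R) (s e : R)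
    (E : set X) : \bar R :=
  ereal_inf [set (\sum_(0 <= i <oo) hausdorff_gauge s (U i))%E |
    U in [set U : (set X)^nat |
      E `<=` \bigcup_i U i /\ forall i, (diameter (U i) <= e%:E)%E]].

Definition hausdorff_measure (R : realType) (X : metricType R) (s : R)
    (E : set X) : \bar R :=
  ereal_sup [set hausdorff_premeasure s e E | e in [set e : R | 0 < e]].

Definition hausdorff_dim (R : realType) (X : metricType R) (E : set X) :
    \bar R :=
  ereal_inf [set s%:E |
    s in [set s : R | 0 <= s /\ hausdorff_measure s E = 0%E]].

(* Infinite words; the letter written z_k (k >= 1) in the usual notation is
   z k.-1 here. *)
Definition word (r : nat) : Type := nat -> 'I_r.

Definition shift (r : nat) (z : word r) : word r := fun k => z k.+1.

Definition shift2 (r1 r2 : nat) (z : word r1 * word r2) : word r1 * word r2 :=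
  (shift z.1, shift z.2).

Definition cylinder (r n : nat) (w : n.-tuple 'I_r) : set (word r) :=
  [set z | forall k : 'I_n, z k = tnth w k].

Definition symbolic_carpet (r1 r2 : nat) (A : {set 'I_r1 * 'I_r2}) :
    set (word r1 * word r2) :=
  [set z | forall k, (z.1 k, z.2 k) \in A].

Definition coding (R : realType) (r : nat) (z : word r) : circle R :=
  \pi_(circle R) (limn (series (fun k => (z k)%:R / r%:R ^+ k.+1 : R))).

Definition coding2 (R : realType) (r1 r2 : nat) (z : word r1 * word r2) :
    torus R :=
  (coding R z.1, coding R z.2).

Definition carpet (R : realType) (r1 r2 : nat) (A : {set 'I_r1 * 'I_r2}) :
    set (torus R) :=
  [set coding2 R z | z in symbolic_carpet A].
Arguments carpet R {r1 r2} A _.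

(* sup over z, z' in K at distance at most e of |f z - f z'| *)
Definition modulus (R : realType) (X : metricType R) (K : set X) (f : X -> R)
    (e : R) : \bar R :=
  ereal_sup [set `|f p.1 - f p.2|%:E |
    p in [set p : X * X | [/\ K p.1, K p.2 & mdist p.1 p.2 <= e]]].

(* The integrand takes an irrelevant value at 0, where e^-1 = 0. *)
Definition dini (R : realType) (X : metricType R) (K : set X) (f : X -> R) :
    Prop :=
  (\int[lebesgue_measure]_(e in `[0%R, 1%R]) (modulus K f e * e^-1%:E) < +oo)%E.

Definition birkhoff_sum (R : realType) (Z : Type) (S : Z -> Z) (f : Z -> R)
    (n : nat) (z : Z) : R :=
  \sum_(k < n) f (iter k S z).

(* sup set0 = 0, so psi vanishes on cylinders that do not meet K. *)
Definition psi (R : realType) (r1 r2 : nat) (A : {set 'I_r1 * 'I_r2})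
    (phi : word r1 * word r2 -> R) (n : nat)
    (w1 : n.-tuple 'I_r1) (w2 : n.-tuple 'I_r2) : R :=
  sup [set expR (birkhoff_sum (@shift2 r1 r2) phi n z) |
    z in symbolic_carpet A `&` (cylinder w1 `*` cylinder w2)].

Definition pressure (R : realType) (r1 r2 : nat) (A : {set 'I_r1 * 'I_r2})
    (phi : word r1 * word r2 -> R) : R :=
  limn (fun n => n%:R^-1 *
    ln (\sum_(w1 : n.-tuple 'I_r1) \sum_(w2 : n.-tuple 'I_r2)
          psi A phi w1 w2)).

(* powR has 0 `^ 0 = 1; the convention here is 0 ^ g = 0 for every g. *)
Definition powR0 (R : realType) (x g : R) : R := if x == 0 then 0 else x `^ g.

Definition tau (R : realType) (r1 r2 : nat) (A : {set 'I_r1 * 'I_r2})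
    (phi : word r1 * word r2 -> R) (q : R) : R :=
  let s := ln r1%:R / ln r2%:R in
  - (ln r1%:R)^-1 * limn (fun n => n%:R^-1 *
    ln (\sum_(w1 : n.-tuple 'I_r1)
          powR0 (\sum_(w2 : n.-tuple 'I_r2) powR0 (psi A phi w1 w2) q) s)).

Definition legendre (R : realType) (f : R -> R) (a : R) : \bar R :=
  ereal_inf [set (a * q - f q)%:E | q in [set: R]].

Definition birkhoff_level (R : realType) (r1 r2 : nat)
    (A : {set 'I_r1 * 'I_r2}) (phit : torus R -> R) (b : R) : set (torus R) :=
  [set z | carpet R A z /\
    n%:R^-1 * birkhoff_sum (torus_map r1 r2) phit n z @[n --> \oo] --> b].

(* Main.v *)
(* The symbolic carpet K is the full shift over A. By the Dini condition, the
   Birkhoff sums of phi at two points of K with the same first n letters differ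
   by a bounded amount. Hence, up to a factor exp(O(|q|)), the partition sums
     a_n(q) = sum_w1 (sum_w2 psi^q)^s
   are multiplicative in n, a_n(q) = exp(n P(q) + O(|q|)), and
   T_psi = - P / log r1.

   A point of the level set has psi = exp(n beta + o(n)) on its cylinders, which
   forces P(q) >= q s beta for all q; otherwise the level set is empty.

   Upper bound. Let Z_n(w1) = sum_w2 psi^q, let L(n) be about n / s, and give the
   approximate square of level n that is coded by (u, v), where |u| = L(n) and
   |v| = n, the weight Z_L(u)^s psi(u|n, v)^q / Z_n(u|n). The weights of one
   level sum to at most a_L. Along a point of the level set the weight is
     exp(n (q beta + f(L(n)) - f(n)) + o(n)),   f(n) = (1/n) log Z_n,
   and f is bounded, so f(L(n)) - f(n) cannot stay below a negative constant.
   So every point lies in infinitely many squares of weight at least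
   exp(n (q beta - eps)), and these are few.

   Lower bound. No Gibbs measure is used. The words of length N are sorted by
   log psi and by the logarithm of the number of words of the same sort in their
   row. There are boundedly many sorts, so P is almost a maximum of finitely many
   affine functions, and a minimax argument gives two sorts of which a mixture
   has Birkhoff average close to beta and homogeneous fibres, with
   log(rows) + s log(columns) at least N log r1 (T* - eps). Concatenating such
   families of slowly growing lengths gives a subset of the level set that is
   parametrized by a product of finite sets. A small subset of the torus meets
   boundedly many approximate squares, each of which is a small box of that
   product, and a countable cover of a product by boxes has total mass at least
   one. *)
Require Import Defs.
From mathcomp Require Import all_boot all_order all_algebra.
From mathcomp Require Import all_classical all_reals all_analysis.
From mathcomp Require Import measurable_realfun ring lra zify.

Set Implicit Arguments.
Unset Strict Implicit.
Unset Printing Implicit Defensive.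

Import Order.TTheory GRing.Theory Num.Theory.
Import numFieldNormedType.Exports.

Local Open Scope classical_set_scope.
Local Open Scope ring_scope.
Local Open Scope quotient_scope.

(* [powR0] and [shift] are also names of library constants. *)
Local Notation pow0 := Defs.powR0.
Local Notation wshift := Defs.shift.

(** * Almost additive sequences, trees and a minimax lemma *)

(** Comparing [b n] and [b m] through [b (n * m)] shows that every lower quotient [(b m - D) / m] is
    at most every upper quotient [(b n + D) / n]. The supremum [P] of the former separates the two
    families. *)
Lemma almost_additive_cvg (R : realType) (b : nat -> R) (D : R) :
    (forall n m, `|b (n + m)%N - b n - b m| <= D) ->
  exists P : R, (n%:R^-1 * b n @[n --> \oo] --> P) /\
    forall n, `|b n - n%:R * P| <= D.
Proof.
move=> hb.
have bM k n : `|b (k.+1 * n)%N - k.+1%:R * b n| <= k%:R * D.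
  elim: k => [|k IH]; first by rewrite mul1n mul1r subrr normr0 mul0r.
  rewrite mulSn; have := hb n (k.+1 * n)%N; move: IH.
  rewrite [k.+2%:R]mulrSr -[k.+1%:R]/(k.+1%:R : R) (mulrSr 1 k) !ler_norml.
  by move=> /andP[h1 h2] /andP[h3 h4]; apply/andP; split; lra.
have D0 : 0 <= D by apply: le_trans (hb 0%N 0%N).
have cmpb n m : (b m.+1 - D) / m.+1%:R <= (b n.+1 + D) / n.+1%:R.
  have n0 : 0 < n.+1%:R :> R by rewrite ltr0n.
  have m0 : 0 < m.+1%:R :> R by rewrite ltr0n.
  rewrite ler_pdivrMr// mulrAC ler_pdivlMr//.
  have := bM n m.+1; have := bM m n.+1; rewrite mulnC !ler_norml.
  move=> /andP[h1 h2] /andP[h3 h4].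
  have en : n.+1%:R = n%:R + 1 :> R by rewrite mulrSr.
  have em : m.+1%:R = m%:R + 1 :> R by rewrite mulrSr.
  by move: h1 h2 h3 h4; rewrite en em => h1 h2 h3 h4; lra.
pose P := sup [set (b m.+1 - D) / m.+1%:R | m in [set: nat]].
have Plow m : (b m.+1 - D) / m.+1%:R <= P.
  apply: ub_le_sup; last by exists m.
  by exists ((b 1%N + D) / 1) => _ [k _ <-]; exact: (cmpb 0%N).
have Phigh n : P <= (b n.+1 + D) / n.+1%:R.
  by apply: ge_sup; [exists ((b 1%N - D) / 1), 0%N|move=> _ [k _ <-]; exact: cmpb].
have bP n : `|b n - n%:R * P| <= D.
  case: n => [|n]; first by rewrite mul0r subr0; have := hb 0%N 0%N; rewrite addn0 subrr sub0r normrN.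
  have n0 : 0 < n.+1%:R :> R by rewrite ltr0n.
  have := Plow n; rewrite ler_pdivrMr// => h1.
  have := Phigh n; rewrite ler_pdivlMr// => h2.
  by rewrite ler_norml; apply/andP; split; lra.
exists P; split => //.
apply/cvgrPdist_le => e e0.
near=> n.
have n0 : 0 < n%:R :> R by rewrite ltr0n; near: n; exists 1%N.
rewrite -[P in P - _](mulKf (lt0r_neq0 n0)) -mulrBr normrM gtr0_norm ?invr_gt0//.
rewrite distrC mulrC ler_pdivrMr// (le_trans (bP n))// -ler_pdivrMl//.
near: n; exists (Num.truncn (e^-1 * D)).+1 => // n /= hn.
apply: ltW; apply: lt_le_trans (truncnS_gt _) _; by rewrite ler_nat.
Unshelve. all: by end_near.
Qed.

(** * Comparison up to a factor exp(c), and powers with 0^g = 0 *)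

Definition ratio_within (R : realType) (c x y : R) :=
  x <= expR c * y /\ y <= expR c * x.

Lemma ratio_within_sum (R : realType) (I : finType) (P : pred I) (c : R) (F G : I -> R) :
  (forall i, P i -> ratio_within c (F i) (G i)) ->
  ratio_within c (\sum_(i | P i) F i) (\sum_(i | P i) G i).
Proof. by move=> h; split; rewrite mulr_sumr; apply: ler_sum => i /h[]. Qed.

Lemma ratio_within_expR (R : realType) (c x y : R) :
  `|x - y| <= c -> ratio_within c (expR x) (expR y).
Proof.
by rewrite ler_norml => /andP[h1 h2]; split; rewrite -expRD ler_expR; lra.
Qed.

Lemma ratio_within_ln (R : realType) (c x y : R) : 0 < x -> 0 < y ->
  ratio_within c x y -> `|ln x - ln y| <= c.
Proof.
move=> x0 y0 [h1 h2].
have : ln x <= ln (expR c * y) by rewrite ler_ln ?posrE ?mulr_gt0 ?expR_gt0.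
have : ln y <= ln (expR c * x) by rewrite ler_ln ?posrE ?mulr_gt0 ?expR_gt0.
rewrite !lnM ?posrE ?expR_gt0// expRK ler_norml => h3 h4.
by apply/andP; split; lra.
Qed.

Lemma pow0_ge0 (R : realType) (x g : R) : 0 <= pow0 x g.
Proof. by rewrite /Defs.powR0; case: ifP => // _; exact: powR_ge0. Qed.

Lemma pow0_gt0 (R : realType) (x g : R) : 0 < x -> 0 < pow0 x g.
Proof. by move=> x0; rewrite /Defs.powR0 gt_eqF// powR_gt0. Qed.

Lemma pow0M (R : realType) (x y g : R) : 0 <= x -> 0 <= y ->
  pow0 (x * y) g = pow0 x g * pow0 y g.
Proof.
move=> x0 y0; rewrite /Defs.powR0 mulf_eq0.
have [_|x1] /= := eqVneq x 0; first by rewrite mul0r.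
by have [_|y1] := eqVneq y 0; rewrite ?mulr0// powRM.
Qed.

Lemma le_pow0 (R : realType) (x y g : R) : 0 <= g -> 0 <= x -> x <= y ->
  pow0 x g <= pow0 y g.
Proof.
move=> g0 x0 xy; rewrite /Defs.powR0.
have [_|x1] := eqVneq x 0; first by rewrite -/(pow0 y g) pow0_ge0.
rewrite gt_eqF ?(lt_le_trans _ xy) ?lt0r ?x1//.
by rewrite ge0_ler_powR ?nnegrE// (le_trans x0).
Qed.

Lemma ratio_within_pow0 (R : realType) (c x y s : R) :
  0 <= s <= 1 -> 0 <= c -> 0 <= x -> 0 <= y ->
  ratio_within c x y -> ratio_within c (pow0 x s) (pow0 y s).
Proof.
move=> /andP[s0 s1] c0.
suff H (a b : R) : 0 <= a -> 0 <= b -> a <= expR c * b ->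
    pow0 a s <= expR c * pow0 b s.
  by move=> x0 y0 [h1 h2]; split; apply: H.
move=> a0 b0 /(le_pow0 s0 a0) /le_trans; apply.
rewrite pow0M ?expR_ge0//; apply: ler_wpM2r; first exact: pow0_ge0.
by rewrite /Defs.powR0 gt_eqF ?expR_gt0// /powR gt_eqF ?expR_gt0// expRK ler_expR ler_piMl.
Qed.

(* A child of [u] of at most average mass exists at each step, so the total
   mass stays below 1 along a whole branch. *)
Lemma light_branch (R : realType) (M : nat -> nat) (m : nat -> seq nat -> R) :
    (forall k, 0 < M k)%N -> (forall i u, 0 <= m i u) ->
    (forall i u, \sum_(c < M (size u)) m i (rcons u (c : nat)) = (M (size u))%:R * m i u) ->
    (\sum_(0 <= i <oo) (m i [::])%:E < 1)%E ->
  exists w : nat -> nat, (forall k, w k < M k)%N /\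
    forall i k, m i (mkseq w k) < 1.
Proof.
move=> M0 m0 mE m1.
pose S u := (\sum_(0 <= i <oo) (m i u)%:E)%E.
have step u : (S u < 1)%E -> exists c, (c < M (size u))%N /\ (S (rcons u c) < 1)%E.
  move=> Su; apply: contrapT => H.
  have H1 (c : 'I_(M (size u))) : (1 <= S (rcons u (c : nat)))%E.
    by rewrite leNgt; apply/negP => hc; apply: H; exists c.
  have : ((M (size u))%:R%:E <= \sum_(c < M (size u)) S (rcons u (c : nat)))%E.
    rewrite -[X in (X%:R)%R]card_ord -sum1_card natr_sum -sumEFin.
    by apply: lee_sum => c _; exact: H1.
  rewrite /S -nneseries_sum; last by move=> i j; rewrite lee_fin.
  under eq_eseriesr do rewrite sumEFin mE EFinM.
  rewrite nneseriesZl; last by move=> i _; rewrite lee_fin.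
  rewrite -/(S u) leNgt => /negP; apply.
  by rewrite -[ltRHS]mule1 lte_pmul2l// lte_fin ltr0n.
pose nx u := xget 0%N [set c | (c < M (size u))%N /\ (S (rcons u c) < 1)%E].
pose U k := iter k (fun u => rcons u (nx u)) [::].
have nxP u : (S u < 1)%E -> (nx u < M (size u))%N /\ (S (rcons u (nx u)) < 1)%E.
  by move=> hu; exact: (xgetPex 0%N (step u hu)).
have sU k : size (U k) = k by elim: k => //= k IH; rewrite size_rcons IH.
have SU k : (S (U k) < 1)%E by elim: k => //= k /nxP[].
pose w k := nx (U k).
have Uw k : U k = mkseq w k.
  by elim: k => //= k IH; rewrite -/(U k) mkseqS -IH.
exists w; split=> [k|i k]; first by have [] := nxP _ (SU k); rewrite sU.
rewrite -lte_fin; apply: le_lt_trans (SU k); rewrite Uw /S.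
rewrite (@nneseriesD1 _ _ i)//; last by move=> j _; rewrite lee_fin.
by rewrite leeDl// nneseries_ge0// => j _ _; rewrite lee_fin.
Qed.

(** For the product of the uniform measures on the sets of size [M j], this is the conditional
    probability, given the prefix [u], of the box of words that equal [rho] on [D], when [D] lies
    below [K]. *)
Definition box_mass (R : realType) (M : nat -> nat) (D : pred nat) (K : nat)
    (rho : nat -> nat) (u : seq nat) : R :=
  if all (fun j => D j ==> (nth 0%N u j == rho j)) (iota 0 (size u))
  then \prod_(size u <= j < K | D j) (M j)%:R^-1 else 0.

Lemma box_mass_ge0 (R : realType) M D K rho u : 0 <= box_mass R M D K rho u.
Proof. by rewrite /box_mass; case: ifP => // _; apply: prodr_ge0. Qed.

(** Law of total probability. At a constrained coordinate only the child [rho k] survives and its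
    factor [1 / M k] disappears; at a free one all children have the mass of [u]. *)
Lemma box_mass_children (R : realType) M (D : pred nat) K rho (u : seq nat) :
    (forall k, 0 < M k)%N -> (forall k, D k -> k < K)%N ->
    (forall k, rho k < M k)%N ->
  \sum_(c < M (size u)) box_mass R M D K rho (rcons u (c : nat)) =
    (M (size u))%:R * box_mass R M D K rho u.
Proof.
move=> M0 DK rM; set k := size u.
have E c : box_mass R M D K rho (rcons u c) =
    if all (fun j => D j ==> (nth 0%N u j == rho j)) (iota 0 k) &&
      (D k ==> (c == rho k))
    then \prod_(k.+1 <= j < K | D j) (M j)%:R^-1 else 0.
  rewrite /box_mass size_rcons -/k -addn1 iotaD add0n all_cat /= andbT addn1.
  rewrite nth_rcons ltnn eqxx; congr (if _ && _ then _ else _).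
  apply: eq_in_all => j; rewrite mem_iota add0n => /= jk.
  by rewrite nth_rcons jk.
under eq_bigr do rewrite E.
rewrite /box_mass -/k; case: ifP => _ /=; last by rewrite mulr0 big1.
have [Dk|nDk] := boolP (D k); last first.
  under eq_bigr do rewrite /=.
  rewrite sumr_const card_ord -[LHS]mulr_natl; congr (_ * _).
  have [kK|Kk] := ltnP k K; last by rewrite !big_geq// (leq_trans Kk).
  by rewrite [RHS]big_ltn_cond// (negbTE nDk).
rewrite [in RHS]big_ltn_cond ?DK// Dk mulrA divff ?mul1r; last by rewrite pnatr_eq0 -lt0n.
rewrite (bigD1 (Ordinal (rM k)))//= eqxx -[RHS]addr0; congr (_ + _).
apply: big1 => c /eqP nc.
by case: eqP => // cr; exfalso; apply: nc; exact: val_inj.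
Qed.

(** Boxes of total mass below 1 cannot cover the product. A word in the box [(i, d)] would see
    conditional mass 1 at depth [K i], which the branch given by [light_branch] never does. *)
Lemma box_cover_mass (R : realType) (M : nat -> nat) (B : finType)
    (act : nat -> pred B) (D : nat -> pred nat) (K : nat -> nat)
    (rho : nat -> B -> nat -> nat) :
    (forall k, 0 < M k)%N -> (forall i k, D i k -> k < K i)%N ->
    (forall i d k, act i d -> rho i d k < M k)%N ->
    (\sum_(0 <= i <oo)
      (\sum_(d | act i d) \prod_(j < K i | D i j) (M j)%:R^-1 : R)%:E < 1)%E ->
  exists w : nat -> nat, (forall k, w k < M k)%N /\
    forall i d, act i d -> exists2 k, D i k & w k <> rho i d k.
Proof.
move=> M0 DK rM H.
pose m i u : R := \sum_(d | act i d) box_mass R M (D i) (K i) (rho i d) u.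
have [i u|i u||w [wM hw]] := @light_branch R M m M0.
- by apply: sumr_ge0 => d _; exact: box_mass_ge0.
- rewrite /m exchange_big/= mulr_sumr; apply: eq_bigr => d di.
  by apply: box_mass_children => //; [exact: DK|move=> k; exact: rM].
- rewrite [ltLHS](_ : _ = \sum_(0 <= i <oo)
      (\sum_(d | act i d) \prod_(j < K i | D i j) (M j)%:R^-1 : R)%:E)%E//.
  apply: eq_eseriesr => i _; congr (_%:E); apply: eq_bigr => d _.
  by rewrite /box_mass /= big_mkord.
exists w; split=> // i d di; apply: contrapT => H1.
have := hw i (K i); apply/negP; rewrite -leNgt.
rewrite /m (bigD1 d)//= -[leLHS]addr0 lerD//; last first.
  by apply: sumr_ge0 => d' _; exact: box_mass_ge0.
rewrite /box_mass size_mkseq ifT ?big_geq//.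
apply/allP => j; rewrite mem_iota add0n => /= jK; apply/implyP => Dj.
by rewrite nth_mkseq//; apply/eqP; apply: contrapT => nj; apply: H1; exists j.
Qed.

(* Minimax for piecewise affine functions on [-Q, Q]; the penalty [Q * `|slope|]
   covers the case where the minimum is attained at an endpoint. *)
Lemma minimax_two_lines (R : realType) (I : finType) (E d : I -> R) (Q V : R) :
    0 <= Q ->
    (forall q, `|q| <= Q -> exists i, V <= E i + q * d i) ->
  exists i j (t : R), [/\ 0 <= t <= 1 &
    V <= t * E i + (1 - t) * E j - Q * `|t * d i + (1 - t) * d j|].
Proof.
move=> Q0 H.
have single i : V <= E i - Q * `|d i| -> exists i j (t : R), [/\ 0 <= t <= 1 &
    V <= t * E i + (1 - t) * E j - Q * `|t * d i + (1 - t) * d j|].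
  move=> Vi; exists i, i, 1; rewrite lexx ler01 subrr !mul0r !addr0 !mul1r; split=> //.
have [i hi] : exists i, V <= E i + - Q * d i by apply: H; rewrite normrN ger0_norm.
have [j hj] : exists j, V <= E j + Q * d j by apply: H; rewrite ger0_norm.
have [di|di] := leP 0 (d i); first by apply: (single i); rewrite ger0_norm// -mulNr.
have [dj|dj] := leP (d j) 0; first by apply: (single j); rewrite ler0_norm//; lra.
have ai : d i < 0 /\ exists2 q, - Q <= q & V <= E i + q * d i by split=> //; exists (- Q).
(* The point where line [k] crosses the height [V]: a decreasing line is at least [V] to its left,
   an increasing one to its right. *)
pose x k := (E k - V) / - d k.
have hx k q : d k < 0 -> (V <= E k + q * d k) = (q <= x k).
  by move=> dk; rewrite /x ler_pdivlMr ?oppr_gt0// mulrN lerNl opprB lerBlDl addrC.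
have hy k q : 0 < d k -> (V <= E k + q * d k) = (x k <= q).
  by move=> dk; rewrite /x invrN mulrN -mulNr opprB ler_pdivrMr// lerBlDl.
pose ki := [arg max_(k > i | d k < 0) x k]%O.
have [dki xki] : d ki < 0 /\ forall k, d k < 0 -> x k <= x ki.
  by rewrite /ki; case: arg_maxP.
pose kj := [arg min_(k < j | 0 < d k) x k]%O.
have [dkj xkj] : 0 < d kj /\ forall k, 0 < d k -> x kj <= x k.
  by rewrite /kj; case: arg_minP.
have Qi : - Q <= x ki by apply: le_trans (xki _ di); rewrite -hx.
have Qj : x kj <= Q by apply: le_trans (xkj _ dj) _; rewrite -hy.
have [xx|xx] := leP (x kj) (x ki).
  have h1 : V <= E ki + x ki * d ki by rewrite hx.
  have h2 : V <= E kj + x ki * d kj by rewrite hy.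
  have D0 : 0 < d kj - d ki by lra.
  (* This weight cancels the two slopes, so the mixture is constant. At [x ki] both lines are at
     least [V]. *)
  exists ki, kj, (d kj / (d kj - d ki)).
  have t0 : 0 <= d kj / (d kj - d ki) by rewrite divr_ge0 ?ltW.
  have t1 : d kj / (d kj - d ki) <= 1 by rewrite ler_pdivrMr//; lra.
  split; first by rewrite t0 t1.
  have D1 : d kj - d ki != 0 by rewrite gt_eqF.
  have tE : d kj / (d kj - d ki) * d ki + (1 - d kj / (d kj - d ki)) * d kj = 0 by field.
  rewrite tE normr0 mulr0 subr0.
  move: (d kj / (d kj - d ki)) t0 t1 tE => t t0 t1 tE.
  have : t * V + (1 - t) * V <= t * (E ki + x ki * d ki) + (1 - t) * (E kj + x ki * d kj).
    by apply: lerD; apply: ler_wpM2l => //; lra.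
  have -> : t * (E ki + x ki * d ki) + (1 - t) * (E kj + x ki * d kj) =
    t * E ki + (1 - t) * E kj + x ki * (t * d ki + (1 - t) * d kj) by ring.
  by rewrite tE; lra.
(* strictly between the two crossing points only a horizontal line can reach V *)
pose q := (Num.max (- Q) (x ki) + Num.min Q (x kj)) / 2.
have mx : Num.max (- Q) (x ki) = x ki by rewrite max_r.
have mn : Num.min Q (x kj) = x kj by rewrite min_r.
have [k hk] : exists k, V <= E k + q * d k.
  by apply: H; rewrite /q mx mn ler_norml; apply/andP; split; lra.
have [dk|dk|dk] := ltgtP (d k) 0.
- by move: hk; rewrite hx// => hk; have := xki _ dk; move: hk; rewrite /q mx mn; lra.
- by move: hk; rewrite hy// => hk; have := xkj _ dk; move: hk; rewrite /q mx mn; lra.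
by apply: (single k); move: hk; rewrite dk normr0 !mulr0; lra.
Qed.

(** * Coding of the circle *)

Definition word_real (R : realType) (r : nat) (z : word r) : R :=
  limn (series (fun k => (z k)%:R / r%:R ^+ k.+1 : R)).

Lemma coding_word_real (R : realType) r (z : word r) :
  coding R z = \pi_(circle R) (word_real R z).
Proof. by []. Qed.

Lemma iter_shift r n (z : word r) k : iter n (@wshift r) z k = z (n + k)%N.
Proof. by elim: n z => // n IH z; rewrite iterSr IH /wshift addSn. Qed.

Lemma word_series_ub (R : realType) r (z : word r) n : (2 <= r)%N ->
  series (fun k => (z k)%:R / r%:R ^+ k.+1 : R) n <= 1 - r%:R ^- n.
Proof.
move=> r2; have r0 : 0 < r%:R :> R by rewrite ltr0n (leq_trans _ r2).
elim: n => [|n IH]; first by rewrite /series /= big_geq// expr0 invr1 subrr.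
rewrite seriesSr (le_trans (lerD IH (lexx _)))//.
have zr : (z n)%:R + 1 <= r%:R :> R by rewrite natr1 ler_nat ltn_ord.
have -> : r%:R ^- n = r%:R / r%:R ^+ n.+1 :> R.
  by rewrite exprS invfM mulrA divff ?mul1r// gt_eqF.
have : ((z n)%:R + 1) / r%:R ^+ n.+1 <= r%:R / r%:R ^+ n.+1 :> R.
  by rewrite ler_pM2r// invr_gt0 exprn_gt0.
by rewrite mulrDl mul1r; lra.
Qed.

Lemma word_series_cvg (R : realType) r (z : word r) : (2 <= r)%N ->
  cvgn (series (fun k => (z k)%:R / r%:R ^+ k.+1 : R)).
Proof.
move=> r2; have r0 : 0 < r%:R :> R by rewrite ltr0n (leq_trans _ r2).
apply: nondecreasing_is_cvgn.
  by apply: nondecreasing_series => k _ _; rewrite divr_ge0// exprn_ge0.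
exists 1 => _ [n _ <-]; apply: le_trans (word_series_ub R z n r2) _.
by rewrite gerBl invr_ge0 exprn_ge0// ltW.
Qed.

Lemma word_real_ge0 (R : realType) r (z : word r) : (2 <= r)%N -> 0 <= word_real R z.
Proof.
move=> r2; apply: limr_ge; first exact: word_series_cvg.
by apply: nearW => n; apply: sumr_ge0 => k _; rewrite divr_ge0// exprn_ge0.
Qed.

Lemma word_real_le1 (R : realType) r (z : word r) : (2 <= r)%N -> word_real R z <= 1.
Proof.
move=> r2; apply: limr_le; first exact: word_series_cvg.
apply: nearW => n; apply: le_trans (word_series_ub R z n r2) _.
by rewrite gerBl invr_ge0 exprn_ge0.
Qed.

Lemma word_real_shift (R : realType) r (z : word r) : (2 <= r)%N ->
  word_real R z = ((z 0%N)%:R + word_real R (wshift z)) / r%:R.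
Proof.
move=> r2; have r0 : r%:R != 0 :> R by rewrite pnatr_eq0 -lt0n (leq_trans _ r2).
have /cvg_ex[l zl] := @word_series_cvg R r z r2.
have /cvg_ex[l' zl'] := @word_series_cvg R r (wshift z) r2.
rewrite /word_real (cvg_lim _ zl)// (cvg_lim _ zl')//.
have {}zl : series (fun k => (z k)%:R / r%:R ^+ k.+1 : R) n.+1 @[n --> \oo] --> l.
  by move: zl; rewrite -cvg_shiftS.
apply: (cvg_unique _ zl); first exact: norm_hausdorff.
have -> : (fun n => series (fun k => (z k)%:R / r%:R ^+ k.+1 : R) n.+1) =
   (fun n => ((z 0%N)%:R + series (fun k => (wshift z k)%:R / r%:R ^+ k.+1) n) / r%:R).
  apply/funext => n; rewrite /series /= big_nat_recl// mulrDl expr1; congr (_ + _).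
  by rewrite mulr_suml; apply: eq_bigr => k _; rewrite -mulrA -invfM -exprSr.
by apply: cvgMl; apply: cvgD => //; exact: cvg_cst.
Qed.

Fixpoint prefix_val r (n : nat) (z : word r) : nat :=
  if n is n'.+1 then (prefix_val n' z * r + z n')%N else 0%N.

Lemma word_real_prefix (R : realType) r n (z : word r) : (2 <= r)%N ->
  word_real R z * r%:R ^+ n =
    (prefix_val n z)%:R + word_real R (iter n (@wshift r) z).
Proof.
move=> r2; have r0 : r%:R != 0 :> R by rewrite pnatr_eq0 -lt0n (leq_trans _ r2).
elim: n => [|n IH]; first by rewrite mulr1 add0r.
rewrite exprSr mulrA IH (word_real_shift R (iter n _ z))// iter_shift addn0 /=.
by rewrite natrD natrM; field.
Qed.

Lemma prefix_val_lt r n (z : word r) : (prefix_val n z < r ^ n)%N.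
Proof.
elim: n => //= n IH; rewrite expnSr -ltn_divLR; last first.
  by apply: leq_ltn_trans (ltn_ord (z n)).
have r0 : (0 < r)%N by apply: leq_ltn_trans (ltn_ord (z n)).
by rewrite divnMDl// divn_small ?addn0.
Qed.

Lemma prefix_val_inj r n (z z' : word r) : prefix_val n z = prefix_val n z' ->
  forall k, (k < n)%N -> z k = z' k.
Proof.
elim: n => //= n IH E.
have r0 : (0 < r)%N by apply: leq_ltn_trans (ltn_ord (z n)).
have E1 : prefix_val n z = prefix_val n z'.
  by have := congr1 (divn^~ r) E; rewrite !divnMDl// !divn_small ?addn0.
have E2 : z n = z' n.
  by apply: val_inj; have := congr1 (modn^~ r) E; rewrite !modnMDl !modn_small.
move=> k; rewrite ltnS leq_eqVlt => /predU1P[->//|]; exact: IH.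
Qed.

Lemma eq_prefix_val r n (z z' : word r) :
  (forall k, (k < n)%N -> z k = z' k) -> prefix_val n z = prefix_val n z'.
Proof.
elim: n => //= n IH E; rewrite IH ?E// => k kn; apply: E.
exact: ltn_trans kn (ltnSn n).
Qed.

Lemma pi_circle_nat (R : realType) (n : nat) : \pi_(circle R) n%:R = 0.
Proof.
rewrite -(pi_circle0 R); apply/eqP; rewrite -Quotient.idealrBE subr0.
by rewrite unfold_in; exact: natr_int.
Qed.

Lemma pi_circleMn (R : realType) (t : R) n :
  \pi_(circle R) (t *+ n) = \pi_(circle R) t *+ n.
Proof. by elim: n => [|n IH]; rewrite ?pi_circle0// !mulrS pi_circleD IH. Qed.

Lemma coding_shift (R : realType) r (z : word r) : (2 <= r)%N ->
  coding R (wshift z) = coding R z *+ r.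
Proof.
move=> r2; have r0 : r%:R != 0 :> R by rewrite pnatr_eq0 -lt0n (leq_trans _ r2).
rewrite !coding_word_real (word_real_shift R z)// -pi_circleMn -[(_ / _) *+ _]mulr_natr.
by rewrite divfK// pi_circleD pi_circle_nat add0r.
Qed.

Lemma mdist_pi (R : realType) (t u : R) :
  mdist (\pi_(circle R) t : circle R) (\pi_(circle R) u : circle R) <= `|t - u|.
Proof. by apply: circle_dist_le; rewrite pi_circleD pi_circleN. Qed.

(** After multiplication by r^n the two reals have the same prefix integer and remainders in
    [0, 1]. *)
Lemma mdist_coding (R : realType) r n (z z' : word r) : (2 <= r)%N ->
  (forall k, (k < n)%N -> z k = z' k) ->
  mdist (coding R z) (coding R z') <= r%:R ^- n.
Proof.
move=> r2 E; have r0 : 0 < r%:R ^+ n :> R by rewrite exprn_gt0// ltr0n (leq_trans _ r2).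
apply: (le_trans (@mdist_pi R _ _)); rewrite -[leRHS]mul1r ler_pdivlMr//.
rewrite -[X in `|_| * X]gtr0_norm// -normrM mulrBl !word_real_prefix//.
rewrite (eq_prefix_val E) opprD addrACA subrr add0r ler_norml.
have := word_real_ge0 R (iter n (@wshift r) z) r2.
have := word_real_ge0 R (iter n (@wshift r) z') r2.
have := word_real_le1 R (iter n (@wshift r) z) r2.
have := word_real_le1 R (iter n (@wshift r) z') r2.
by move=> *; apply/andP; split; lra.
Qed.

Lemma mdist_circle_half (R : realType) (x y : circle R) : mdist x y <= 2^-1.
Proof.
set t := repr (x - y); pose u := t - (Num.floor (t + 2^-1))%:~R.
have fl := floor_itv (t + 2^-1); have := fl => /andP[h1 h2].
apply: (@le_trans _ _ `|u|); last first.
  by rewrite ler_norml; move: h1 h2; rewrite intrD /u => h1 h2; apply/andP; split; lra.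
apply: circle_dist_le; rewrite /u -[RHS]reprK; apply/eqP.
rewrite -Quotient.idealrBE unfold_in addrAC subrr add0r rpredN; exact: intr_int.
Qed.

(** Lifted to the line and scaled by r^n, the points differ by less than 2 modulo r^n, and the two
    remainders add at most 1. So the prefix integers differ by at most 2 modulo r^n; the shift by 3
    keeps [d] a natural number. *)
Lemma close_coding_prefix (R : realType) r n (z z' : word r) : (2 <= r)%N ->
  mdist (coding R z) (coding R z') <= r%:R ^- n ->
  exists d : 'I_6, (prefix_val n z + 3 = prefix_val n z' + d %[mod r ^ n])%N.
Proof.
move=> r2 h; have r0 : 0 < r%:R ^+ n :> R by rewrite exprn_gt0// ltr0n (leq_trans _ r2).
have ri0 : 0 < r%:R ^- n :> R by rewrite invr_gt0.
(* The distance is an infimum, so a representative is taken with error r^-n; this gives the bound 2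
   r^-n on [t]. *)
have [t tE tlt] := circle_dist_adherent (coding R z) (coding R z') ri0.
have : word_real R z - word_real R z' - t \is a Num.int.
  have /eqP : \pi_(circle R) (word_real R z - word_real R z') = \pi_(circle R) t.
    by rewrite tE pi_circleD pi_circleN.
  by rewrite -Quotient.idealrBE.
move=> /intrP[m mE].
have tr : `|t * r%:R ^+ n| < 2.
  rewrite normrM (gtr0_norm r0) -ltr_pdivlMr// (lt_le_trans tlt)//.
  by rewrite mulrDl mul1r lerD2r.
have := word_real_ge0 R (iter n (@wshift r) z) r2.
have := word_real_ge0 R (iter n (@wshift r) z') r2.
have := word_real_le1 R (iter n (@wshift r) z) r2.
have := word_real_le1 R (iter n (@wshift r) z') r2.
have := word_real_prefix R n z r2; have := word_real_prefix R n z' r2.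
set a' := word_real R (iter n _ z'); set a := word_real R (iter n _ z).
move=> E' E a'1 a1 a'0 a0.
pose e : int := (prefix_val n z)%:Z - (prefix_val n z')%:Z - m * (r ^ n)%:Z.
have eE : e%:~R = t * r%:R ^+ n + a' - a :> R.
  rewrite /e !rmorphB rmorphM /= -mE -[((r ^ n)%:Z)%:~R]/((r ^ n)%:R : R).
  rewrite -[((prefix_val n z)%:Z)%:~R]/((prefix_val n z)%:R : R).
  rewrite -[((prefix_val n z')%:Z)%:~R]/((prefix_val n z')%:R : R).
  by rewrite natrX !mulrBl E E'; ring.
have : `|e%:~R : R| < 3%:~R.
  by move: tr; rewrite eE !ltr_norml => /andP[h1 h2]; apply/andP; split; lra.
rewrite -intr_norm ltr_int => e3.
have d6 : (absz (e + 3)%R < 6)%N by lia.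
exists (Ordinal d6) => /=; apply: (@can_inj _ _ Posz absz) => //.
rewrite -!modz_nat -[RHS](modzMDl m); congr (_ %% _)%Z.
have : (absz (e + 3)%R)%:Z = e + 3 by lia.
by rewrite !PoszD => ->; rewrite /e; ring.
Qed.

(** * Bounded distortion from the Dini condition *)

(* Integrals of nonnegative functions are suprema over simple functions below,
   so monotonicity needs no measurability. *)
Lemma ge0_le_integral_nonmeasurable d (T : measurableType d) (R : realType)
    (mu : {measure set T -> \bar R}) (D : set T) (f g : T -> \bar R) :
    (forall x, D x -> 0 <= f x)%E -> (forall x, D x -> f x <= g x)%E ->
  (\int[mu]_(x in D) f x <= \int[mu]_(x in D) g x)%E.
Proof.
move=> f0 fg; rewrite !(integral_mkcond D) !ge0_integralTE.
- apply: le_ereal_sup => _ [h hf <-]; exists h => // x.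
  by apply: le_trans (hf x) _; apply: lee_restrict.
- by move=> x; apply: erestrict_ge0 => t Dt; apply: le_trans (f0 _ Dt) (fg _ Dt).
- by move=> x; apply: erestrict_ge0.
Qed.

Lemma modulus_ge0 (R : realType) (X : metricType R) (K : set X) (f : X -> R) z e :
  K z -> 0 <= e -> (0 <= modulus K f e)%E.
Proof.
move=> Kz e0; apply: ereal_sup_ubound; exists (z, z) => /=; last by rewrite subrr normr0.
by split=> //; rewrite mdistxx.
Qed.

Lemma le_modulus (R : realType) (X : metricType R) (K : set X) (f : X -> R) e e' :
  e <= e' -> (modulus K f e <= modulus K f e')%E.
Proof.
move=> ee; apply: le_ereal_sup => _ [p [K1 K2 h] <-]; exists p => //.
by split=> //; exact: le_trans h ee.
Qed.

(** The sum is the integral of the step function [G] equal to [v n / x n] on ]x_(n+1), x_n]. There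
    the modulus is at least [v n] and 1/e is at least [1 / x n], so [G] lies below the Dini
    integrand. *)
Lemma dini_step (R : realType) (X : metricType R) (K : set X) (f : X -> R) z
    (x v : nat -> R) (N : nat) :
    K z -> (forall n m, (n <= m)%N -> x m <= x n) -> x 0%N <= 1 -> (forall n, 0 < x n) ->
    (forall n, 0 <= v n) ->
    (forall n, (n < N)%N -> ((v n)%:E <= modulus K f (x n.+1))%E) ->
  ((\sum_(n < N) v n * (x n - x n.+1) / x n)%:E <=
    \int[lebesgue_measure]_(e in `[0%R, 1%R]) (modulus K f e * e^-1%:E))%E.
Proof.
move=> Kz xm x1 x0 v0 vN.
pose I n : set R := `]x n.+1, x n]%classic.
have I01 n : I n `<=` `[0%R, 1%R]%classic.
  move=> e; rewrite /I /= !in_itv /= => /andP[h1 h2].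
  by rewrite (ltW (lt_trans (x0 _) h1)) /= (le_trans h2)// (le_trans _ x1)// xm.
pose G (e : R) := (\sum_(n < N) (v n / x n * \1_(I n) e)%:E)%E.
have w0 n : 0 <= v n / x n by rewrite divr_ge0// ltW.
have -> : (\sum_(n < N) v n * (x n - x n.+1) / x n)%:E =
    (\int[lebesgue_measure]_(e in `[0%R, 1%R]) G e)%E.
  rewrite /G ge0_integral_sum//; last 2 first.
    move=> n; apply/measurable_EFinP; apply: measurable_funM; first exact: measurable_cst.
    by apply: measurable_indic; exact: measurable_itv.
    by move=> n e _; rewrite lee_fin mulr_ge0.
  rewrite -sumEFin; apply: eq_bigr => n _.
  under eq_integral do rewrite EFinM.
  rewrite ge0_integralZl//; last 2 first.
    by apply/measurable_EFinP; apply: measurable_indic; exact: measurable_itv.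
    by rewrite lee_fin.
  rewrite integral_indic; [|exact: measurable_itv|exact: measurable_itv].
  rewrite setIidl; last exact: I01.
  rewrite [X in (_ * X)%E](_ : _ = lebesgue_measure `]x n.+1, x n]%classic)//.
  rewrite lebesgue_measure_itv/= lte_fin.
  case: ltP => xx.
    by rewrite -EFinD -EFinM; congr (_%:E); rewrite mulrAC.
  have -> : x n = x n.+1 by apply/eqP; rewrite eq_le xx xm.
  by rewrite subrr mulr0 mul0r mule0.
apply: ge0_le_integral_nonmeasurable => e.
  by move=> _; rewrite sume_ge0// => n _; rewrite lee_fin mulr_ge0.
rewrite /= in_itv /= => /andP[e0 e1].
have mod0 : (0 <= modulus K f e * e^-1%:E)%E.
  by apply: mule_ge0; [exact: modulus_ge0 Kz _|rewrite lee_fin invr_ge0].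
rewrite /G.
have [[m Im]|nI] := pselect (exists m : 'I_N, I m e); last first.
  rewrite big1// => n _; rewrite indicE memNset ?mulr0// => In.
  by apply: nI; exists n.
rewrite (bigD1 m)//= big1 ?adde0; last first.
  move=> n nm; rewrite indicE memNset ?mulr0//.
  move: Im; rewrite /I /= !in_itv /= => /andP[h1 h2] /andP[h3 h4].
  move: nm; rewrite -val_eqE /= neq_ltn => /orP[] lt.
    by have := xm _ _ lt; rewrite leNgt (lt_le_trans h3 h2).
  by have := xm _ _ lt; rewrite leNgt (lt_le_trans h1 h4).
rewrite indicE mem_set// mulr1 EFinM.
move: Im; rewrite /I /= in_itv /= => /andP[h1 h2].
have ep : 0 < e by apply: lt_trans h1.
apply: lee_pmul; rewrite ?lee_fin ?invr_ge0 ?(ltW (x0 _))//.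
  by apply: le_trans (vN _ _) _ => //; apply: le_modulus; exact: ltW.
by rewrite lef_pV2 ?posrE.
Qed.

Lemma mdist_torus_le (R : realType) (z z' : torus R) (a b : R) :
  mdist z.1 z'.1 <= a -> mdist z.2 z'.2 <= b -> mdist z z' <= a + b.
Proof.
move=> h1 h2; have a0 := le_trans (mdist_ge0 _ _) h1; have b0 := le_trans (mdist_ge0 _ _) h2.
rewrite -[leRHS]ger0_norm ?addr_ge0// -sqrtr_sqr ler_sqrt ?sqr_ge0//.
have m1 := mdist_ge0 z.1 z'.1; have m2 := mdist_ge0 z.2 z'.2.
move: h1 h2 m1 m2; move: (mdist z.1 z'.1) (mdist z.2 z'.2) => u v h1 h2 m1 m2.
nra.
Qed.

Lemma mdist_torus_ge1 (R : realType) (z z' : torus R) : mdist z.1 z'.1 <= mdist z z'.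
Proof.
rewrite -[leLHS]ger0_norm ?mdist_ge0// -sqrtr_sqr ler_sqrt ?addr_ge0 ?sqr_ge0//.
by rewrite lerDl sqr_ge0.
Qed.

Lemma mdist_torus_ge2 (R : realType) (z z' : torus R) : mdist z.2 z'.2 <= mdist z z'.
Proof.
rewrite -[leLHS]ger0_norm ?mdist_ge0// -sqrtr_sqr ler_sqrt ?addr_ge0 ?sqr_ge0//.
by rewrite lerDr sqr_ge0.
Qed.

(** A diameter bound below 1 leaves a part of [0, 1] on which the modulus is the full oscillation;
    the Dini integral then bounds the oscillation. *)
Lemma mdist_torus_diam (R : realType) (z z' : torus R) : mdist z z' <= 3 / 4.
Proof.
have h1 := mdist_circle_half z.1 z'.1; have h2 := mdist_circle_half z.2 z'.2.
have m1 := mdist_ge0 z.1 z'.1; have m2 := mdist_ge0 z.2 z'.2.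
rewrite -[leRHS]ger0_norm// -sqrtr_sqr ler_sqrt ?sqr_ge0//.
move: h1 h2 m1 m2; move: (mdist z.1 z'.1) (mdist z.2 z'.2) => u v h1 h2 m1 m2.
nra.
Qed.

Lemma iter_shift2 r1 r2 n (z : word r1 * word r2) :
  iter n (@shift2 r1 r2) z = (iter n (@wshift r1) z.1, iter n (@wshift r2) z.2).
Proof. by elim: n => [|n IH]; [case: z|rewrite !iterS IH]. Qed.

Lemma symbolic_carpet_shift r1 r2 (A : {set 'I_r1 * 'I_r2}) n z :
  symbolic_carpet A z -> symbolic_carpet A (iter n (@shift2 r1 r2) z).
Proof. by move=> Kz k; rewrite iter_shift2 /= !iter_shift; exact: Kz. Qed.

Definition agree r1 r2 (n : nat) (z z' : word r1 * word r2) :=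
  forall k, (k < n)%N -> z.1 k = z'.1 k /\ z.2 k = z'.2 k.

(** After k shifts, points with n common letters still share n - k letters, so their distances run
    through a geometric sequence of scales. The oscillations at these scales sum to at most a
    constant times the Dini integral. *)
Lemma bounded_distortion (R : realType) (r1 r2 : nat) (A : {set 'I_r1 * 'I_r2})
    (f : torus R -> R) : (2 <= r1)%N -> (r1 <= r2)%N -> dini (carpet R A) f ->
  exists C : R, [/\ 0 <= C,
    forall z z', symbolic_carpet A z -> symbolic_carpet A z' ->
      `|f (coding2 R z) - f (coding2 R z')| <= C &
    forall n z z', symbolic_carpet A z -> symbolic_carpet A z' -> agree n z z' ->
    `|birkhoff_sum (@shift2 r1 r2) (f \o @coding2 R r1 r2) n z -
      birkhoff_sum (@shift2 r1 r2) (f \o @coding2 R r1 r2) n z'| <= C].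
Proof.
move=> hr1 hr12; have hr2 := leq_trans hr1 hr12; rewrite /dini.
have [z0 Kz0|K0] := pselect (exists z, symbolic_carpet A z); last first.
  by exists 0; split=> // [z z' Kz|n z z' Kz]; exfalso; apply: K0; exists z.
case: z0 Kz0 => z0 Kz0.
have cK z : symbolic_carpet A z -> carpet R A (coding2 R z) by exists z.
have carpet0 := cK _ Kz0.
set J := (\int[_]_(_ in _) _)%E => Jfin.
have J0 : (0 <= J)%E.
  apply: integral_ge0 => e; rewrite /= in_itv /= => /andP[e0 _]; apply: mule_ge0.
    exact: modulus_ge0 carpet0 e0.
  by rewrite lee_fin invr_ge0.
have JE : J = (fine J)%:E by rewrite fineK// ge0_fin_numE.
have j0 : 0 <= fine J by rewrite fine_ge0.
move: (fine J) JE j0 => j JE j0 {J0 Jfin}.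
(* One cell ]3/4, 1] of relative length 1/4 gives the factor 4. *)
have osc z z' : symbolic_carpet A z -> symbolic_carpet A z' ->
    `|f (coding2 R z) - f (coding2 R z')| <= 4 * j.
  move=> Kz Kz'; set D := `|_|.
  have := @dini_step R _ (carpet R A) f _ (fun n => if n is 0%N then 1 else 3 / 4)
    (fun=> D) 1 carpet0.
  rewrite -/J JE big_ord1 lee_fin => H.
  have : D * (1 - 3 / 4) / 1 <= j.
    apply: H => //.
    - by case=> [|n] [|m]// _; lra.
    - by case=> [|n]; lra.
    - by move=> n; exact: normr_ge0.
    - move=> n _; apply: ereal_sup_ubound; exists (coding2 R z, coding2 R z') => //=.
      by split; [exact: cK|exact: cK|exact: mdist_torus_diam].
  by rewrite divr1; clear; lra.
pose r : R := r1%:R^-1.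
have r0 : 0 < r1%:R :> R by rewrite ltr0n (leq_trans _ hr1).
have r12 : 2 <= r1%:R :> R by rewrite ler_nat.
have ri0 : 0 < r by rewrite invr_gt0.
have rh : r <= 2^-1 by rewrite lef_pV2 ?posrE.
(* One common letter is given up to absorb the factor 2 from the two coordinates, as 2 r <= 1. *)
have dist_agree n (z z' : word r1 * word r2) : agree n.+2 z z' ->
    mdist (coding2 R z) (coding2 R z') <= r ^+ n.+1.
  move=> ag; have h1 : mdist (coding R z.1) (coding R z'.1) <= r ^+ n.+2.
    by rewrite /r exprVn; apply: mdist_coding => // k /ag[].
  have h2 : mdist (coding R z.2) (coding R z'.2) <= r ^+ n.+2.
    apply: (@le_trans _ _ (r2%:R ^- n.+2)).
      by apply: mdist_coding => // k /ag[].
    rewrite /r -exprVn ler_pXn2r// ?nnegrE ?invr_ge0//.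
    by rewrite lef_pV2 ?posrE ?ltr0n ?(leq_trans _ hr1) ?(leq_trans _ hr2)// ler_nat.
  have := @mdist_torus_le R (coding2 R z) (coding2 R z') _ _ h1 h2; move=> /le_trans; apply.
  rewrite (exprS r n.+1) -mulrDl; apply: ler_piMl; first by rewrite exprn_ge0// ltW.
  by lra.
exists (4 * j + 2 * j); split.
- by lra.
- by move=> z z' Kz Kz'; apply: le_trans (osc _ _ Kz Kz') _; lra.
move=> n z z' Kz Kz' ag; rewrite /birkhoff_sum -sumrB.
case: n ag => [|n] ag; first by rewrite big_ord0 normr0; lra.
(* The terms in reverse order: [v k] compares points with k + 2 common letters. The last term of the
   Birkhoff sum, with a single common letter left, is bounded by [osc]. *)
pose v k : R := `|f (coding2 R (iter (n - k.+1) (@shift2 r1 r2) z)) -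
             f (coding2 R (iter (n - k.+1) (@shift2 r1 r2) z'))|.
rewrite big_ord_recr /= (le_trans (ler_normD _ _))// addrC lerD//.
  by apply: osc; exact: symbolic_carpet_shift.
apply: (le_trans (ler_norm_sum _ _ _)).
rewrite (reindex_inj rev_ord_inj)/=.
rewrite -[leLHS]/(\sum_(i < n) v i).
have := @dini_step R _ (carpet R A) f _ (fun n => r ^+ n) v n carpet0.
rewrite -/J JE lee_fin => H.
have {}H : \sum_(k < n) v k * (r ^+ k - r ^+ k.+1) / r ^+ k <= j.
  apply: H => //.
  - move=> a b ab; apply: ler_wiXn2l => //; first exact: ltW.
    by lra.
  - by move=> k; rewrite exprn_gt0.
  - by move=> k; exact: normr_ge0.
  - move=> k kn; apply: ereal_sup_ubound.
    exists (coding2 R (iter (n - k.+1) (@shift2 r1 r2) z),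
            coding2 R (iter (n - k.+1) (@shift2 r1 r2) z')) => //=.
    split; [by apply: cK; exact: symbolic_carpet_shift..|].
    apply: dist_agree => i ik; rewrite !iter_shift2 /= !iter_shift.
    by apply: ag; lia.
(* Each cell has relative length 1 - r >= 1/2, whence the summand [2 * j] in the constant. *)
have : \sum_(k < n) v k * 2^-1 <= \sum_(k < n) v k * (r ^+ k - r ^+ k.+1) / r ^+ k.
  apply: ler_sum => k _; rewrite -mulrA ler_wpM2l//; first exact: normr_ge0.
  rewrite exprS mulrBl divff ?gt_eqF ?exprn_gt0// mulfK ?gt_eqF ?exprn_gt0//.
  by lra.
by rewrite -mulr_suml; lra.
Qed.

(** * Partition sums *)

Lemma big_cat_tuple (V : nmodType) (T : finType) n m (F : (n + m).-tuple T -> V) :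
  \sum_w F w = \sum_(u : n.-tuple T) \sum_(v : m.-tuple T) F (cat_tuple u v).
Proof.
rewrite pair_big /= (reindex (fun p : n.-tuple T * m.-tuple T => cat_tuple p.1 p.2))//.
apply: onW_bij; apply: inj_card_bij; last first.
  by rewrite card_prod !card_tuple expnD.
move=> [u v] [u' v'] /= /(congr1 val) /= /eqP.
by rewrite eqseq_cat ?size_tuple// => /andP[/eqP/val_inj-> /eqP/val_inj->].
Qed.

Lemma birkhoff_sumD (R : realType) (Z : Type) (S : Z -> Z) (f : Z -> R) n m z :
  birkhoff_sum S f (n + m) z = birkhoff_sum S f n z + birkhoff_sum S f m (iter n S z).
Proof.
rewrite /birkhoff_sum big_split_ord/=; congr (_ + _).
by apply: eq_bigr => k _; rewrite addnC iterD.
Qed.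

Section partition_sums.
Variables (R : realType) (r1 r2 : nat) (A : {set 'I_r1 * 'I_r2}).
Variables (phi : word r1 * word r2 -> R) (a0 : 'I_r1 * 'I_r2) (C : R) (s : R).
Hypothesis a0A : a0 \in A.
Hypothesis C0 : 0 <= C.
Hypothesis s01 : 0 <= s <= 1.

Local Notation S := (birkhoff_sum (@shift2 r1 r2) phi).

Hypothesis distortion : forall n z z', symbolic_carpet A z -> symbolic_carpet A z' ->
  agree n z z' -> `|S n z - S n z'| <= C.

(** Padding with the letter [a0] of [A] selects a point of K in each admissible cylinder. Birkhoff
    sums at this point replace the supremum in [psi], at the cost of a factor at most exp(C). *)
Definition pad2 n (w1 : n.-tuple 'I_r1) (w2 : n.-tuple 'I_r2) : word r1 * word r2 :=
  (fun k => nth a0.1 w1 k, fun k => nth a0.2 w2 k).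

Definition admissible n (w1 : n.-tuple 'I_r1) (w2 : n.-tuple 'I_r2) :=
  [forall k : 'I_n, (tnth w1 k, tnth w2 k) \in A].

Definition log_weight n (w1 : n.-tuple 'I_r1) (w2 : n.-tuple 'I_r2) : R :=
  S n (pad2 w1 w2).

Definition weight q n (w1 : n.-tuple 'I_r1) (w2 : n.-tuple 'I_r2) : R :=
  if admissible w1 w2 then expR (q * log_weight w1 w2) else 0.

(** The sum Z_n(w1), computed at padded points; [partition_sum] is the corresponding a_n(q). *)
Definition fiber_sum q n (w1 : n.-tuple 'I_r1) : R :=
  \sum_(w2 : n.-tuple 'I_r2) weight q w1 w2.

Definition partition_sum q n : R :=
  \sum_(w1 : n.-tuple 'I_r1) pow0 (fiber_sum q w1) s.

Lemma admissibleP n (w1 : n.-tuple 'I_r1) (w2 : n.-tuple 'I_r2) :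
  admissible w1 w2 <-> forall k, (k < n)%N -> (nth a0.1 w1 k, nth a0.2 w2 k) \in A.
Proof.
split=> [/forallP h k kn|h].
  by have := h (Ordinal kn); rewrite !(tnth_nth a0.1) (tnth_nth a0.2).
by apply/forallP => k; rewrite (tnth_nth a0.1) (tnth_nth a0.2) h.
Qed.

Lemma pad2_carpet n (w1 : n.-tuple 'I_r1) (w2 : n.-tuple 'I_r2) :
  admissible w1 w2 -> symbolic_carpet A (pad2 w1 w2).
Proof.
move=> /admissibleP h k /=; have [kn|nk] := ltnP k n; first exact: h.
by rewrite !nth_default ?size_tuple// -surjective_pairing.
Qed.

Lemma weight_ge0 q n (w1 : n.-tuple 'I_r1) (w2 : n.-tuple 'I_r2) :
  0 <= weight q w1 w2.
Proof. by rewrite /weight; case: ifP => // _; exact: expR_ge0. Qed.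

Lemma fiber_sum_ge0 q n (w1 : n.-tuple 'I_r1) : 0 <= fiber_sum q w1.
Proof. by apply: sumr_ge0 => w2 _; exact: weight_ge0. Qed.

Lemma weight_le_fiber_sum q n (w1 : n.-tuple 'I_r1) (w2 : n.-tuple 'I_r2) :
  weight q w1 w2 <= fiber_sum q w1.
Proof.
rewrite /fiber_sum (bigD1 w2)//= lerDl.
by apply: sumr_ge0 => w _; exact: weight_ge0.
Qed.

Lemma fiber_sum_gt0 q n (w1 : n.-tuple 'I_r1) (w2 : n.-tuple 'I_r2) :
  admissible w1 w2 -> 0 < fiber_sum q w1.
Proof.
move=> adm; apply: lt_le_trans (weight_le_fiber_sum q w1 w2).
by rewrite /weight adm expR_gt0.
Qed.

Lemma pow0_fiber_le_partition q n (w1 : n.-tuple 'I_r1) :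
  pow0 (fiber_sum q w1) s <= partition_sum q n.
Proof.
rewrite /partition_sum (bigD1 w1)//= lerDl.
by apply: sumr_ge0 => w _; exact: pow0_ge0.
Qed.

Lemma partition_sum_gt0 q n : 0 < partition_sum q n.
Proof.
pose w1 : n.-tuple 'I_r1 := [tuple of nseq n a0.1].
pose w2 : n.-tuple 'I_r2 := [tuple of nseq n a0.2].
apply: lt_le_trans (pow0_fiber_le_partition q w1).
apply: pow0_gt0; apply: (@fiber_sum_gt0 q n w1 w2).
by apply/admissibleP => k kn; rewrite !nth_nseq kn -surjective_pairing.
Qed.

Lemma log_weight_distortion n (w1 : n.-tuple 'I_r1) (w2 : n.-tuple 'I_r2) z :
    admissible w1 w2 -> symbolic_carpet A z -> agree n z (pad2 w1 w2) ->
  `|S n z - log_weight w1 w2| <= C.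
Proof. by move=> adm Kz; apply: distortion => //; exact: pad2_carpet. Qed.

Lemma cylinder_agree n (w1 : n.-tuple 'I_r1) (w2 : n.-tuple 'I_r2) z :
  (cylinder w1 `*` cylinder w2) z <-> agree n z (pad2 w1 w2).
Proof.
split=> [[h1 h2] k kn|h] /=.
  have := h1 (Ordinal kn); have := h2 (Ordinal kn).
  by rewrite (tnth_nth a0.1) (tnth_nth a0.2).
split=> k; have := h k (ltn_ord k); first by rewrite (tnth_nth a0.1) => -[].
by rewrite (tnth_nth a0.2) => -[].
Qed.

(** On an admissible cylinder log [psi] lies between [log_weight] and [log_weight + C]. On any other
    cylinder both sides vanish, by the convention 0^q = 0. *)
Lemma psi_weight q n (w1 : n.-tuple 'I_r1) (w2 : n.-tuple 'I_r2) :
  ratio_within (`|q| * C) (pow0 (psi A phi w1 w2) q) (weight q w1 w2).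
Proof.
rewrite /psi; set E := [set _ | _ in _].
rewrite /weight; case: ifPn => adm; last first.
  have -> : E = set0.
    rewrite -subset0 => x [z [Kz /cylinder_agree ag] _].
    move/negP: adm; apply; apply/admissibleP => k kn.
    by have [/= <- <-] := ag k kn; exact: Kz.
  by rewrite sup0 /Defs.powR0 eqxx; split; rewrite mulr0.
have Ew : E (expR (log_weight w1 w2)).
  exists (pad2 w1 w2) => //; split; first exact: pad2_carpet.
  by apply/cylinder_agree.
have Eub : ubound E (expR (log_weight w1 w2 + C)).
  move=> _ [z [Kz /cylinder_agree ag] <-]; rewrite ler_expR.
  by have := log_weight_distortion adm Kz ag; rewrite ler_norml => /andP[_]; lra.
have h1 : expR (log_weight w1 w2) <= sup E.
  by apply: ub_le_sup => //; exists (expR (log_weight w1 w2 + C)).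
have h2 : sup E <= expR (log_weight w1 w2 + C).
  by apply: ge_sup => //; exists (expR (log_weight w1 w2)).
have E0 : 0 < sup E by apply: lt_le_trans h1; exact: expR_gt0.
rewrite /Defs.powR0 gt_eqF// /powR gt_eqF//.
apply: ratio_within_expR; rewrite -mulrBr normrM ler_wpM2l//.
have : ln (expR (log_weight w1 w2)) <= ln (sup E) by rewrite ler_ln ?posrE ?expR_gt0.
have : ln (sup E) <= ln (expR (log_weight w1 w2 + C)) by rewrite ler_ln ?posrE ?expR_gt0.
by rewrite !expRK ler_norml => h3 h4; have := C0; move=> *; apply/andP; split; lra.
Qed.

Lemma psi_partition_sum q n :
  ratio_within (`|q| * C)
    (\sum_(w1 : n.-tuple 'I_r1)
       pow0 (\sum_(w2 : n.-tuple 'I_r2) pow0 (psi A phi w1 w2) q) s)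
    (partition_sum q n).
Proof.
have qC : 0 <= `|q| * C by rewrite mulr_ge0.
apply: ratio_within_sum => w1 _; apply: ratio_within_pow0 => //.
- by apply: sumr_ge0 => w2 _; exact: pow0_ge0.
- exact: fiber_sum_ge0.
by apply: ratio_within_sum => w2 _; exact: psi_weight.
Qed.

Lemma admissible_cat n m (u1 : n.-tuple 'I_r1) (u2 : n.-tuple 'I_r2)
    (v1 : m.-tuple 'I_r1) (v2 : m.-tuple 'I_r2) :
  admissible (cat_tuple u1 v1) (cat_tuple u2 v2) = admissible u1 u2 && admissible v1 v2.
Proof.
apply/idP/andP => [/admissibleP h|[/admissibleP h1 /admissibleP h2]].
  split; apply/admissibleP => k kn.
    have := h k (leq_trans kn (leq_addr _ _)).
    by rewrite /= !nth_cat !size_tuple kn.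
  have kn' : (n + k < n + m)%N by rewrite ltn_add2l.
  by have := h _ kn'; rewrite /= !nth_cat !size_tuple ltnNge leq_addr /= addKn.
apply/admissibleP => k kn; rewrite /= !nth_cat !size_tuple.
by case: ltnP => kn'; [exact: h1|apply: h2; rewrite ltn_subLR].
Qed.

(** The n-fold shift of the padded concatenation is exactly the padding of the second word, so only
    the first n terms contribute an error. *)
Lemma log_weight_cat n m (u1 : n.-tuple 'I_r1) (u2 : n.-tuple 'I_r2)
    (v1 : m.-tuple 'I_r1) (v2 : m.-tuple 'I_r2) :
    admissible u1 u2 -> admissible v1 v2 ->
  `|log_weight (cat_tuple u1 v1) (cat_tuple u2 v2) -
    (log_weight u1 u2 + log_weight v1 v2)| <= C.
Proof.
move=> au av; rewrite [X in X - _]/log_weight birkhoff_sumD.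
have -> : iter n (@shift2 r1 r2) (pad2 (cat_tuple u1 v1) (cat_tuple u2 v2)) = pad2 v1 v2.
  rewrite iter_shift2; congr pair; apply/funext => k; rewrite iter_shift /=.
    by rewrite nth_cat size_tuple ltnNge leq_addr /= addKn.
  by rewrite nth_cat size_tuple ltnNge leq_addr /= addKn.
rewrite opprD addrACA subrr addr0; apply: log_weight_distortion => //.
  by apply: pad2_carpet; rewrite admissible_cat au.
by move=> k kn /=; rewrite !nth_cat !size_tuple kn.
Qed.

Lemma weight_cat q n m (u1 : n.-tuple 'I_r1) (u2 : n.-tuple 'I_r2)
    (v1 : m.-tuple 'I_r1) (v2 : m.-tuple 'I_r2) :
  ratio_within (`|q| * C) (weight q (cat_tuple u1 v1) (cat_tuple u2 v2))
    (weight q u1 u2 * weight q v1 v2).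
Proof.
rewrite /weight admissible_cat; case: ifP => [/andP[au av]|].
  rewrite au av -expRD -mulrDr; apply: ratio_within_expR.
  by rewrite -mulrBr normrM ler_wpM2l//; exact: log_weight_cat.
case: (admissible u1 u2) => /= [->|_]; rewrite ?mul0r ?mulr0.
  by split; rewrite mulr0.
by split; rewrite mulr0.
Qed.

Lemma fiber_sum_cat q n m (u1 : n.-tuple 'I_r1) (v1 : m.-tuple 'I_r1) :
  ratio_within (`|q| * C) (fiber_sum q (cat_tuple u1 v1))
    (fiber_sum q u1 * fiber_sum q v1).
Proof.
rewrite /fiber_sum big_cat_tuple big_distrl /=; apply: ratio_within_sum => u2 _.
by rewrite mulr_sumr; apply: ratio_within_sum => v2 _; exact: weight_cat.
Qed.

(** The factor exp(|q| C) of a single weight survives summation over the fibres, does not grow under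
    the power s <= 1, and survives summation over the rows. *)
Lemma partition_sumM q n m :
  ratio_within (`|q| * C) (partition_sum q (n + m))
    (partition_sum q n * partition_sum q m).
Proof.
rewrite /partition_sum big_cat_tuple big_distrl /=; apply: ratio_within_sum => u1 _.
rewrite mulr_sumr; apply: ratio_within_sum => v1 _.
rewrite -pow0M ?fiber_sum_ge0//; apply: ratio_within_pow0 => //.
- by rewrite mulr_ge0.
- exact: fiber_sum_ge0.
- by rewrite mulr_ge0 ?fiber_sum_ge0.
exact: fiber_sum_cat.
Qed.

(** The limit is stated for the sums of [psi] that define [tau], the uniform error bound for the
    padded sums used in all estimates. The two have a bounded ratio, hence the same rate. *)
Lemma partition_sum_rate : exists P : R -> R, forall q,
  (n%:R^-1 * ln (\sum_(w1 : n.-tuple 'I_r1)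
     pow0 (\sum_(w2 : n.-tuple 'I_r2) pow0 (psi A phi w1 w2) q) s)
     @[n --> \oo] --> P q) /\
  (forall n, `|ln (partition_sum q n) - n%:R * P q| <= `|q| * C).
Proof.
suff H q : exists P : R, (n%:R^-1 * ln (\sum_(w1 : n.-tuple 'I_r1)
     pow0 (\sum_(w2 : n.-tuple 'I_r2) pow0 (psi A phi w1 w2) q) s)
     @[n --> \oo] --> P) /\
  (forall n, `|ln (partition_sum q n) - n%:R * P| <= `|q| * C).
  by have [P hP] := choice H; exists P.
have [|P [cvP hP]] := @almost_additive_cvg R (fun n => ln (partition_sum q n)) (`|q| * C).
  move=> n m; rewrite -addrA -opprD -lnM ?posrE ?partition_sum_gt0//.
  apply: ratio_within_ln; rewrite ?mulr_gt0 ?partition_sum_gt0//.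
  exact: partition_sumM.
exists P; split; last exact: hP.
set u := (X in X @ _ --> _).
rewrite (_ : u = (fun n => n%:R^-1 * ln (partition_sum q n)) +
    (fun n => u n - n%:R^-1 * ln (partition_sum q n))); last first.
  by apply/funext => n /=; rewrite addrC subrK.
rewrite -[P]addr0; apply: cvgD => //.
have bnd n : `|u n - n%:R^-1 * ln (partition_sum q n)| <= n%:R^-1 * (`|q| * C).
  rewrite /u -mulrBr normrM ger0_norm ?invr_ge0// ler_wpM2l ?invr_ge0//.
  have := psi_partition_sum q n; set T := (X in ratio_within _ X _) => h.
  have a_gt0 := partition_sum_gt0 q n.
  apply: ratio_within_ln => //.
  have [_ h2] := h; have := lt_le_trans a_gt0 h2.
  by rewrite pmulr_rgt0 ?expR_gt0.
apply: norm_cvg0; apply: (@squeeze_cvgr _ _ _ _ (fun=> 0) (fun n => n%:R^-1 * (`|q| * C))).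
- by apply: nearW => n; rewrite normr_ge0 bnd.
- exact: cvg_cst.
rewrite -[X in _ --> X](mul0r (`|q| * C)); apply: cvgMl.
by rewrite -cvg_shiftS; exact: cvg_harmonic.
Qed.

End partition_sums.

(** * Hausdorff measure of limsup sets *)

Lemma diameter_ge0 (R : realType) (X : metricType R) (U : set X) (x : X) :
  U x -> (0 <= diameter U)%E.
Proof. by move=> Ux; apply: ereal_sup_ubound; exists (x, x) => //=; rewrite mdistxx. Qed.

Lemma hausdorff_gauge_ge0 (R : realType) (X : metricType R) (t : R) (U : set X) :
  (0 <= hausdorff_gauge t U)%E.
Proof. by rewrite /hausdorff_gauge; case: ifP => // _; exact: poweR_ge0. Qed.

Lemma hausdorff_gauge_le (R : realType) (X : metricType R) (t d : R) (U : set X) :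
    0 <= t -> 0 <= d -> (diameter U <= d%:E)%E ->
  (hausdorff_gauge t U <= (d `^ t)%:E)%E.
Proof.
move=> t0 d0 Ud; rewrite /hausdorff_gauge; case: ifPn => [_|/set0P[x Ux]].
  by rewrite lee_fin powR_ge0.
have D0 := diameter_ge0 Ux; rewrite -poweR_EFin.
by apply: gt0_ler_poweR; rewrite // in_itv /= ?leey ?andbT ?lee_fin.
Qed.

Lemma geometric_eseries_lty (R : realType) (K rho : R) : 0 <= K -> 0 <= rho < 1 ->
  (\sum_(0 <= n <oo) (K * rho ^+ n)%:E < +oo)%E.
Proof.
move=> K0 /andP[r0 r1]; apply: (@le_lt_trans _ _ (K / (1 - rho))%:E); last exact: ltry.
apply: lime_le.
  by apply: is_cvg_nneseries => n _ _; rewrite lee_fin mulr_ge0// exprn_ge0.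
apply: nearW => n; rewrite sumEFin lee_fin.
have := @geometric_seriesE R K rho; rewrite lt_eqF// => /(_ isT)/(congr1 (@^~ n)).
rewrite /series /= => ->; rewrite ler_pM2r ?invr_gt0 ?subr_gt0//.
by apply: ler_piMr => //; rewrite gerBl exprn_ge0.
Qed.

(** Convergence half of the Borel-Cantelli argument: for every [n0] the sets of level at least [n0]
    cover [E], and their total gauge is a tail of a convergent series. *)
Lemma hausdorff_cantelli (R : realType) (X : metricType R) (E : set X)
    (t : R) (N : nat -> nat) (U : nat -> nat -> set X) (d : nat -> R) :
    0 <= t -> (forall n, 0 <= d n) -> d n @[n --> \oo] --> 0 ->
    (forall n j, (j < N n)%N -> (diameter (U n j) <= (d n)%:E)%E) ->
    (\sum_(0 <= n <oo) ((N n)%:R * d n `^ t)%:E < +oo)%E ->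
    (forall n0 z, E z -> exists n j, [/\ (n0 <= n)%N, (j < N n)%N & U n j z]) ->
  hausdorff_measure t E = 0%E.
Proof.
move=> t0 d0 dcv Ud sumfin EU.
pose w n := ((N n)%:R * d n `^ t)%:E.
have w0 n : (0 <= w n)%E by rewrite lee_fin mulr_ge0// powR_ge0.
have tail : (\sum_(n0 <= n <oo) w n)%E @[n0 --> \oo] --> 0%E.
  by apply: nneseries_tail_cvg.
apply/eqP; rewrite eq_le; apply/andP; split; last first.
  apply: le_ereal_sup_tmp; exists (hausdorff_premeasure t 1 E); first by exists 1 => /=.
  apply: le_ereal_inf_tmp => _ [V _ <-]; apply: nneseries_ge0 => i _ _.
  exact: hausdorff_gauge_ge0.
apply: ge_ereal_sup => _ [e /= e0 <-].
apply/lee_addgt0Pr => eps eps0; rewrite add0e.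
have : \forall n0 \near \oo, (\sum_(n0 <= n <oo) w n < eps%:E)%E.
  apply: (tail [set y | y < eps%:E]%E); apply: open_ereal_lt'.
  by rewrite lte_fin.
move=> [n1 _ tail_n1].
have : \forall n \near \oo, d n <= e.
  have /cvgrPdist_le/(_ _ e0) := dcv; apply: filterS => n.
  by rewrite sub0r normrN ger0_norm.
move=> [n2 _ dn2].
pose n0 := maxn n1 n2.
(* The cover must be a single sequence: indices outside the family get the empty set, of gauge 0,
   and the pairs are enumerated by a bijection with nat. *)
pose V (p : nat * nat) := if (n0 <= p.1)%N && (p.2 < N p.1)%N then U p.1 p.2 else set0.
have /card_set_bijP[f fbij] : ([set: nat] #= [set: nat * nat])%card.
  by rewrite card_eq_sym; exact: card_nat2.
have gV p : (hausdorff_gauge t (V p) <=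
    if (n0 <= p.1)%N && (p.2 < N p.1)%N then (d p.1 `^ t)%:E else 0)%E.
  rewrite /V; case: ifP => [/andP[_ pN]|_].
    by apply: hausdorff_gauge_le => //; exact: Ud.
  by rewrite /hausdorff_gauge eqxx.
apply: (@le_trans _ _ (\sum_(0 <= i <oo) hausdorff_gauge t (V (f i)))%E).
  apply: ereal_inf_lbound; exists (V \o f) => //; split.
    move=> z /(EU n0)[n [j [n0n jN Uz]]].
    have [_ _ /(_ (n, j) I)[i _ fi]] := fbij.
    by exists i => //=; rewrite fi /V /= n0n jN.
  move=> i /=; rewrite /V; case: ifP => [/andP[n0i iN]|_].
    apply: (le_trans (Ud _ _ iN)); rewrite lee_fin; apply: dn2.
    by apply: leq_trans n0i; exact: leq_maxr.
  rewrite /diameter [X in ereal_sup X](_ : _ = set0) ?ereal_sup0 ?leNye//.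
  by rewrite -subset0 => x [p [[]]].
rewrite nneseries_esumT; last by move=> i; exact: hausdorff_gauge_ge0.
rewrite -(reindex_esum _ _ _ (fun p => hausdorff_gauge t (V p)) fbij).
apply: (@le_trans _ _ (\esum_(n in [set: nat]) \esum_(j in [set: nat])
    hausdorff_gauge t (V (n, j)))%E).
  rewrite esum_esum; last by move=> *; exact: hausdorff_gauge_ge0.
  rewrite [leRHS](_ : _ = \esum_(p in [set: nat * nat]) hausdorff_gauge t (V p))%E//.
  rewrite (_ : [set: nat] `*`` (fun=> [set: nat]) = setT); last first.
    by apply/seteqP; split.
  by apply: eq_esum => -[].
apply: (@le_trans _ _ (\esum_(n in [set: nat]) (if (n0 <= n)%N then w n else 0))%E).
  apply: le_esum => n _.
  apply: (@le_trans _ _ (\esum_(j in [set: nat])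
     (if (n0 <= n)%N && (j < N n)%N then (d n `^ t)%:E else 0))%E).
    by apply: le_esum => j _; exact: (gV (n, j)).
  case: ifP => n0n /=; last by rewrite esum1.
  rewrite -nneseries_esumT; last by move=> j; case: ifP => // _; rewrite lee_fin powR_ge0.
  rewrite (nneseries_split 0 (N n)); last by move=> j _; case: ifP => // _; rewrite lee_fin powR_ge0.
  rewrite add0n [X in (_ + X)%E]eseries0 ?adde0; last first.
    by move=> j jN _; rewrite ltnNge jN.
  rewrite big_mkord (eq_bigr (fun=> (d n `^ t)%:E)); last by move=> j _; rewrite ltn_ord.
  by rewrite sumEFin sumr_const card_ord /w lee_fin mulr_natl.
rewrite -nneseries_esumT; last by move=> n; case: ifP.
rewrite (nneseries_split 0 n0); last by move=> n _; case: ifP.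
rewrite big_mkord big1 ?add0e; last by move=> n _; rewrite leqNgt ltn_ord.
apply: (@le_trans _ _ (\sum_(n0 <= n <oo) w n)%E).
  by rewrite add0n; apply: lee_nneseries => n _ //; case: ifP.
by rewrite ltW//; apply: tail_n1; rewrite /= leq_maxl.
Qed.

(* The bounded sequence [g n / n] cannot drop by [e] at every step n -> L n. *)
Lemma mcmullen_ratio (R : realType) (g : nat -> R) (B s e : R) (L : nat -> nat) :
    0 <= B -> 0 < e -> 0 <= s <= 1 -> (forall n, `|g n| <= n%:R * B) ->
    (forall n, (n <= L n)%N) -> (forall n, s * (L n)%:R <= n%:R <= s * (L n).+1%:R) ->
  forall n0, exists2 n, (n0 <= n)%N & - (n%:R * e) <= s * g (L n) - g n.
Proof.
move=> B0 e0 /andP[s0 s1] gB nL sL n0; apply: contrapT => H.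
have {}H n : (n0 <= n)%N -> s * g (L n) < g n - n%:R * e.
  by move=> n0n; rewrite ltNge; apply/negP => h; apply: H; exists n => //; lra.
(* Replacing [s * L n] by [n] costs at most [B], which is at most [n * e / 2] from [n1] on; half of
   the drop is kept. *)
pose n1 := maxn (maxn n0 1%N) (Num.truncn (2 * B / e)).+1.
have n1P n : (n1 <= n)%N -> [/\ (n0 <= n)%N, (0 < n)%N & 2 * B <= n%:R * e].
  rewrite !geq_max => /andP[/andP[h1 h2] h3]; split=> //.
  rewrite -ler_pdivrMr//; apply: ltW; apply: lt_le_trans (truncnS_gt _) _.
  by rewrite ler_nat.
pose f n := g n / n%:R.
have fB n : `|f n| <= B.
  rewrite /f; case: n => [|n]; first by rewrite invr0 mulr0 normr0.
  have p0 : 0 < n.+1%:R :> R by rewrite ltr0n.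
  by rewrite normrM normfV (gtr0_norm p0) ler_pdivrMr// mulrC.
have step n : (n1 <= n)%N -> f (L n) < f n - e / 2.
  move=> /n1P[h1 h2 h3]; have := H n h1.
  have L0 : 0 < (L n)%:R :> R by rewrite ltr0n (leq_trans h2).
  have p0 : 0 < n%:R :> R by rewrite ltr0n.
  have -> : g (L n) = (L n)%:R * f (L n) by rewrite /f mulrC divfK// gt_eqF.
  have -> : g n = n%:R * f n by rewrite /f mulrC divfK// gt_eqF.
  move=> h4; have := fB (L n); rewrite ler_norml => /andP[f1 f2].
  have /andP[a1 a2] := sL n; move: a2; rewrite mulrSr mulrDr mulr1 => a2.
  have key : `|(n%:R - s * (L n)%:R) * f (L n)| <= B.
    rewrite normrM -[leRHS]mul1r ler_pM ?fB//.
    by rewrite ger0_norm; lra.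
  move: key; rewrite ler_norml => /andP[k1 k2].
  have : n%:R * f (L n) < n%:R * (f n - e / 2) by rewrite mulrBr; nra.
  by rewrite ltr_pM2l.
have it k : (n1 <= iter k L n1)%N /\ f (iter k L n1) <= f n1 - k%:R * (e / 2).
  elim: k => [|k [IH1 IH2]]; first by rewrite mul0r subr0.
  rewrite iterS; split; first exact: leq_trans IH1 (nL _).
  by have := step _ IH1; rewrite (mulrSr 1 k) mulrDl mul1r; lra.
(* After this many steps the total drop exceeds 2 B, the largest possible variation of [f]. *)
pose k := (Num.truncn (4 * B / e)).+1.
have kP : 4 * B < k%:R * e by rewrite -ltr_pdivrMr// truncnS_gt.
have [_] := it k; have := fB n1; have := fB (iter k L n1).
by rewrite !ler_norml => /andP[h1 h2] /andP[h3 h4] h5; lra.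
Qed.

(** * Approximate squares and Birkhoff sums *)

(** The number L(n): the largest L with r1^L <= r2^n, which makes the sides r1^-L and r2^-n of an
    approximate square comparable. *)
Definition level (r1 r2 n : nat) := trunc_log r1 (r2 ^ n).

Section levels.
Variables (R : realType) (r1 r2 : nat).
Hypotheses (hr1 : (2 <= r1)%N) (hr12 : (r1 <= r2)%N).

Let r1_gt0 : 0 < r1%:R :> R. Proof. by rewrite ltr0n (leq_trans _ hr1). Qed.
Let hr2 : (2 <= r2)%N. Proof. exact: leq_trans hr12. Qed.
Let r2_gt0 : 0 < r2%:R :> R. Proof. by rewrite ltr0n (leq_trans _ hr2). Qed.

Lemma ln_nat_gt0 (r : nat) : (2 <= r)%N -> 0 < ln r%:R :> R.
Proof. by move=> r2'; rewrite ln_gt0// (ltr_nat _ 1). Qed.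

Local Notation ratio := (ln r1%:R / ln r2%:R : R).

Lemma ln_ratio01 : 0 <= ratio <= 1.
Proof.
have l1 := ln_nat_gt0 hr1; have l2 := ln_nat_gt0 hr2.
rewrite divr_ge0 ?(ltW l1) ?(ltW l2)//= ler_pdivrMr// mul1r.
by rewrite ler_ln ?posrE// ler_nat.
Qed.

Lemma level_bounds n : (r1 ^ level r1 r2 n <= r2 ^ n < r1 ^ (level r1 r2 n).+1)%N.
Proof. by apply: trunc_log_bounds; rewrite ?expn_gt0 ?(leq_trans _ hr2). Qed.

Lemma leq_level n : (n <= level r1 r2 n)%N.
Proof. by apply: trunc_log_max => //; case: n => // n; rewrite leq_exp2r. Qed.

Lemma level_ratio n :
  ratio * (level r1 r2 n)%:R <= n%:R <= ratio * (level r1 r2 n).+1%:R.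
Proof.
have /andP[h1 h2] := level_bounds n.
have l1 := ln_nat_gt0 hr1; have l2 := ln_nat_gt0 hr2.
apply/andP; split.
  rewrite mulrAC ler_pdivrMr//.
  have : ln ((r1 ^ level r1 r2 n)%:R : R) <= ln ((r2 ^ n)%:R : R).
    by rewrite ler_ln ?posrE ?ltr0n ?expn_gt0 ?ler_nat// ?(leq_trans _ hr2) ?(leq_trans _ hr1).
  by rewrite !natrX !lnXn// -[X in X <= _]mulr_natr -[X in _ <= X]mulr_natl.
rewrite mulrAC ler_pdivlMr//.
have : ln ((r2 ^ n)%:R : R) <= ln ((r1 ^ (level r1 r2 n).+1)%:R : R).
  by rewrite ler_ln ?posrE ?ltr0n ?expn_gt0 ?ler_nat// ?(leq_trans _ hr2) ?(leq_trans _ hr1)// ltnW.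
by rewrite !natrX !lnXn// -[X in X <= _]mulr_natl -[X in _ <= X]mulr_natr.
Qed.

End levels.

(** * Prefixes of points of K and their weights *)

Definition word_prefix r n (x : word r) : n.-tuple 'I_r := [tuple x i | i < n].

Lemma nth_word_prefix r n (x : word r) a k : (k < n)%N -> nth a (word_prefix n x) k = x k.
Proof.
by move=> kn; rewrite -[k]/(nat_of_ord (Ordinal kn)) -tnth_nth tnth_mktuple.
Qed.

Lemma word_prefix_eq r n (x y : word r) k :
  word_prefix n x = word_prefix n y -> (k < n)%N -> x k = y k.
Proof.
by move=> xy kn; rewrite -(nth_word_prefix x (x 0%N) kn) xy nth_word_prefix.
Qed.

Lemma iter_coding2 (R : realType) r1 r2 n (z : word r1 * word r2) :
  (2 <= r1)%N -> (2 <= r2)%N ->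
  iter n (@torus_map R r1 r2) (coding2 R z) = coding2 R (iter n (@shift2 r1 r2) z).
Proof.
move=> h1 h2; elim: n => //= n ->; rewrite /torus_map /coding2 /=.
by rewrite !coding_shift.
Qed.

Lemma birkhoff_sum_coding2 (R : realType) r1 r2 (f : torus R -> R) n
    (z : word r1 * word r2) : (2 <= r1)%N -> (2 <= r2)%N ->
  birkhoff_sum (torus_map r1 r2) f n (coding2 R z) =
  birkhoff_sum (@shift2 r1 r2) (f \o @coding2 R r1 r2) n z.
Proof. by move=> h1 h2; apply: eq_bigr => k _; rewrite iter_coding2. Qed.

Section symbolic_estimates.
Variables (R : realType) (r1 r2 : nat) (A : {set 'I_r1 * 'I_r2}).
Variables (phi : word r1 * word r2 -> R) (a0 : 'I_r1 * 'I_r2) (C M s : R).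
Hypothesis a0A : a0 \in A.
Hypothesis s01 : 0 <= s <= 1.

Local Notation S := (birkhoff_sum (@shift2 r1 r2) phi).

Hypothesis distortion : forall n z z', symbolic_carpet A z -> symbolic_carpet A z' ->
  agree n z z' -> `|S n z - S n z'| <= C.
Hypothesis phiM : forall z, symbolic_carpet A z -> `|phi z| <= M.

Lemma agree_prefix n (z : word r1 * word r2) :
  agree n z (pad2 a0 (word_prefix n z.1) (word_prefix n z.2)).
Proof. by move=> k kn /=; rewrite !nth_word_prefix. Qed.

Lemma admissible_prefix n z : symbolic_carpet A z ->
  admissible A (word_prefix n z.1) (word_prefix n z.2).
Proof.
move=> Kz; apply/(admissibleP _ a0) => k kn.
by rewrite !nth_word_prefix//; exact: Kz.
Qed.

Lemma log_weight_prefix n z : symbolic_carpet A z ->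
  `|S n z - log_weight phi a0 (word_prefix n z.1) (word_prefix n z.2)| <= C.
Proof.
move=> Kz; apply: (log_weight_distortion a0A distortion) => //.
  exact: admissible_prefix.
exact: agree_prefix.
Qed.

Lemma birkhoff_bound n z : symbolic_carpet A z -> `|S n z| <= n%:R * M.
Proof.
move=> Kz; apply: (le_trans (ler_norm_sum _ _ _)).
rewrite mulr_natl -[X in _ *+ X]card_ord -sumr_const; apply: ler_sum => k _.
by apply: phiM; exact: symbolic_carpet_shift.
Qed.

Lemma log_weight_bound n (w1 : n.-tuple 'I_r1) (w2 : n.-tuple 'I_r2) :
  admissible A w1 w2 -> `|log_weight phi a0 w1 w2| <= n%:R * M.
Proof. by move=> adm; apply: birkhoff_bound; exact: pad2_carpet. Qed.

(** From below by one admissible word, from above by r2^n words of maximal weight. This is the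
    boundedness that [mcmullen_ratio] requires. *)
Lemma ln_fiber_sum_bound q n (w1 : n.-tuple 'I_r1) (w2 : n.-tuple 'I_r2) :
    admissible A w1 w2 ->
  `|ln (fiber_sum A phi a0 q w1)| <= n%:R * (`|q| * M + ln r2%:R).
Proof.
move=> adm; have Z0 := fiber_sum_gt0 phi a0 q adm.
have r20 : (0 < r2)%N by apply: leq_ltn_trans (ltn_ord a0.2).
have lr0 : 0 <= ln r2%:R :> R by rewrite ln_ge0// ler1n.
have qG (v1 : n.-tuple 'I_r1) (v2 : n.-tuple 'I_r2) : admissible A v1 v2 ->
    `|q * log_weight phi a0 v1 v2| <= n%:R * (`|q| * M).
  by move=> av; rewrite normrM mulrCA ler_wpM2l// log_weight_bound.
rewrite ler_norml; apply/andP; split.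
  have h := weight_le_fiber_sum A phi a0 q w1 w2.
  have W0 : 0 < weight A phi a0 q w1 w2 by rewrite /weight adm expR_gt0.
  have : ln (weight A phi a0 q w1 w2) <= ln (fiber_sum A phi a0 q w1).
    by rewrite ler_ln ?posrE.
  rewrite /weight adm expRK; have := qG _ _ adm; rewrite ler_norml => /andP[h1 _].
  have n0 : 0 <= n%:R * ln r2%:R :> R by rewrite mulr_ge0.
  by rewrite mulrDr; lra.
have : fiber_sum A phi a0 q w1 <= expR (n%:R * (`|q| * M)) *+ (r2 ^ n).
  rewrite -[X in _ *+ (X ^ _)]card_ord -card_tuple -sumr_const.
  apply: ler_sum => v2 _; rewrite /weight; case: ifP => [av|_]; last exact: expR_ge0.
  by rewrite ler_expR; have := qG _ _ av; rewrite ler_norml => /andP[].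
rewrite -[X in _ <= X]mulr_natr natrX => h.
have : ln (fiber_sum A phi a0 q w1) <= ln (expR (n%:R * (`|q| * M)) * r2%:R ^+ n).
  by rewrite ler_ln ?posrE// mulr_gt0 ?expR_gt0 ?exprn_gt0 ?ltr0n.
rewrite lnM ?posrE ?expR_gt0 ?exprn_gt0 ?ltr0n// expRK lnXn ?ltr0n//.
by rewrite -[ln _ *+ _]mulr_natl mulrDr.
Qed.

Variable P : R -> R.
Hypothesis PP : forall q n, `|ln (partition_sum A phi a0 s q n) - n%:R * P q| <= `|q| * C.

(** The prefix of [z] alone contributes about exp(q s S_n z) to the partition sum; it remains to
    take logarithms and divide by n. *)
Lemma pressure_ge q z (b : R) : symbolic_carpet A z ->
  n%:R^-1 * S n z @[n --> \oo] --> b -> q * s * b <= P q.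
Proof.
move=> Kz Sb; have /andP[s0 s1] := s01.
have key n : q * s * S n z - 2 * (`|q| * C) <= n%:R * P q.
  set w1 := word_prefix n z.1; set w2 := word_prefix n z.2.
  have adm : admissible A w1 w2 by exact: admissible_prefix.
  have h1 := weight_le_fiber_sum A phi a0 q w1 w2.
  have h2 := pow0_fiber_le_partition A phi a0 s q w1.
  have W0 : 0 < weight A phi a0 q w1 w2 by rewrite /weight adm expR_gt0.
  have h3 := le_pow0 s0 (ltW W0) h1.
  have W0' := pow0_gt0 s W0.
  have : ln (pow0 (weight A phi a0 q w1 w2) s) <= ln (partition_sum A phi a0 s q n).
    by rewrite ler_ln ?posrE ?(lt_le_trans W0')// ?(le_trans h3)// (le_trans h3 h2).
  rewrite /Defs.powR0 gt_eqF// ln_powR /weight adm expRK.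
  have h4 : `|q * s * (S n z - log_weight phi a0 w1 w2)| <= `|q| * C.
    rewrite normrM normrM (ger0_norm s0) -mulrA ler_wpM2l//.
    by apply: le_trans (log_weight_prefix n Kz); apply: ler_piMl.
  have := PP q n; move: h4; rewrite !ler_norml => /andP[h4 h5] /andP[h6 h7].
  have : q * s * (S n z - log_weight phi a0 w1 w2) =
     q * s * S n z - s * (q * log_weight phi a0 w1 w2) by ring.
  by move=> E; rewrite E in h5; lra.
have Scv : q * s * (n%:R^-1 * S n z) - n%:R^-1 * (2 * (`|q| * C)) @[n --> \oo] --> q * s * b - 0.
  apply: cvgB; first by apply: cvgMr.
  rewrite -[X in _ --> X](mul0r (2 * (`|q| * C))); apply: cvgMl.
  by rewrite -cvg_shiftS; exact: cvg_harmonic.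
rewrite subr0 in Scv; apply: (ler_cvg_to Scv (cvg_cst (P q))).
near=> n.
have n0 : 0 < n%:R :> R by rewrite ltr0n; near: n; exists 1%N.
rewrite -(ler_pM2l n0) mulrBr [_ * (q * s * _)]mulrCA !mulVKf ?gt_eqF//.
Unshelve. all: by end_near.
Qed.

End symbolic_estimates.

(** * Upper bound for the dimension *)

(** By maximality of L, r2^n < r1^(L+1), so the horizontal side r1^-L is at most r1 r2^-n. *)
Lemma mdist_coding2_level (R : realType) (r1 r2 n : nat) (z z' : word r1 * word r2) :
    (2 <= r1)%N -> (r1 <= r2)%N ->
    (forall k, (k < level r1 r2 n)%N -> z.1 k = z'.1 k) ->
    (forall k, (k < n)%N -> z.2 k = z'.2 k) ->
  mdist (coding2 R z) (coding2 R z') <= (r1%:R + 1) * r2%:R ^- n.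
Proof.
move=> hr1 hr12 ag1 ag2; have hr2 := leq_trans hr1 hr12.
have h1 := mdist_coding R hr1 ag1; have h2 := mdist_coding R hr2 ag2.
have := @mdist_torus_le R (coding2 R z) (coding2 R z') _ _ h1 h2; move=> /le_trans; apply.
rewrite mulrDl mul1r lerD2r ler_pdivlMr ?exprn_gt0 ?ltr0n ?(leq_trans _ hr2)//.
rewrite ler_pdivrMl ?exprn_gt0 ?ltr0n ?(leq_trans _ hr1)// -exprSr -!natrX ler_nat.
by have /andP[_ /ltnW] := level_bounds hr1 hr12 n.
Qed.

Section dimension_upper_bound.
Variables (R : realType) (r1 r2 : nat) (A : {set 'I_r1 * 'I_r2}).
Variables (phit : torus R -> R) (a0 : 'I_r1 * 'I_r2) (C M : R).
Hypotheses (hr1 : (2 <= r1)%N) (hr12 : (r1 <= r2)%N).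
Hypothesis a0A : a0 \in A.

Let phi : word r1 * word r2 -> R := phit \o @coding2 R r1 r2.
Let s : R := ln r1%:R / ln r2%:R.
Local Notation S := (birkhoff_sum (@shift2 r1 r2) phi).

Hypothesis distortion : forall n z z', symbolic_carpet A z -> symbolic_carpet A z' ->
  agree n z z' -> `|S n z - S n z'| <= C.
Hypothesis phiM : forall z, symbolic_carpet A z -> `|phi z| <= M.
Variable P : R -> R.
Hypothesis PP : forall q n, `|ln (partition_sum A phi a0 s q n) - n%:R * P q| <= `|q| * C.

Variables (q b t : R).
Hypothesis t0 : 0 <= t.
Hypothesis tq : P q / s - q * b < t * ln r2%:R.

Let L := level r1 r2.
(** A quarter of the gap in [tq]. The threshold for heavy squares uses up 2e, and 2e is left as the
    decay rate of the covering sums. *)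
Let e := (t * ln r2%:R - (P q / s - q * b)) / 4.
Let Z n (w : n.-tuple 'I_r1) := fiber_sum A phi a0 q w.
Let tk n m (u : m.-tuple 'I_r1) : n.-tuple 'I_r1 := word_prefix n (fun k => nth a0.1 u k).

(* The mass that McMullen's measure with cylinder masses
   psi^q Z^(s-1) exp(-n P) gives to an approximate square, up to exp(-L P). *)
Let mass n (uv : (L n).-tuple 'I_r1 * n.-tuple 'I_r2) : R :=
  pow0 (Z uv.1) s * weight A phi a0 q (tk n uv.1) uv.2 / Z (tk n uv.1).

Let heavy n : {set (L n).-tuple 'I_r1 * n.-tuple 'I_r2} :=
  [set uv | expR (n%:R * (q * b - 2 * e)) <= mass uv].

Let e_gt0 : 0 < e. Proof. by rewrite /e divr_gt0// subr_gt0. Qed.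
Let s01 : 0 <= s <= 1. Proof. exact: ln_ratio01. Qed.
Let lr1 : 0 < ln r1%:R :> R. Proof. exact: ln_nat_gt0. Qed.
Let lr2 : 0 < ln r2%:R :> R. Proof. by apply: ln_nat_gt0; exact: leq_trans hr12. Qed.
Let s_gt0 : 0 < s. Proof. by rewrite divr_gt0. Qed.
Let M0 : 0 <= M.
Proof.
apply: le_trans (phiM (z := (fun=> a0.1, fun=> a0.2)) _) => //.
by move=> k /=; rewrite -surjective_pairing.
Qed.

Let mass_ge0 n (uv : (L n).-tuple 'I_r1 * n.-tuple 'I_r2) : 0 <= mass uv.
Proof.
by rewrite /mass divr_ge0 ?mulr_ge0 ?pow0_ge0 ?weight_ge0 ?fiber_sum_ge0.
Qed.

(** Summation over the second word produces the fibre sum in the denominator and leaves Z_L(u)^s. A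
    zero denominator gives mass 0. *)
Let sum_mass n : \sum_uv @mass n uv <= partition_sum A phi a0 s q (L n).
Proof.
rewrite -(pair_bigA _ (fun u v => mass (u, v))) /=; apply: ler_sum => u _.
rewrite /mass /= -mulr_suml -mulr_sumr -/(fiber_sum A phi a0 q (tk n u)) -/(Z (tk n u)).
have [->|Zn0] := eqVneq (Z (tk n u)) 0; first by rewrite mulr0 mul0r pow0_ge0.
by rewrite mulfK.
Qed.

(** Markov's inequality for [mass]. As L(n) differs from n / s by at most 1, replacing L P by n P /
    s costs at most |P|. *)
Let card_heavy n : #|heavy n|%:R <=
  expR (`|P q| + `|q| * C) * expR (n%:R * (P q / s - q * b + 2 * e)).
Proof.
have : #|heavy n|%:R * expR (n%:R * (q * b - 2 * e)) <= partition_sum A phi a0 s q (L n).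
  rewrite mulr_natl -sumr_const; apply: le_trans (sum_mass n).
  rewrite [leRHS](bigID [in heavy n])/= -[leLHS]addr0; apply: lerD.
    by apply: ler_sum => uv; rewrite inE.
  by apply: sumr_ge0 => uv _; exact: mass_ge0.
have lnp : ln (partition_sum A phi a0 s q (L n)) <= n%:R * (P q / s) + `|P q| + `|q| * C.
  have := PP q (L n); rewrite ler_norml => /andP[_ h].
  suff : (L n)%:R * P q <= n%:R * (P q / s) + `|P q| by lra.
  have /andP[a1 a2] : s * (L n)%:R <= n%:R <= s * (L n).+1%:R by exact: level_ratio.
  have -> : n%:R * (P q / s) = n%:R / s * P q by ring.
  rewrite -lerBlDl -mulrBl (le_trans (ler_norm _))// normrM; apply: ler_piMl => //.
  rewrite mulrC -ler_pdivlMr// in a1; rewrite mulrC -ler_pdivrMr// in a2.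
  by rewrite mulrSr in a2; rewrite ler_norml; apply/andP; split; lra.
have Z0 := partition_sum_gt0 phi s a0A q (L n).
rewrite -[X in _ <= X -> _](lnK Z0) => /le_trans h.
move: lnp; rewrite -ler_expR => /h; rewrite -ler_pdivlMr ?expR_gt0// => /le_trans; apply.
by rewrite -expRN -!expRD ler_expR; lra.
Qed.

Let square n (uv : (L n).-tuple 'I_r1 * n.-tuple 'I_r2) : set (torus R) :=
  [set coding2 R z | z in [set z | [/\ symbolic_carpet A z,
     word_prefix (L n) z.1 = uv.1 & word_prefix n z.2 = uv.2]]].

Let diameter_square n (uv : (L n).-tuple 'I_r1 * n.-tuple 'I_r2) :
  (diameter (square uv) <= ((r1%:R + 1) * r2%:R ^- n)%:E)%E.
Proof.
apply: ge_ereal_sup => _ [[x y] [[z [_ h1 h2] <-] [z' [_ h1' h2'] <-]] <-] /=.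
rewrite lee_fin; apply: mdist_coding2_level => //.
  by move=> k kL; apply: (word_prefix_eq _ kL); rewrite h1 h1'.
by move=> k kn; apply: (word_prefix_eq _ kn); rewrite h2 h2'.
Qed.

(** The logarithm of the mass is q S_n + s g(L n) - g(n) up to |q| C. One e pays for the convergence
    of the Birkhoff averages together with this distortion, the other for [mcmullen_ratio], which
    supplies infinitely many suitable n. *)
Let heavy_often z : symbolic_carpet A z -> n%:R^-1 * S n z @[n --> \oo] --> b ->
  forall n0, exists2 n, (n0 <= n)%N & (word_prefix (L n) z.1, word_prefix n z.2) \in heavy n.
Proof.
move=> Kz Sb n0.
have Scv : q * (n%:R^-1 * S n z) - n%:R^-1 * (`|q| * C) @[n --> \oo] --> q * b.
  rewrite -[q * b]subr0; apply: cvgB; first by apply: cvgMr.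
  rewrite -[X in _ --> X](mul0r (`|q| * C)); apply: cvgMl.
  by rewrite -cvg_shiftS; exact: cvg_harmonic.
have : \forall n \near \oo, q * b - e <= q * (n%:R^-1 * S n z) - n%:R^-1 * (`|q| * C).
  by apply: (cvgr_ge _ Scv); rewrite gtrBl.
move=> [n1 _ hn1].
pose g n := ln (Z (word_prefix n z.1)).
have adm n : admissible A (word_prefix n z.1) (word_prefix n z.2) by exact: admissible_prefix.
have gB n : `|g n| <= n%:R * (`|q| * M + ln r2%:R).
  by apply: (ln_fiber_sum_bound a0A phiM q (adm n)).
have B0 : 0 <= `|q| * M + ln r2%:R by rewrite addr_ge0 ?mulr_ge0 ?(ltW lr2).
have [n nn hn] := mcmullen_ratio B0 e_gt0 s01 gB (leq_level hr1 hr12) (level_ratio R hr1 hr12)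
  (maxn (maxn n0 n1) 1%N).
move: nn; rewrite !geq_max => /andP[/andP[n0n n1n] n_gt0]; exists n => //.
have np : 0 < n%:R :> R by rewrite ltr0n.
have hS : n%:R * (q * b - e) <= q * S n z - `|q| * C.
  have := hn1 n n1n; rewrite /= -(ler_pM2l np) => /le_trans; apply.
  by rewrite mulrBr [n%:R * (q * _)]mulrCA !mulVKf ?gt_eqF.
have tkE : tk n (word_prefix (L n) z.1) = word_prefix n z.1.
  apply: eq_from_tnth => k; rewrite !tnth_mktuple nth_word_prefix//.
  by apply: leq_trans (ltn_ord k) _; exact: leq_level.
have Z0 m : 0 < Z (word_prefix m z.1) by exact: fiber_sum_gt0 (adm m).
rewrite inE /mass /= tkE /Defs.powR0 gt_eqF// /powR gt_eqF// -/(g (L n)).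
rewrite -[Z (word_prefix n z.1)]lnK ?posrE// -/(g n) /weight adm -expRN -!expRD ler_expR.
have : `|q * (S n z - log_weight phi a0 (word_prefix n z.1) (word_prefix n z.2))| <= `|q| * C.
  by rewrite normrM ler_wpM2l//; exact: (log_weight_prefix a0A distortion).
rewrite mulrBr ler_norml => /andP[h1 h2].
have -> : n%:R * (q * b - 2 * e) = n%:R * (q * b - e) - n%:R * e by ring.
move: hn hS h1 h2; rewrite -/(L n); lra.
Qed.

Lemma hausdorff_measure_level0 : hausdorff_measure t (birkhoff_level A phit b) = 0%E.
Proof.
have hr2 := leq_trans hr1 hr12.
pose d n : R := (r1%:R + 1) * r2%:R ^- n.
have r2_gt1 : 1 < r2%:R :> R by rewrite (ltr_nat _ 1).
have r2_gt0 : 0 < r2%:R :> R by lra.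
have D0 : 0 < r1%:R + 1 :> R by rewrite ltr_pwDr.
have d_gt0 n : 0 < d n by rewrite mulr_gt0// invr_gt0 exprn_gt0.
pose uv0 n : (L n).-tuple 'I_r1 * n.-tuple 'I_r2 := ([tuple of nseq _ a0.1], [tuple of nseq _ a0.2]).
pose U n j := square (nth (uv0 n) (enum (heavy n)) j).
apply: (@hausdorff_cantelli _ _ _ _ (fun n => #|heavy n|) U d) => //.
- by move=> n; exact: ltW.
- rewrite -[X in _ --> X](mulr0 (r1%:R + 1)); apply: cvgMr.
  rewrite (_ : (fun n => _) = (fun n => r2%:R^-1 ^+ n)); last by apply/funext => n; rewrite exprVn.
  by apply: cvg_expr; rewrite ger0_norm ?invr_ge0 ?(ltW r2_gt0)// invf_lt1.
- by move=> n j _; exact: diameter_square.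
(* The number of heavy squares times their gauge is at most K exp(-2 e n), a geometric series. *)
- pose K := expR (`|P q| + `|q| * C + t * ln (r1%:R + 1)).
  have := @geometric_eseries_lty R K (expR (- (2 * e))) (expR_ge0 _).
  rewrite expR_ge0 expR_lt1 oppr_lt0 mulr_gt0 ?e_gt0// => /(_ isT).
  apply: le_lt_trans; apply: lee_nneseries => n _.
    by move=> _; rewrite lee_fin mulr_ge0 ?powR_ge0.
  rewrite lee_fin (le_trans (ler_wpM2r (powR_ge0 _ _) (card_heavy n)))//.
  rewrite /powR gt_eqF// lnM ?posrE ?invr_gt0 ?exprn_gt0// lnV ?posrE ?exprn_gt0// lnXn//.
  rewrite /K -expRM_natl -!expRD ler_expR -[ln _ *+ n]mulr_natl.
  rewrite -subr_ge0 (_ : _ - _ = 0)//; by rewrite /e; field; rewrite gt_eqF.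
move=> n0 _ [[z Kz <-]].
under eq_fun do rewrite birkhoff_sum_coding2//.
move=> /(heavy_often Kz)/(_ n0)[n n0n uvh].
exists n, (index (word_prefix (L n) z.1, word_prefix n z.2) (enum (heavy n))).
split=> //; first by rewrite cardE index_mem mem_enum.
by rewrite /U nth_index ?mem_enum//; exists z.
Qed.

End dimension_upper_bound.

(** * Homogeneous families of words *)

(** After division by x + y the two fractions lie in ]0, 1], where u <= u^s, and they add up to
    1. *)
Lemma pow0_subadditive (R : realType) (s x y : R) : 0 <= s <= 1 -> 0 <= x -> 0 <= y ->
  pow0 (x + y) s <= pow0 x s + pow0 y s.
Proof.
move=> /andP[s0 s1]; rewrite le_eqVlt => /predU1P[<-|x0].
  by rewrite add0r {2}/Defs.powR0 eqxx add0r.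
rewrite le_eqVlt => /predU1P[<-|y0].
  by rewrite addr0 {3}/Defs.powR0 eqxx addr0.
have xy0 : 0 < x + y by rewrite addr_gt0.
have frac (u : R) : 0 < u -> u <= 1 -> u <= pow0 u s.
  move=> u0 u1; rewrite /Defs.powR0 gt_eqF// /powR gt_eqF// -{1}(lnK u0) ler_expR.
  by have := ln_le0 u1; nra.
have scale (u : R) : 0 < u -> pow0 u s = pow0 (x + y) s * pow0 (u / (x + y)) s.
  by move=> u0; rewrite -pow0M ?divr_ge0 ?(ltW xy0) ?(ltW u0)// mulrC divfK// gt_eqF.
rewrite [in leRHS]scale// (scale y)// -mulrDr.
rewrite -[leLHS]mulr1 ler_wpM2l ?pow0_ge0//.
apply: (@le_trans _ _ (x / (x + y) + y / (x + y))).
  by rewrite -mulrDl divff// gt_eqF.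
by apply: lerD; apply: frac; rewrite ?divr_gt0// ler_pdivrMr// mul1r ?lerDl ?lerDr ltW.
Qed.

Lemma pow0_sum_le (R : realType) (I : Type) (r : seq I) (Q : pred I) (F : I -> R) (s : R) :
    0 <= s <= 1 -> (forall i, 0 <= F i) ->
  pow0 (\sum_(i <- r | Q i) F i) s <= \sum_(i <- r | Q i) pow0 (F i) s.
Proof.
move=> s01 F0; elim: r => [|i r IH]; first by rewrite !big_nil /Defs.powR0 eqxx.
rewrite !big_cons; case: ifP => // _.
apply: (le_trans (pow0_subadditive s01 (F0 i) (sumr_ge0 _ _))) => //.
by rewrite lerD2l.
Qed.

Section blocks.
Variables (R : realType) (r1 r2 : nat) (A : {set 'I_r1 * 'I_r2}).
Variables (phi : word r1 * word r2 -> R) (a0 : 'I_r1 * 'I_r2).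
Hypothesis a0A : a0 \in A.

Local Notation S := (birkhoff_sum (@shift2 r1 r2) phi).

(* Encodes a set of words over A of length [block_len] with homogeneous fibres:
   the words are (block_x a, block_y a b) with a < block_rows, b < block_cols. *)
Record block := Block {
  block_len : nat; block_rows : nat; block_cols : nat;
  block_x : nat -> word r1; block_y : nat -> nat -> word r2 }.

(** [H1] and [H2] bound the logarithmic numbers of rows and of columns from below. The Birkhoff
    estimate concerns every point of K that starts with the word, so it can be applied to any later
    segment of a concatenation. *)
Record good_block (w : block) (B H1 H2 e : R) : Prop := GoodBlock {
  block_rows_ge : expR H1 <= (block_rows w)%:R;
  block_cols_ge : expR H2 <= (block_cols w)%:R;
  block_in : forall a b k, (a < block_rows w)%N -> (b < block_cols w)%N ->
    (block_x w a k, block_y w a b k) \in A;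
  block_x_inj : forall a a', (a < block_rows w)%N -> (a' < block_rows w)%N ->
    (forall k, (k < block_len w)%N -> block_x w a k = block_x w a' k) -> a = a';
  block_y_inj : forall a b b', (a < block_rows w)%N -> (b < block_cols w)%N ->
    (b' < block_cols w)%N ->
    (forall k, (k < block_len w)%N -> block_y w a b k = block_y w a b' k) -> b = b';
  block_birkhoff : forall a b z, (a < block_rows w)%N -> (b < block_cols w)%N ->
    symbolic_carpet A z -> agree (block_len w) z (block_x w a, block_y w a b) ->
    `|S (block_len w) z - B| <= e }.

Lemma good_block_weaken w (B B' H1 H2 H1' H2' e e' : R) :
    good_block w B H1 H2 e -> H1' <= H1 -> H2' <= H2 -> `|B - B'| + e <= e' ->
  good_block w B' H1' H2' e'.
Proof.
case=> h1 h2 hA hx hy hB l1 l2 l3; split=> //.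
- by apply: le_trans h1; rewrite ler_expR.
- by apply: le_trans h2; rewrite ler_expR.
move=> a b z aM bM Kz ag; apply: le_trans l3.
by have := hB a b z aM bM Kz ag; have := ler_distD B (S (block_len w) z) B'; lra.
Qed.

Definition splice r n (x y : word r) : word r := fun k => if (k < n)%N then x k else y (k - n)%N.

(** A pair of rows is coded by one number through quotient and remainder by [block_rows w], and a
    pair of columns likewise. *)
Definition cat_block (v w : block) := Block (block_len v + block_len w)
  (block_rows v * block_rows w) (block_cols v * block_cols w)
  (fun a => splice (block_len v) (block_x v (a %/ block_rows w)) (block_x w (a %% block_rows w)))
  (fun a b => splice (block_len v) (block_y v (a %/ block_rows w) (b %/ block_cols w))
    (block_y w (a %% block_rows w) (b %% block_cols w))).

Lemma splice_inj r n m (x y x' y' : word r) :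
    (forall k, (k < n + m)%N -> splice n x y k = splice n x' y' k) ->
  (forall k, (k < n)%N -> x k = x' k) /\ (forall k, (k < m)%N -> y k = y' k).
Proof.
rewrite /splice => h; split=> k km.
  by have := h k (leq_trans km (leq_addr _ _)); rewrite km.
have := h (n + k)%N; rewrite ltn_add2l => /(_ km).
by rewrite ltnNge leq_addr /= addKn.
Qed.

Lemma good_cat_block v w B H1 H2 e B' H1' H2' e' :
    good_block v B H1 H2 e -> good_block w B' H1' H2' e' ->
  good_block (cat_block v w) (B + B') (H1 + H1') (H2 + H2') (e + e').
Proof.
case=> vr vc vA vx vy vB [wr wc wA wx wy wB].
have wr0 : (0 < block_rows w)%N by rewrite -(ltr0n R) (lt_le_trans _ wr)// expR_gt0.
have wc0 : (0 < block_cols w)%N by rewrite -(ltr0n R) (lt_le_trans _ wc)// expR_gt0.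
split=> /=.
- by rewrite expRD natrM ler_pM ?expR_ge0.
- by rewrite expRD natrM ler_pM ?expR_ge0.
- move=> a b k aM bM; rewrite /splice; case: ifP => _.
    by apply: vA; rewrite ltn_divLR.
  by apply: wA; rewrite ltn_mod.
- move=> a a' aM aM' /splice_inj[h1 h2].
  rewrite (divn_eq a (block_rows w)) (divn_eq a' (block_rows w)).
  by rewrite (vx _ _ _ _ h1) ?ltn_divLR// (wx _ _ _ _ h2) ?ltn_mod.
- move=> a b b' aM bM bM' /splice_inj[h1 h2].
  rewrite (divn_eq b (block_cols w)) (divn_eq b' (block_cols w)).
  by rewrite (vy _ _ _ _ _ _ h1) ?ltn_divLR// (wy _ _ _ _ _ _ h2) ?ltn_mod.
move=> a b z aM bM Kz ag; rewrite birkhoff_sumD.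
have h1 : `|S (block_len v) z - B| <= e.
  apply: (vB (a %/ block_rows w) (b %/ block_cols w))%N; rewrite ?ltn_divLR//.
  move=> k kn; have := ag k (leq_trans kn (leq_addr _ _)).
  by rewrite /splice /= kn.
have h2 : `|S (block_len w) (iter (block_len v) (@shift2 r1 r2) z) - B'| <= e'.
  apply: (wB (a %% block_rows w) (b %% block_cols w))%N; rewrite ?ltn_mod//.
    exact: symbolic_carpet_shift.
  move=> k kn; have kn' : (block_len v + k < block_len v + block_len w)%N by rewrite ltn_add2l.
  have := ag _ kn'; rewrite iter_shift2 /= !iter_shift /splice.
  by rewrite ltnNge leq_addr /= addKn.
by rewrite opprD addrACA (le_trans (ler_normD _ _))// lerD.
Qed.

Lemma good_repeat_block w k B H1 H2 e : good_block w B H1 H2 e ->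
  exists2 v, block_len v = (k * block_len w)%N &
    good_block v (k%:R * B) (k%:R * H1) (k%:R * H2) (k%:R * e).
Proof.
move=> gw; elim: k => [|k [v lv gv]].
  exists (Block 0 1 1 (fun=> fun=> a0.1) (fun=> fun=> fun=> a0.2)); rewrite ?mul0n//.
  split=> /=; rewrite ?mul0r ?expR0//.
  - by move=> a b k _ _; rewrite -surjective_pairing.
  - by move=> [|?] [|?].
  - by move=> a [|?] [|?].
  by move=> a b z _ _ _ _; rewrite /birkhoff_sum big_ord0 subr0 normr0.
exists (cat_block w v); first by rewrite /= lv mulSn.
by rewrite mulrSr -![(k%:R + 1) * _]mulrC !mulrDr !mulr1 ![_ * k%:R]mulrC ![k%:R * _ + _]addrC;
  exact: good_cat_block.
Qed.

End blocks.

(** * Sorting words and rows into types *)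

Section word_types.
Variables (R : realType) (r1 r2 : nat) (A : {set 'I_r1 * 'I_r2}).
Variables (phi : word r1 * word r2 -> R) (a0 : 'I_r1 * 'I_r2) (C M s : R).
Hypothesis a0A : a0 \in A.
Hypothesis s01 : 0 <= s <= 1.

Local Notation S := (birkhoff_sum (@shift2 r1 r2) phi).

Hypothesis distortion : forall n z z', symbolic_carpet A z -> symbolic_carpet A z' ->
  agree n z z' -> `|S n z - S n z'| <= C.
Hypothesis phiM : forall z, symbolic_carpet A z -> `|phi z| <= M.

Variables (N : nat) (eps : R).
Hypotheses (N_gt0 : (0 < N)%N) (eps_gt0 : 0 < eps).

(** [K] and [K'] bound the numbers of weight types and of fibre types independently of [N], so
    choosing a type costs [ln (K * K') / N], which vanishes for long words. *)
Let K := (Num.truncn (2 * M / eps)).+1.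
Let K' := (Num.truncn (ln r2%:R / eps)).+1.
Let NR_gt0 : 0 < N%:R :> R. Proof. by rewrite ltr0n. Qed.
Let Ne_gt0 : 0 < N%:R * eps. Proof. by rewrite mulr_gt0. Qed.
Let M0 : 0 <= M.
Proof.
apply: le_trans (phiM (z := (fun=> a0.1, fun=> a0.2)) _) => //.
by move=> k /=; rewrite -surjective_pairing.
Qed.

(* Words are sorted by their Birkhoff sum, and rows by the number of words of
   each sort above them, both on a logarithmic grid of mesh [N * eps]. *)
Definition weight_type (w1 : N.-tuple 'I_r1) (w2 : N.-tuple 'I_r2) : nat :=
  Num.truncn ((log_weight phi a0 w1 w2 + N%:R * M) / (N%:R * eps)).

Definition type_fiber (w1 : N.-tuple 'I_r1) (b : nat) : {set N.-tuple 'I_r2} :=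
  [set w2 | admissible A w1 w2 && (weight_type w1 w2 == b)].

Definition fiber_type (w1 : N.-tuple 'I_r1) (b : nat) : nat :=
  Num.truncn (ln #|type_fiber w1 b|%:R / (N%:R * eps)).

Definition type_rows (b c : nat) : {set N.-tuple 'I_r1} :=
  [set w1 | (0 < #|type_fiber w1 b|)%N && (fiber_type w1 b == c)].

Lemma truncn_itv_div (x : R) : 0 <= x ->
  (Num.truncn (x / (N%:R * eps)))%:R * (N%:R * eps) <= x <
  (Num.truncn (x / (N%:R * eps))).+1%:R * (N%:R * eps).
Proof.
move=> x0; rewrite -ler_pdivlMr// -ltr_pdivrMr// truncnS_gt andbT.
by rewrite truncn_le divr_ge0// ltW.
Qed.

Lemma weight_typeP (w1 : N.-tuple 'I_r1) (w2 : N.-tuple 'I_r2) : admissible A w1 w2 ->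
  let b := weight_type w1 w2 in
  [/\ (b < K)%N, N%:R * (b%:R * eps - M) <= log_weight phi a0 w1 w2 &
     log_weight phi a0 w1 w2 <= N%:R * (b%:R * eps - M) + N%:R * eps].
Proof.
move=> adm b; have := log_weight_bound a0A phiM adm; rewrite ler_norml => /andP[h1 h2].
have h3 : 0 <= log_weight phi a0 w1 w2 + N%:R * M by lra.
have /andP[h4 h5] := truncn_itv_div h3; rewrite -/(weight_type _ _) -/b in h4 h5.
split.
- rewrite ltnS /b; apply: le_truncn; rewrite ler_pdivrMr//.
  by rewrite (_ : 2 * M / eps * (N%:R * eps) = 2 * (N%:R * M)); [lra|field; rewrite gt_eqF].
- by move: h4; lra.
by move: h5; rewrite mulrSr; lra.
Qed.

Lemma fiber_typeP w1 b : (0 < #|type_fiber w1 b|)%N ->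
  let c := fiber_type w1 b in
  [/\ (c < K')%N, expR (N%:R * (eps * c%:R)) <= #|type_fiber w1 b|%:R &
     #|type_fiber w1 b|%:R <= expR (N%:R * (eps * c.+1%:R))].
Proof.
move=> m0 c; have m1 : 0 < #|type_fiber w1 b|%:R :> R by rewrite ltr0n.
have l0 : 0 <= ln #|type_fiber w1 b|%:R :> R by rewrite ln_ge0// ler1n.
have /andP[h4 h5] := truncn_itv_div l0; rewrite -/(fiber_type _ _) -/c in h4 h5.
have r20 : 0 < r2%:R :> R by rewrite ltr0n (leq_ltn_trans _ (ltn_ord a0.2)).
have lm : ln #|type_fiber w1 b|%:R <= N%:R * ln r2%:R :> R.
  rewrite mulr_natl -lnXn// ler_ln ?posrE ?exprn_gt0// -natrX ler_nat.
  by rewrite -[X in (_ <= X ^ _)%N]card_ord -card_tuple max_card.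
split.
- rewrite ltnS /c; apply: le_truncn; rewrite ler_pdivrMr//.
  by rewrite (_ : ln r2%:R / eps * (N%:R * eps) = N%:R * ln r2%:R); [lra|field; rewrite gt_eqF].
- by rewrite -[leRHS]lnK// ler_expR; lra.
by rewrite -[leLHS]lnK// ler_expR; lra.
Qed.

Lemma fiber_sum_le_types q (w1 : N.-tuple 'I_r1) : fiber_sum A phi a0 q w1 <=
  \sum_(b < K) #|type_fiber w1 b|%:R * expR (N%:R * (q * (b%:R * eps - M) + `|q| * eps)).
Proof.
rewrite /fiber_sum (partition_big (fun w2 => inord (weight_type w1 w2) : 'I_K) xpredT)//=.
apply: ler_sum => b _; rewrite /weight -big_mkcondr /= [leRHS]mulr_natl -sumr_const.
rewrite (eq_bigl [in type_fiber w1 b]); last first.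
  move=> w2; rewrite inE andbC; have [adm|//] := boolP (admissible A w1 w2).
  have [bK _ _] := weight_typeP adm.
  by rewrite -val_eqE /= inordK.
apply: ler_sum => w2; rewrite inE => /andP[adm /eqP wb]; rewrite ler_expR.
have [_ h1 h2] := weight_typeP adm; rewrite wb in h1 h2.
have : `|q * (log_weight phi a0 w1 w2 - N%:R * (b%:R * eps - M))| <= `|q| * (N%:R * eps).
  by rewrite normrM ler_wpM2l// ger0_norm; lra.
by rewrite ler_norml => /andP[_]; lra.
Qed.

Lemma pow0_card_le_types w1 b : pow0 #|type_fiber w1 b|%:R s <=
  \sum_(c < K') (w1 \in type_rows b c)%:R * expR (s * (N%:R * (eps * c.+1%:R))).
Proof.
have sum0 (c : 'I_K') : true -> 0 <= (w1 \in type_rows b c)%:R * expR (s * (N%:R * (eps * c.+1%:R))) :> R.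
  by move=> _; rewrite mulr_ge0 ?expR_ge0.
have [m0|] := posnP #|type_fiber w1 b|.
  by rewrite m0 /Defs.powR0 eqxx sumr_ge0.
move=> m0; have [cK _ h] := fiber_typeP m0.
rewrite (bigD1 (Ordinal cK))//= inE m0 eqxx mul1r -[leLHS]addr0 lerD//; last first.
  by apply: sumr_ge0 => c _; exact: sum0.
have m1 : 0 < #|type_fiber w1 b|%:R :> R by rewrite ltr0n.
rewrite /Defs.powR0 gt_eqF// /powR gt_eqF// ler_expR.
have /andP[s0 _] := s01; apply: ler_wpM2l => //.
by rewrite -ler_expR lnK.
Qed.

(** Subadditivity of x^s moves the power inside the sum over weight types. Each row has one fibre
    type per weight type, and exchanging the sums counts the rows of each pair of types. *)
Lemma partition_sum_le_types q : partition_sum A phi a0 s q N <=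
  \sum_(p : 'I_K * 'I_K') #|type_rows p.1 p.2|%:R * expR (N%:R *
    (s * (eps * p.2.+1%:R) + s * (q * (p.1%:R * eps - M) + `|q| * eps))).
Proof.
have /andP[s0 s1] := s01.
rewrite -(pair_bigA _ (fun (b : 'I_K) (c : 'I_K') => #|type_rows b c|%:R * expR (N%:R *
    (s * (eps * c.+1%:R) + s * (q * (b%:R * eps - M) + `|q| * eps))))) /=.
apply: (@le_trans _ _ (\sum_(w1 : N.-tuple 'I_r1) \sum_(b < K) \sum_(c < K')
    (w1 \in type_rows b c)%:R * expR (N%:R *
    (s * (eps * c.+1%:R) + s * (q * (b%:R * eps - M) + `|q| * eps))))).
  apply: ler_sum => w1 _.
  apply: le_trans (le_pow0 s0 (fiber_sum_ge0 _ _ _ _ _) (fiber_sum_le_types q w1)) _.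
  apply: le_trans (pow0_sum_le _ _ s01 _) _.
    by move=> b; rewrite mulr_ge0 ?expR_ge0.
  apply: ler_sum => b _; rewrite pow0M ?expR_ge0//.
  apply: le_trans (ler_wpM2r (pow0_ge0 _ _) (pow0_card_le_types w1 b)) _.
  rewrite mulr_suml; apply: ler_sum => c _.
  rewrite -mulrA ler_wpM2l// /Defs.powR0 gt_eqF ?expR_gt0// /powR gt_eqF ?expR_gt0//.
  by rewrite expRK -expRD ler_expR; lra.
rewrite exchange_big/=; apply: ler_sum => b _; rewrite exchange_big/=; apply: ler_sum => c _.
rewrite -mulr_suml ler_wpM2r ?expR_ge0//.
rewrite -sum1_card natr_sum [leRHS]big_mkcond /=; apply: ler_sum => w1 _.
by case: (w1 \in _).
Qed.

(** Some pair of types carries at least the average share of the sum. The resulting bound is affine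
    in [q] up to the error in the last bracket. *)
Lemma exists_heavy_type q : exists p : 'I_K * 'I_K', (0 < #|type_rows p.1 p.2|)%N /\
  ln (partition_sum A phi a0 s q N) / N%:R <=
    ln #|type_rows p.1 p.2|%:R / N%:R + s * (eps * p.2%:R)
    + q * (s * (p.1%:R * eps - M)) + (s * eps + s * `|q| * eps + ln (K * K')%:R / N%:R).
Proof.
have Z0 := partition_sum_gt0 phi s a0A q N.
pose F (p : 'I_K * 'I_K') := #|type_rows p.1 p.2|%:R * expR (N%:R *
    (s * (eps * p.2.+1%:R) + s * (q * (p.1%:R * eps - M) + `|q| * eps))).
have KK0 : 0 < (K * K')%:R :> R by rewrite ltr0n.
have [p hp] : exists p, partition_sum A phi a0 s q N <= (K * K')%:R * F p.
  apply: contrapT => H.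
  have lt (p : 'I_K * 'I_K') : F p < partition_sum A phi a0 s q N / (K * K')%:R.
    by rewrite ltNge ler_pdivrMr// mulrC; apply/negP => h; apply: H; exists p.
  have := partition_sum_le_types q; rewrite leNgt => /negP; apply.
  apply: (@lt_le_trans _ _ (\sum_(p : 'I_K * 'I_K') partition_sum A phi a0 s q N / (K * K')%:R)).
    rewrite [ltLHS](bigD1 (ord0, ord0))// [ltRHS](bigD1 (ord0, ord0))//.
    by apply: ltr_leD; [exact: lt|apply: ler_sum => p _; apply: ltW; exact: (lt p)].
  by rewrite sumr_const card_prod !card_ord -[leLHS]mulr_natr divfK// gt_eqF.
have rp : (0 < #|type_rows p.1 p.2|)%N.
  rewrite lt0n; apply/negP => /eqP E; move: hp; rewrite /F E mul0r mulr0.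
  by rewrite leNgt Z0.
exists p; split=> //.
have rR : 0 < #|type_rows p.1 p.2|%:R :> R by rewrite ltr0n.
have : ln (partition_sum A phi a0 s q N) <= ln ((K * K')%:R * F p).
  by rewrite ler_ln ?posrE// mulr_gt0// mulr_gt0// expR_gt0.
rewrite lnM ?posrE ?mulr_gt0 ?expR_gt0// lnM ?posrE ?expR_gt0// expRK => h.
rewrite ler_pdivrMr//; apply: le_trans h _.
rewrite le_eqVlt; apply/orP; left; apply/eqP.
by rewrite (mulrSr 1 p.2); field; rewrite gt_eqF.
Qed.

(** Every row of fibre type [c] carries at least exp(N eps c) words; keeping the same number [m] of
    words in each row makes the fibres homogeneous. *)
Lemma type_block b c : (0 < #|type_rows b c|)%N ->
  exists2 w : block r1 r2, block_len w = N &
  good_block A phi w (N%:R * (b%:R * eps - M)) (ln #|type_rows b c|%:R)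
    (N%:R * (eps * c%:R)) (N%:R * eps + C).
Proof.
move=> rows0.
pose w1 a : N.-tuple 'I_r1 := nth [tuple of nseq N a0.1] (enum (type_rows b c)) a.
pose w2 a j : N.-tuple 'I_r2 := nth [tuple of nseq N a0.2] (enum (type_fiber (w1 a) b)) j.
have w1P a : (a < #|type_rows b c|)%N -> w1 a \in type_rows b c.
  by move=> ha; rewrite -mem_enum mem_nth// -cardE.
have exN : exists n : nat, expR (N%:R * (eps * c%:R)) <= n%:R.
  by exists (Num.truncn (expR (N%:R * (eps * c%:R)))).+1; rewrite ltW// truncnS_gt.
pose m := ex_minn exN.
have [mge mmin] : expR (N%:R * (eps * c%:R)) <= m%:R /\
    forall n : nat, expR (N%:R * (eps * c%:R)) <= n%:R -> (m <= n)%N.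
  by rewrite /m; case: ex_minnP.
have fibm a : (a < #|type_rows b c|)%N -> (m <= #|type_fiber (w1 a) b|)%N.
  move=> /w1P; rewrite inE => /andP[f0 /eqP fc]; apply: mmin.
  by have [_ h _] := fiber_typeP f0; rewrite -fc.
have w2P a j : (a < #|type_rows b c|)%N -> (j < m)%N -> w2 a j \in type_fiber (w1 a) b.
  move=> ha hj; rewrite -mem_enum mem_nth// -cardE.
  exact: leq_trans hj (fibm _ ha).
have adm a j : (a < #|type_rows b c|)%N -> (j < m)%N -> admissible A (w1 a) (w2 a j).
  by move=> ha hj; have := w2P a j ha hj; rewrite inE => /andP[].
exists (Block N #|type_rows b c| m (fun a k => nth a0.1 (w1 a) k)
   (fun a j k => nth a0.2 (w2 a j) k)) => //.
split=> //=.
- by rewrite lnK// posrE ltr0n.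
- by move=> a j k ha hj; exact: (pad2_carpet a0A (adm a j ha hj) k).
- move=> a a' ha ha' h.
  have /eqP : w1 a = w1 a'.
    by apply: eq_from_tnth => k; rewrite !(tnth_nth a0.1) h.
  by rewrite nth_uniq ?enum_uniq// -?cardE// => /eqP.
- move=> a j j' ha hj hj' h.
  have /eqP : w2 a j = w2 a j'.
    by apply: eq_from_tnth => k; rewrite !(tnth_nth a0.2) h.
  have fm := fibm _ ha.
  by rewrite nth_uniq ?enum_uniq// -?cardE ?(leq_trans hj)// ?(leq_trans hj')// => /eqP.
move=> a j z ha hj Kz ag.
have h1 := log_weight_distortion a0A distortion (adm a j ha hj) Kz ag.
have [_ h2 h3] := weight_typeP (adm a j ha hj).
have := w2P a j ha hj; rewrite inE => /andP[_ /eqP tb]; rewrite tb in h2 h3.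
by move: h1; rewrite !ler_norml => /andP[h4 h5]; apply/andP; split; lra.
Qed.

Lemma ln_type_rows_bound b c : (0 < #|type_rows b c|)%N ->
  0 <= ln (#|type_rows b c|%:R : R) <= N%:R * ln r1%:R.
Proof.
move=> rows0; have rR : 0 < #|type_rows b c|%:R :> R by rewrite ltr0n.
have r10 : 0 < r1%:R :> R by rewrite ltr0n (leq_ltn_trans _ (ltn_ord a0.1)).
rewrite ln_ge0 ?ler1n//= mulr_natl -lnXn// ler_ln ?posrE ?exprn_gt0// -natrX ler_nat.
by rewrite -[X in (_ <= X ^ _)%N]card_ord -card_tuple max_card.
Qed.

Lemma fiber_type_bound b c : (0 < #|type_rows b c|)%N -> eps * c%:R <= ln r2%:R.
Proof.
move=> /card_gt0P[w1]; rewrite inE => /andP[m0 /eqP <-].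
have [cK _ _] := fiber_typeP m0.
have r20 : 1 <= r2%:R :> R by rewrite ler1n (leq_ltn_trans _ (ltn_ord a0.2)).
rewrite mulrC -ler_pdivlMr//; apply: le_trans (_ : (Num.truncn (ln r2%:R / eps))%:R <= _).
  by rewrite ler_nat -ltnS.
by rewrite truncn_le divr_ge0 ?ln_ge0// ltW.
Qed.

End word_types.

(** * Parameters and inequalities for mixtures *)

Lemma mix_close (R : realType) (x y t u e b : R) :
    `|u - t| <= e -> `|x| <= b -> `|y| <= b ->
  `|(u * x + (1 - u) * y) - (t * x + (1 - t) * y)| <= 2 * b * e.
Proof.
move=> h1 h2 h3.
have -> : (u * x + (1 - u) * y) - (t * x + (1 - t) * y) = (x - y) * (u - t) by ring.
by rewrite normrM ler_pM// (le_trans (ler_normB _ _))//; lra.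
Qed.

Lemma exists_nat_ge (R : realType) (x : R) : exists2 n : nat, (0 < n)%N & x <= n%:R.
Proof. by exists (Num.truncn x).+1 => //; rewrite ltW// truncnS_gt. Qed.

(** [Q] is so large that the minimax penalty forces the mean deviation below eta / 4; [eps] is so
    small that rounding to types costs at most eta / 4 for all |q| <= Q. *)
Lemma grid_parameters (R : realType) (s E eta : R) : 0 < s -> 0 <= E -> 0 < eta ->
  exists Q eps : R, [/\ 0 < Q, 0 < eps, Q * (s * eta / 4) = E + eta,
    eps * (Q + 1) = eta / 4 & eps <= eta / 4].
Proof.
move=> s0 E0 eta0.
pose Q := 4 * (E + eta) / (s * eta); have Q0 : 0 < Q by rewrite divr_gt0 ?mulr_gt0//; lra.
exists Q, (eta / (4 * (Q + 1))).
have Q1 : Q + 1 != 0 by rewrite gt_eqF//; lra.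
split=> //.
- by rewrite divr_gt0//; lra.
- by rewrite /Q; field; rewrite !gt_eqF.
- by field.
by rewrite ler_pM2l// lef_pV2 ?posrE//; lra.
Qed.

Lemma large_length (R : realType) (x C eta : R) : 0 <= x -> 0 <= C -> 0 < eta ->
  exists N : nat, [/\ (0 < N)%N, x / N%:R <= eta / 4 & C <= N%:R * (eta / 4)].
Proof.
move=> x0 C0 eta0; have [N N0 hN] := exists_nat_ge (4 * (x + C) / eta).
have NR : 0 < N%:R :> R by rewrite ltr0n.
rewrite ler_pdivrMr// in hN; exists N; split=> //; last by lra.
by rewrite ler_pdivrMr//; lra.
Qed.

Lemma floor_ratio (R : realType) (t : R) (k : nat) : 0 <= t <= 1 -> (0 < k)%N ->
  exists2 k1 : nat, (k1 <= k)%N & `|k1%:R / k%:R - t| <= k%:R^-1.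
Proof.
move=> /andP[t0 t1] k0; have kR : 0 < k%:R :> R by rewrite ltr0n.
have tk0 : 0 <= t * k%:R by rewrite mulr_ge0.
have k1a : (Num.truncn (t * k%:R))%:R <= t * k%:R by rewrite truncn_le.
have := truncnS_gt (t * k%:R); rewrite (mulrSr 1) => k1b.
exists (Num.truncn (t * k%:R)); first by rewrite -(ler_nat R) (le_trans k1a)//; apply: ler_piMl.
rewrite -(ler_pM2r kR) mulVf ?gt_eqF// -[X in _ * X <= _](gtr0_norm kR) -normrM mulrBl.
by rewrite divfK ?gt_eqF// ler_norml; apply/andP; split; lra.
Qed.

Lemma convex_itv (R : realType) (t x y B : R) : 0 <= t <= 1 -> 0 <= x <= B -> 0 <= y <= B ->
  0 <= t * x + (1 - t) * y <= B.
Proof. by move=> /andP[t0 t1] /andP[x0 x1] /andP[y0 y1]; apply/andP; split; nra. Qed.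

Lemma convex_norm_le (R : realType) (t u x y D e k : R) :
    0 < k -> `|u - t| <= k^-1 -> `|x| <= D -> `|y| <= D ->
    `|t * x + (1 - t) * y| <= e / 2 -> 4 * D <= k * e ->
  `|u * x + (1 - u) * y| <= e.
Proof.
move=> k0 ut xD yD txy kD; have mix := mix_close ut xD yD.
have : 2 * D * k^-1 <= e / 2 by rewrite ler_pdivrMr//; lra.
by move: mix txy; rewrite !ler_norml => /andP[? ?] /andP[? ?] ?; apply/andP; split; lra.
Qed.

Lemma convex_ge (R : realType) (t u x y E V e k : R) :
    0 < k -> `|u - t| <= k^-1 -> 0 <= x <= E -> 0 <= y <= E ->
    V <= t * x + (1 - t) * y -> 2 * E <= k * e ->
  V - e <= u * x + (1 - u) * y.
Proof.
move=> k0 ut /andP[x0 xE] /andP[y0 yE] txy kE.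
have := mix_close ut (_ : `|x| <= E) (_ : `|y| <= E).
rewrite (ger0_norm x0) (ger0_norm y0) => /(_ xE yE); rewrite ler_norml => /andP[h _].
have : 2 * E * k^-1 <= e by rewrite ler_pdivrMr//; lra.
lra.
Qed.

Lemma weighted_itv (R : realType) (s x y B B' : R) : 0 < s -> s <= 1 ->
  0 <= x <= B -> 0 <= y <= B' -> 0 <= x + s * y <= B + B'.
Proof.
move=> s0 s1 /andP[x0 x1] /andP[y0 y1]; apply/andP; split.
  by rewrite addr_ge0// mulr_ge0// ltW.
by apply: lerD => //; apply: le_trans y1; apply: ler_piMl.
Qed.

Lemma slope_bound (R : realType) (V eta Z W E : R) :
  V - eta / 2 <= Z - W -> Z <= E -> 0 <= V -> 0 < eta -> W <= E + eta.
Proof. lra. Qed.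

Lemma rate_of_cell (R : realType) (V x p1 s p2 m a c : R) :
  V - x <= p1 + s * p2 -> x <= m -> p1 <= a + m -> s * p2 <= s * (c + m) ->
  s * m <= m -> 0 < m -> V - 4 * m <= a + s * c.
Proof. lra. Qed.

Lemma rate_le_div (R : realType) (x p d n : R) : 0 < n -> `|x - n * p| <= d ->
  p <= x / n + d / n.
Proof. by move=> n0; rewrite -mulrDl ler_pdivlMr// ler_norml => /andP[? ?]; lra. Qed.

Lemma heavy_type_line (R : realType) (a L c x M b q s eps nq K qC QC V eta p : R) :
    a <= L + s * c + q * (s * (x - M)) + (s * eps + s * nq * eps + K) -> p <= a + qC ->
    s * eps + s * nq * eps <= eta / 4 -> qC <= QC -> K + QC <= eta / 4 ->
    V <= p - q * s * b ->
  V - eta / 2 <= L + s * c + q * (s * (x - M - b)).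
Proof. lra. Qed.

(** * Near-optimal homogeneous blocks *)

Section near_optimal_blocks.
Variables (R : realType) (r1 r2 : nat) (A : {set 'I_r1 * 'I_r2}).
Variables (phi : word r1 * word r2 -> R) (a0 : 'I_r1 * 'I_r2) (C M s : R).
Hypothesis a0A : a0 \in A.
Hypothesis C0 : 0 <= C.
Hypothesis s0 : 0 < s.
Hypothesis s1 : s <= 1.

Local Notation S := (birkhoff_sum (@shift2 r1 r2) phi).

Hypothesis distortion : forall n z z', symbolic_carpet A z -> symbolic_carpet A z' ->
  agree n z z' -> `|S n z - S n z'| <= C.
Hypothesis phiM : forall z, symbolic_carpet A z -> `|phi z| <= M.
Variable P : R -> R.
Hypothesis PP : forall q n, `|ln (partition_sum A phi a0 s q n) - n%:R * P q| <= `|q| * C.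

Variables (b V : R).
Hypothesis V0 : 0 <= V.
Hypothesis PV : forall q, V <= P q - q * s * b.

Let M0 : 0 <= M.
Proof.
apply: le_trans (phiM (z := (fun=> a0.1, fun=> a0.2)) _) => //.
by move=> k /=; rewrite -surjective_pairing.
Qed.
Let s01 : 0 <= s <= 1. Proof. by rewrite ltW. Qed.
Let lr1 : 0 <= ln r1%:R :> R.
Proof. by rewrite ln_ge0// ler1n (leq_ltn_trans _ (ltn_ord a0.1)). Qed.
Let lr2 : 0 <= ln r2%:R :> R.
Proof. by rewrite ln_ge0// ler1n (leq_ltn_trans _ (ltn_ord a0.2)). Qed.

(** Each type gives an affine function of q with intercept [L + s * c], its entropy rate, and slope
    [s * x], where [x] is its deviation from the average [b]. By [exists_heavy_type] some line
    reaches V - eta/2 for every |q| <= Q, and the minimax lemma extracts two of them. *)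
Lemma optimal_pair (eta : R) : 0 < eta ->
  exists (N : nat) (wi wj : block r1 r2) (t xi xj Li Lj ci cj : R), let n := N%:R in
  [/\ (0 < N)%N /\ 0 <= t <= 1,
    block_len wi = N /\ block_len wj = N,
    good_block A phi wi (n * (b + xi)) (n * Li) (n * ci) (n * (eta / 2)) /\
    good_block A phi wj (n * (b + xj)) (n * Lj) (n * cj) (n * (eta / 2)),
    [/\ 0 <= Li <= ln r1%:R, 0 <= Lj <= ln r1%:R, 0 <= ci <= ln r2%:R & 0 <= cj <= ln r2%:R] &
    [/\ `|xi| <= M + `|b|, `|xj| <= M + `|b|, `|t * xi + (1 - t) * xj| <= eta / 4 &
      V - eta / 2 <= t * (Li + s * ci) + (1 - t) * (Lj + s * cj)]].
Proof.
move=> eta0.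
have E0 : 0 <= ln r1%:R + ln r2%:R :> R by rewrite addr_ge0.
have [Q [eps [Q0 eps0 QE epsE eps_le]]] := grid_parameters s0 E0 eta0.
pose K := (Num.truncn (2 * M / eps)).+1; pose K' := (Num.truncn (ln r2%:R / eps)).+1.
have KK0 : 0 <= ln (K * K')%:R :> R by rewrite ln_ge0// ler1n.
have QC0 : 0 <= Q * C by rewrite mulr_ge0// ltW.
have [N [N0 hN1 hN2]] := large_length (addr_ge0 KK0 QC0) C0 eta0.
have NR : 0 < N%:R :> R by rewrite ltr0n.
pose rows (p : 'I_K * 'I_K') := #|type_rows A phi a0 M N eps p.1 p.2|.
pose I := {p | (0 < rows p)%N}.
pose L (i : I) : R := ln (rows (val i))%:R / N%:R.
pose c (i : I) : R := eps * (val i).2%:R.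
pose x (i : I) : R := (val i).1%:R * eps - M - b.
have Lbnd i : 0 <= L i <= ln r1%:R.
  have /andP[l0 l1] := ln_type_rows_bound (valP i).
  by rewrite divr_ge0//= ler_pdivrMr// [ln r1%:R * _]mulrC.
have cbnd i : 0 <= c i <= ln r2%:R.
  by rewrite mulr_ge0 ?(ltW eps0)//= (fiber_type_bound N0 eps0 (valP i)).
have xbnd i : `|x i| <= M + `|b|.
  apply: (le_trans (ler_normB _ _)); rewrite lerD2r.
  have i0 : 0 <= (val i).1%:R * eps by rewrite mulr_ge0// ltW.
  have i1 : (val i).1%:R * eps <= 2 * M.
    rewrite -ler_pdivlMr//; apply: le_trans (_ : (Num.truncn (2 * M / eps))%:R <= _).
      by rewrite ler_nat -ltnS.
    by rewrite truncn_le divr_ge0 ?mulr_ge0// ltW.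
  by rewrite ler_norml; apply/andP; split; move: i0 i1; lra.
have LN i : ln (rows (val i))%:R = N%:R * L i by rewrite /L [N%:R * _]mulrC divfK// gt_eqF.
have lines q : `|q| <= Q -> exists i, V - eta / 2 <= (L i + s * c i) + q * (s * x i).
  move=> qQ; have [p [p0 hp]] := exists_heavy_type a0A s01 phiM N0 eps0 q.
  exists (exist _ p p0); rewrite /L /c /x /=.
  move: hp; rewrite -/K -/K' -/(rows p).
  set Lp := _ / N%:R; set cp := eps * _; set bp := _ * eps => hp.
  have h2 : P q <= ln (partition_sum A phi a0 s q N) / N%:R + `|q| * C / N%:R.
    exact: rate_le_div.
  have h3 : s * eps + s * `|q| * eps <= eta / 4.
    rewrite -epsE (_ : s * eps + s * `|q| * eps = s * (eps * (`|q| + 1))); last by ring.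
    rewrite -[leRHS]mul1r ler_pM ?mulr_ge0 ?addr_ge0 ?(ltW eps0) ?(ltW s0)//.
    by rewrite ler_pM2l// lerD2r.
  have h4 : `|q| * C / N%:R <= Q * C / N%:R.
    by rewrite ler_wpM2r ?invr_ge0// ler_wpM2r.
  have h5 := PV q; move: hp h2 h3 h4 hN1 h5; rewrite mulrDl.
  exact: heavy_type_line.
have [i [j [t [t01 ht]]]] := minimax_two_lines (ltW Q0) lines.
exists N; have [wi li gi] := type_block a0A distortion phiM N0 eps0 (valP i).
have [wj lj gj] := type_block a0A distortion phiM N0 eps0 (valP j).
exists wi, wj, t, (x i), (x j), (L i), (L j), (c i), (c j); split=> //.
- have tol : N%:R * eps + C <= N%:R * (eta / 2).
    rewrite (_ : N%:R * (eta / 2) = N%:R * (eta / 4) + N%:R * (eta / 4)); last by field.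
    by apply: lerD => //; rewrite ler_pM2l.
  have bx (k : I) : N%:R * ((val k).1%:R * eps - M) = N%:R * (b + x k) by rewrite /x; ring.
  split.
    by apply: good_block_weaken gi _ _ _; rewrite ?LN// bx subrr normr0 add0r.
  by apply: good_block_weaken gj _ _ _; rewrite ?LN// bx subrr normr0 add0r.
have E k := weighted_itv s0 s1 (Lbnd k) (cbnd k).
have /andP[_ E2] := convex_itv t01 (E i) (E j).
move: ht; set X := t * (s * x i) + _.
have -> : X = s * (t * x i + (1 - t) * x j) by rewrite /X; ring.
rewrite normrM gtr0_norm//; set y := `|_|; set Z := _ + _ * (_ + _) in E2 *.
have y0 : 0 <= y by exact: normr_ge0.
move=> ht; split=> //; last first.
  by apply: le_trans ht _; rewrite gerBl; apply: mulr_ge0; [exact: ltW|apply: mulr_ge0 => //; exact: ltW].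
(* The entropy of the mixture is at most ln r1 + ln r2, which bounds the penalty; the choice of [Q]
   turns this into a mean deviation of at most eta / 4. *)
have Qs : 0 < Q * s by rewrite mulr_gt0.
rewrite -(ler_pM2l Qs) -!mulrA [s * (eta / 4)]mulrA QE.
exact: slope_bound ht E2 V0 eta0.
Qed.

(** The mixture is realized by [k1] copies of one block followed by [k - k1] copies of the other,
    with k1 / k close to the weight [t]; a large [k] makes the rounding harmless. *)
Lemma near_optimal_block (eta : R) : 0 < eta ->
  exists (w : block r1 r2) (h1 h2 : R), let n := (block_len w)%:R in
    [/\ (0 < block_len w)%N, good_block A phi w (n * b) (n * h1) (n * h2) (n * eta),
     0 <= h1 <= ln r1%:R, 0 <= h2 <= ln r2%:R & V - eta <= h1 + s * h2].
Proof.
move=> eta0; have [N [wi [wj [t [xi [xj [Li [Lj [ci [cj]]]]]]]]]] := optimal_pair eta0.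
move=> [[N0 t01] [li lj] [gi gj] [Li01 Lj01 ci01 cj01] [xiD xjD xt VE]].
have NR : 0 < N%:R :> R by rewrite ltr0n.
have E0 : 0 <= ln r1%:R + ln r2%:R :> R by rewrite addr_ge0.
have D0 : 0 <= M + `|b| by rewrite addr_ge0.
have [k k0 hk] := exists_nat_ge (8 * (ln r1%:R + ln r2%:R + (M + `|b|)) / eta).
have kR : 0 < k%:R :> R by rewrite ltr0n.
have [k1 k1k ut] := floor_ratio t01 k0.
rewrite ler_pdivrMr// in hk.
set u := k1%:R / k%:R in ut.
have u01 : 0 <= u <= 1 by rewrite divr_ge0//= ler_pdivrMr// mul1r ler_nat.
have k1E : k1%:R = k%:R * u :> R by rewrite mulrC divfK// gt_eqF.
have k2E : (k - k1)%:R = k%:R * (1 - u) :> R by rewrite natrB// mulrBr mulr1 -k1E.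
have [v1 lv1 gv1] := good_repeat_block a0A k1 gi.
have [v2 lv2 gv2] := good_repeat_block a0A (k - k1) gj.
have len : block_len (cat_block v1 v2) = (k * N)%N.
  by rewrite /= lv1 lv2 li lj -mulnDl subnKC.
exists (cat_block v1 v2), (u * Li + (1 - u) * Lj), (u * ci + (1 - u) * cj).
rewrite len natrM; split.
- by rewrite muln_gt0 k0.
- apply: good_block_weaken (good_cat_block gv1 gv2) _ _ _; rewrite k1E k2E.
  + by rewrite le_eqVlt; apply/orP; left; apply/eqP; ring.
  + by rewrite le_eqVlt; apply/orP; left; apply/eqP; ring.
  set B := (X in `|X|); have -> : B = k%:R * N%:R * (u * xi + (1 - u) * xj) by rewrite /B; ring.
  rewrite normrM gtr0_norm ?mulr_gt0//.
  rewrite (_ : k%:R * u * _ + _ = k%:R * N%:R * (eta / 2)); last by ring.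
  rewrite -mulrDr ler_pM2l ?mulr_gt0// [leRHS]splitr lerD2r.
  apply: (convex_norm_le kR ut xiD xjD); first by lra.
  by lra.
- exact: convex_itv.
- exact: convex_itv.
have := convex_ge (e := eta / 2) kR ut 
  (weighted_itv s0 s1 Li01 ci01) (weighted_itv s0 s1 Lj01 cj01) VE.
rewrite -addrA -opprD -splitr.
have -> : u * Li + (1 - u) * Lj + s * (u * ci + (1 - u) * cj) =
    u * (Li + s * ci) + (1 - u) * (Lj + s * cj) by ring.
by apply; lra.
Qed.

(* The exponents of [near_optimal_block] depend on the tolerance; by the
   pigeonhole principle one pair serves for arbitrarily small tolerances. *)
Lemma near_optimal_rates (eta : R) : 0 < eta ->
  exists h1 h2 : R, [/\ 0 <= h1, 0 <= h2, V - eta <= h1 + s * h2 &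
    forall e : R, 0 < e -> exists2 w : block r1 r2, (0 < block_len w)%N &
      let n := (block_len w)%:R in good_block A phi w (n * b) (n * h1) (n * h2) (n * e)].
Proof.
(* One mesh pays for the tolerance of the block and one for rounding each of the two exponents. *)
move=> eta0; have [mesh mesh0 ->] : exists2 m : R, 0 < m & eta = 4 * m.
  by exists (eta / 4); [rewrite divr_gt0|field].
have /choice[f hf] n : exists p : block r1 r2 * (R * R), let l := (block_len p.1)%:R in
    [/\ (0 < block_len p.1)%N,
     good_block A phi p.1 (l * b) (l * p.2.1) (l * p.2.2) (l * n.+1%:R^-1),
     0 <= p.2.1 <= ln r1%:R, 0 <= p.2.2 <= ln r2%:R & V - n.+1%:R^-1 <= p.2.1 + s * p.2.2].
  have [|w [h1 [h2 h]]] := @near_optimal_block (n.+1%:R^-1); first by rewrite invr_gt0.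
  by exists (w, (h1, h2)).
pose K1 := (Num.truncn (ln r1%:R / mesh)).+1; pose K2 := (Num.truncn (ln r2%:R / mesh)).+1.
pose cell n : 'I_K1 * 'I_K2 :=
  (inord (Num.truncn ((f n).2.1 / mesh)), inord (Num.truncn ((f n).2.2 / mesh))).
have [c hc] : exists c, forall n0, exists2 n, (n0 <= n)%N & cell n = c.
  apply: contrapT => H.
  have /choice[g hg] c : exists n0, forall n, (n0 <= n)%N -> cell n <> c.
    apply: contrapT => Hc; apply: H; exists c => n0; apply: contrapT => Hn.
    by apply: Hc; exists n0 => n n0n cn; apply: Hn; exists n.
  pose m := \max_c g c; apply: (hg (cell m) m) => //.
  exact: (@leq_bigmax _ g (cell m)).
exists (c.1%:R * mesh), (c.2%:R * mesh).
have low n : cell n = c -> [/\ c.1%:R * mesh <= (f n).2.1, (f n).2.1 <= c.1%:R * mesh + mesh,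
   c.2%:R * mesh <= (f n).2.2 & (f n).2.2 <= c.2%:R * mesh + mesh].
  have [_ _ /andP[p1 p2] /andP[p3 p4] _] := hf n.
  have grid (x B : R) : 0 <= x <= B -> let k := Num.truncn (x / mesh) in
      [/\ (k < (Num.truncn (B / mesh)).+1)%N, k%:R * mesh <= x & x <= k%:R * mesh + mesh].
    move=> /andP[x0 xB] k; split.
    - by rewrite ltnS; apply: le_truncn; rewrite ler_pM2r ?invr_gt0.
    - by rewrite -ler_pdivlMr// truncn_le divr_ge0// ltW.
    rewrite -[X in _ + X]mul1r -mulrDl natr1 -ler_pdivrMr//.
    by apply: ltW; exact: truncnS_gt.
  have [k1 a1 a2] := grid _ _ (introT andP (conj p1 p2)).
  have [k2 a3 a4] := grid _ _ (introT andP (conj p3 p4)).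
  by move=> <-; rewrite /cell /= !inordK.
split.
- by rewrite mulr_ge0// ltW.
- by rewrite mulr_ge0// ltW.
- have [n0 _ hn0] := exists_nat_ge (mesh^-1).
  have [n nn cn] := hc n0; have [_ _ _ _ hV] := hf n; have [_ a1 _ a2] := low n cn.
  have n1 : n.+1%:R^-1 <= mesh.
    rewrite -[leRHS]invrK lef_pV2 ?posrE ?invr_gt0// (le_trans hn0)// ler_nat.
    by apply: leq_trans nn _.
  have s2 : s * (f n).2.2 <= s * (c.2%:R * mesh + mesh) by rewrite ler_pM2l.
  have sm : s * mesh <= mesh by apply: ler_piMl => //; exact: ltW.
  exact: rate_of_cell hV n1 a1 s2 sm mesh0.
move=> e e0; have [n0 _ hn0] := exists_nat_ge (e^-1).
have [n nn cn] := hc n0; have [l0 gw _ _ _] := hf n; have [a1 _ a2 _] := low n cn.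
exists (f n).1 => //=; apply: good_block_weaken gw _ _ _; rewrite ?ler_wpM2l//.
rewrite subrr normr0 add0r ler_wpM2l//.
rewrite -[leRHS]invrK lef_pV2 ?posrE ?invr_gt0// (le_trans hn0)// ler_nat.
exact: leq_trans nn _.
Qed.

End near_optimal_blocks.

(** * Moran sets in the level set *)

Section block_positions.
Variable l : nat -> nat.
Hypothesis l_gt0 : forall i, (0 < l i)%N.

Definition block_start i := (\sum_(j < i) l j)%N.

(* (index of the block containing position [p], offset of [p] in that block) *)
Fixpoint block_pos p : nat * nat :=
  if p is p'.+1 then
    let: (i, k) := block_pos p' in if (k.+1 < l i)%N then (i, k.+1) else (i.+1, 0%N)
  else (0%N, 0%N).

Lemma block_startS i : block_start i.+1 = (block_start i + l i)%N.
Proof. by rewrite /block_start big_ord_recr. Qed.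

Lemma leq_block_start i : (i <= block_start i)%N.
Proof. by elim: i => // i IH; rewrite block_startS -addn1 leq_add. Qed.

Lemma block_start_mono i j : (i <= j)%N -> (block_start i <= block_start j)%N.
Proof.
elim: j => [|j IH]; first by rewrite leqn0 => /eqP ->.
rewrite leq_eqVlt => /predU1P[->//|]; rewrite ltnS => /IH /leq_trans; apply.
by rewrite block_startS leq_addr.
Qed.

Lemma block_posP p : p = (block_start (block_pos p).1 + (block_pos p).2)%N /\
  ((block_pos p).2 < l (block_pos p).1)%N.
Proof.
elim: p => [|p [IH1 IH2]] /=; first by rewrite /block_start big_ord0.
case: (block_pos p) IH1 IH2 => i k /= pE kl; case: ltnP => h /=.
  by rewrite addnS -pE.
rewrite addn0 block_startS {1}pE -addnS; split=> //; congr addn.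
by apply/eqP; rewrite eqn_leq kl h.
Qed.

Lemma block_pos_start i k : (k < l i)%N -> block_pos (block_start i + k) = (i, k).
Proof.
move=> kl; have [h1 h2] := block_posP (block_start i + k).
move: h1 h2; case: (block_pos _) => j m /= h1 h2.
have [ij|ji|ij] := ltngtP i j.
- have := block_start_mono ij; rewrite block_startS => h3.
  have := leq_trans h3 (leq_addr m (block_start j)).
  by rewrite -h1 leq_add2l leqNgt kl.
- have := block_start_mono ji; rewrite block_startS => h3.
  have := leq_trans h3 (leq_addr k (block_start i)).
  by rewrite h1 leq_add2l leqNgt h2.
by move: h1; rewrite ij => /addnI ->.
Qed.

Lemma block_start_leqE i p : (block_start i.+1 <= p)%N = (i < (block_pos p).1)%N.
Proof.
have [h1 h2] := block_posP p; apply/idP/idP => [h|h].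
  rewrite ltnNge; apply/negP => /block_start_mono h3; move: h; rewrite h1 block_startS.
  have [ij|] := ltnP (block_pos p).1 i.
    have := block_start_mono ij; rewrite block_startS => h4 h5.
    have := leq_trans (leq_addr (l i) (block_start i)) h5.
    by move/(leq_trans h4); rewrite leq_add2l leqNgt h2.
  move=> h4; have h5 : (block_pos p).1 = i.
    apply/eqP; rewrite eqn_leq h4 andbT leqNgt; apply/negP => /block_start_mono.
    rewrite block_startS => h6; have := leq_trans h6 h3.
    by rewrite -[X in (_ <= X)%N]addn0 leq_add2l leqn0 eqn0Ngt l_gt0.
  by rewrite h5 leq_add2l leqNgt -h5 h2.
by rewrite h1 (leq_trans (block_start_mono h))// leq_addr.
Qed.

End block_positions.

Lemma birkhoff_error_split (R : realType) (T x lD n e ki D : R) :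
    T <= e / 4 * n -> x <= n * ki -> lD <= n * ki * D -> n * ((1 + D) * ki) <= n * (e / 4) ->
    0 <= e * n ->
  T + x + lD <= e * n.
Proof. lra. Qed.

(** * Infinite concatenations of blocks and their codes *)

Section block_sequences.
Variables (R : realType) (r1 r2 : nat) (A : {set 'I_r1 * 'I_r2}).
Variables (phi : word r1 * word r2 -> R) (M b h1 h2 : R).
Hypothesis phiM : forall z, symbolic_carpet A z -> `|phi z| <= M.
Hypothesis M0 : 0 <= M.
Local Notation S := (birkhoff_sum (@shift2 r1 r2) phi).

(** [kappa i] is the largest k <= i whose block has length at most i / k. The tolerances thus tend
    to 0, while each block stays short compared with its position. *)
Lemma block_sequence :
    (forall e : R, 0 < e -> exists2 w : block r1 r2, (0 < block_len w)%N &
      let n := (block_len w)%:R in good_block A phi w (n * b) (n * h1) (n * h2) (n * e)) ->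
  exists (W : nat -> block r1 r2) (kappa : nat -> nat),
    [/\ forall i, (0 < block_len (W i))%N,
      forall i, let n := (block_len (W i))%:R in
        good_block A phi (W i) (n * b) (n * h1) (n * h2) (n * (kappa i).+1%:R^-1),
      forall i, (kappa i * block_len (W i) <= i)%N &
      forall k, exists i0, forall i, (i0 <= i)%N -> (k <= kappa i)%N].
Proof.
move=> H.
have /choice[w hw] k : exists w : block r1 r2, (0 < block_len w)%N /\
    let n := (block_len w)%:R in good_block A phi w (n * b) (n * h1) (n * h2) (n * k.+1%:R^-1).
  by have [|w l0 gw] := H (k.+1%:R^-1); [rewrite invr_gt0|exists w].
pose Q i k := (k <= i)%N && (k * block_len (w k) <= i)%N.
have Q0 i : exists k, Q i k by exists 0%N.
have Qb i k : Q i k -> (k <= i)%N by case/andP.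
pose kappa i := ex_maxn (Q0 i) (Qb i).
have kP i : Q i (kappa i) /\ forall k, Q i k -> (k <= kappa i)%N.
  by rewrite /kappa; case: ex_maxnP.
exists (fun i => w (kappa i)), kappa; split=> [i|i|i|k].
- exact: (hw (kappa i)).1.
- exact: (hw (kappa i)).2.
- by have [/andP[]] := kP i.
exists (maxn k (k * block_len (w k))) => i; rewrite geq_max => /andP[ki kli].
by apply: (kP i).2; rewrite /Q ki.
Qed.

Variables (W : nat -> block r1 r2) (kappa : nat -> nat).
Hypothesis W0 : forall i, (0 < block_len (W i))%N.
Hypothesis Wgood : forall i, let n := (block_len (W i))%:R in
  good_block A phi (W i) (n * b) (n * h1) (n * h2) (n * (kappa i).+1%:R^-1).
Hypothesis kappa_len : forall i, (kappa i * block_len (W i) <= i)%N.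
Hypothesis kappa_infty : forall k, exists i0, forall i, (i0 <= i)%N -> (k <= kappa i)%N.

Let l i := block_len (W i).
Local Notation t := (block_start l).
Local Notation pos := (block_pos l).

(* Even coordinates of the code choose the rows, odd ones the columns. *)
Definition code_size k : nat :=
  if odd k then block_cols (W k./2) else block_rows (W k./2).

Definition valid_code (v : nat -> nat) := forall k, (v k < code_size k)%N.

Definition code_word (v : nat -> nat) : word r1 * word r2 :=
  (fun p => block_x (W (pos p).1) (v (pos p).1.*2) (pos p).2,
   fun p => block_y (W (pos p).1) (v (pos p).1.*2) (v (pos p).1.*2.+1) (pos p).2).

Lemma valid_code_row v i : valid_code v -> (v i.*2 < block_rows (W i))%N.
Proof. by move=> hv; have := hv i.*2; rewrite /code_size odd_double doubleK. Qed.

Lemma valid_code_col v i : valid_code v -> (v i.*2.+1 < block_cols (W i))%N.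
Proof. by move=> hv; have := hv i.*2.+1; rewrite /code_size /= odd_double uphalf_double. Qed.

Lemma code_size_gt0 k : (0 < code_size k)%N.
Proof.
rewrite /code_size; have [hr hc _ _ _ _] := Wgood k./2.
by case: ifP => _; rewrite -(ltr0n R); [apply: lt_le_trans hc|apply: lt_le_trans hr]; exact: expR_gt0.
Qed.

Lemma code_word_carpet v : valid_code v -> symbolic_carpet A (code_word v).
Proof.
move=> hv p; apply: (block_in (Wgood (pos p).1)).
  exact: valid_code_row.
exact: valid_code_col.
Qed.

Lemma birkhoff_code_block v i : valid_code v ->
  `|S (l i) (iter (t i) (@shift2 r1 r2) (code_word v)) - (l i)%:R * b|
    <= (l i)%:R * (kappa i).+1%:R^-1.
Proof.
move=> hv; apply: (block_birkhoff (Wgood i) (valid_code_row i hv) (valid_code_col i hv)).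
  by apply: symbolic_carpet_shift; exact: code_word_carpet.
by move=> k kl; rewrite iter_shift2 /= !iter_shift /code_word /= block_pos_start.
Qed.

Lemma birkhoff_code_start v n : valid_code v ->
  `|S (t n) (code_word v) - (t n)%:R * b| <= \sum_(i < n) (l i)%:R * (kappa i).+1%:R^-1.
Proof.
move=> hv; elim: n => [|n IH].
  by rewrite /block_start !big_ord0 mul0r subr0 /birkhoff_sum big_ord0 normr0.
rewrite block_startS birkhoff_sumD big_ord_recr /= natrD mulrDl opprD addrACA.
by apply: (le_trans (ler_normD _ _)); apply: lerD => //; exact: birkhoff_code_block.
Qed.

(** Block i starts at position at least i, and [kappa i * l i <= i]. *)
Lemma block_len_small k : (0 < k)%N -> exists n0, forall n, (n0 <= n)%N ->
  (k * l (pos n).1 <= t (pos n).1)%N /\ (k <= kappa (pos n).1)%N.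
Proof.
move=> k0; have [i0 hi0] := kappa_infty k; exists (t i0.+1) => n.
rewrite block_start_leqE// => /ltnW/hi0 h; split=> //.
apply: leq_trans (leq_block_start W0 _).
by apply: leq_trans (kappa_len _); rewrite leq_mul2r h orbT.
Qed.

(** The error comes from the first [i0] blocks, a bounded amount; from later complete blocks, of
    relative tolerance at most 1/k; and from the incomplete last block, of length at most n / k. *)
Lemma birkhoff_code v : valid_code v -> n%:R^-1 * S n (code_word v) @[n --> \oo] --> b.
Proof.
move=> hv; have Kz := code_word_carpet hv; have M_ge0 := M0.
apply/cvgrPdist_le => e e0.
have D0 : 0 <= M + `|b| by rewrite addr_ge0.
have [k k0 hk] := exists_nat_ge (4 * (1 + (M + `|b|)) / e).
have kR : 0 < k%:R :> R by rewrite ltr0n.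
have [i0 hi0] := kappa_infty k.
have [n0 hn0] := block_len_small k0.
have [n1 n10 hn1] := exists_nat_ge (4 * (t i0)%:R / e).
exists (maxn (maxn n0 n1) (t i0)) => // n /=; rewrite !geq_max => /andP[/andP[n0n n1n] tn].
have n_gt0 : 0 < n%:R :> R by rewrite ltr0n (leq_trans n10).
rewrite -[b in b - _](mulKf (lt0r_neq0 n_gt0)) -mulrBr normrM gtr0_norm ?invr_gt0//.
rewrite distrC mulrC ler_pdivrMr//.
have [nE off] := block_posP W0 n; have [small kk] := hn0 n n0n.
move: nE off small kk; set I := (pos n).1; set m := (pos n).2 => nE off small kk.
have tail : `|S m (iter (t I) (@shift2 r1 r2) (code_word v)) - m%:R * b| <= (l I)%:R * (M + `|b|).
  apply: (le_trans (ler_normB _ _)); rewrite normrM ger0_norm// mulrDr.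
  have mI : m%:R <= (l I)%:R :> R by rewrite ler_nat ltnW.
  apply: lerD; last by rewrite ler_wpM2r.
  apply: (le_trans (birkhoff_bound phiM m (symbolic_carpet_shift _ Kz))).
  by rewrite ler_wpM2r.
have head : \sum_(i < I) (l i)%:R * (kappa i).+1%:R^-1 <= (t i0)%:R + (t I)%:R * k%:R^-1 :> R.
  rewrite /block_start !natr_sum mulr_suml.
  apply: (@le_trans _ _ (\sum_(i < I) ((if (i < i0)%N then (l i)%:R else 0) + (l i)%:R / k%:R))).
    apply: ler_sum => i _; case: ltnP => [_|i0i].
      rewrite -[leLHS]addr0 lerD ?mulr_ge0 ?invr_ge0//.
      by rewrite -[leRHS]mulr1 ler_wpM2l// invf_le1// ler1n.
    rewrite add0r ler_wpM2l// lef_pV2 ?posrE// ler_nat.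
    by apply: leq_trans (hi0 _ i0i) _.
  rewrite big_split/= lerD2r -big_mkcond /=.
  have [Ii|iI] := leqP I i0.
    apply: (@le_trans _ _ (t I)%:R).
      by rewrite /block_start natr_sum big_mkcond /=; apply: ler_sum => i _; case: ifP.
    by rewrite -natr_sum ler_nat; exact: block_start_mono.
  by rewrite (big_ord_widen _ (fun i => (l i)%:R : R) (ltnW iI)).
rewrite {1 2}nE birkhoff_sumD natrD mulrDl opprD addrACA.
apply: (le_trans (ler_normD _ _)).
have start := birkhoff_code_start I hv.
have tI : (t I)%:R <= n%:R :> R by rewrite ler_nat nE leq_addr.
have lI : (l I)%:R <= n%:R / k%:R :> R.
  by rewrite ler_pdivlMr// -natrM ler_nat mulnC (leq_trans small)// nE leq_addr.
apply: (le_trans (lerD (le_trans start head) tail)).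
have hk1 : (1 + (M + `|b|)) / k%:R <= e / 4.
  by rewrite ler_pdivrMr//; move: hk; rewrite ler_pdivrMr//; lra.
have hn : (t i0)%:R <= e / 4 * n%:R :> R.
  have : n1%:R <= n%:R :> R by rewrite ler_nat.
  by move/(le_trans hn1); rewrite ler_pdivrMr//; lra.
have a1 : (t I)%:R * k%:R^-1 <= n%:R * k%:R^-1 :> R by rewrite ler_wpM2r ?invr_ge0.
have a2 : (l I)%:R * (M + `|b|) <= n%:R / k%:R * (M + `|b|) by rewrite ler_wpM2r.
have a3 : n%:R * ((1 + (M + `|b|)) / k%:R) <= n%:R * (e / 4) by rewrite ler_wpM2l// ltW.
exact: birkhoff_error_split hn a1 a2 a3 (ltW (mulr_gt0 e0 n_gt0)).
Qed.

(** The code coordinates determined by [m] letters of the first word and [n] letters of the second: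
    rows of blocks that end by [m], columns of blocks that end by [n]. *)
Definition coded (m n k : nat) :=
  if odd k then (t k./2.+1 <= n)%N else (t k./2.+1 <= m)%N.

Lemma coded_lt m n k : (n <= m)%N -> coded m n k -> (k < m.*2)%N.
Proof.
move=> nm; have le : (k./2.+1 <= t k./2.+1)%N by exact: leq_block_start.
have : (k < k./2.+1.*2)%N by rewrite doubleS -[X in (X < _)%N]odd_double_half; case: odd.
move=> /leq_trans h; rewrite /coded; case: ifP => _ h'; apply: h; rewrite leq_double.
  exact: leq_trans le (leq_trans h' nm).
exact: leq_trans le h'.
Qed.

(** Columns are separated only within a common row; since n <= m, the row of a block is known
    whenever its column letters are. *)
Lemma code_word_inj m n v v' : (n <= m)%N -> valid_code v -> valid_code v' ->
    (forall k, (k < m)%N -> (code_word v).1 k = (code_word v').1 k) ->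
    (forall k, (k < n)%N -> (code_word v).2 k = (code_word v').2 k) ->
  forall k, coded m n k -> v k = v' k.
Proof.
move=> nm hv hv' e1 e2.
have rows i : (t i.+1 <= m)%N -> v i.*2 = v' i.*2.
  move=> tm; apply: (block_x_inj (Wgood i)); [exact: valid_code_row..|].
  move=> k kl; have := e1 (t i + k)%N; rewrite /= block_pos_start//; apply.
  by apply: leq_trans tm; rewrite block_startS ltn_add2l.
move=> k; rewrite /coded => tk; rewrite -[k]odd_double_half; move: tk.
case: (odd k) => /= tk; last by rewrite add0n; exact: rows.
rewrite add1n; have E := rows _ (leq_trans tk nm).
apply: (block_y_inj (Wgood k./2) (valid_code_row _ hv)); [exact: valid_code_col| |].
  exact: valid_code_col.
move=> j jl; have := e2 (t k./2 + j)%N; rewrite /= block_pos_start// -E; apply.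
by apply: leq_trans tk; rewrite block_startS ltn_add2l.
Qed.

(** Grouping the coordinates in pairs, a complete block of length l contributes at most exp(-l h1)
    through its row and exp(-l h2) through its column. *)
Lemma coded_mass_le m n : (n <= m)%N ->
  \prod_(k < m.*2 | coded m n k) (code_size k)%:R^-1 <=
    expR (- (h1 * (t (pos m).1)%:R + h2 * (t (pos n).1)%:R)).
Proof.
move=> nm.
have pairs K : \prod_(k < K.*2 | coded m n k) (code_size k)%:R^-1 =
    \prod_(i < K) ((if (i < (pos m).1)%N then (block_rows (W i))%:R^-1 else 1) *
      (if (i < (pos n).1)%N then (block_cols (W i))%:R^-1 else 1)) :> R.
  elim: K => [|K IH]; first by rewrite !big_ord0.
  rewrite doubleS big_mkcond !big_ord_recr /= -big_mkcond IH -mulrA; congr (_ * _).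
  rewrite /coded /code_size /= odd_double /= uphalf_double doubleK.
  by rewrite !block_start_leqE.
have start K j : (j <= K)%N -> (t j)%:R = \sum_(i < K) (if (i < j)%N then (l i)%:R else 0) :> R.
  by move=> jK; rewrite /block_start natr_sum -big_mkcond /= (big_ord_widen K (fun i => (l i)%:R : R)).
have posle p : (p <= m)%N -> ((pos p).1 <= m)%N.
  move=> pm; apply: leq_trans (leq_block_start W0 _) _; apply: leq_trans pm.
  by have [E _] := block_posP W0 p; rewrite {2}E leq_addr.
rewrite pairs (start m _ (posle m (leqnn m))) (start m _ (posle n nm)).
rewrite !mulr_sumr -big_split /= -sumrN expR_sum; apply: ler_prod => i _.
have [hr hc _ _ _ _] := Wgood i.
have r0 : 0 < (block_rows (W i))%:R :> R by apply: lt_le_trans hr; exact: expR_gt0.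
have c0 : 0 < (block_cols (W i))%:R :> R by apply: lt_le_trans hc; exact: expR_gt0.
rewrite mulr_ge0 /=; last 2 first.
- by case: ifP; rewrite ?invr_ge0 ?ltW.
- by case: ifP; rewrite ?invr_ge0 ?ltW.
rewrite opprD expRD; apply: ler_pM.
- by case: ifP; rewrite ?invr_ge0 ?ltW.
- by case: ifP; rewrite ?invr_ge0 ?ltW.
- case: ifP => _; last by rewrite mulr0 oppr0 expR0.
  by rewrite expRN lef_pV2 ?posrE ?expR_gt0// mulrC.
case: ifP => _; last by rewrite mulr0 oppr0 expR0.
by rewrite expRN lef_pV2 ?posrE ?expR_gt0// mulrC.
Qed.

End block_sequences.

(** * Lower bound for the dimension *)

(** For d > 0 the last power r^-n not below d is comparable to d. For d = 0 there is no such scale,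
    and an arbitrarily small one is taken. *)
Lemma diameter_le1_level (R : realType) (r : nat) (d e : R) : (2 <= r)%N ->
    0 < e -> 0 <= d <= 1 ->
  exists n : nat, d <= r%:R ^- n /\ (r%:R ^- n <= r%:R * d \/ r%:R ^- n <= e).
Proof.
move=> r2 e0 /andP[d0 d1].
have r1 : 1 < r%:R :> R by rewrite (ltr_nat _ 1).
have r0 : 0 < r%:R :> R by lra.
have small (x : R) : 0 < x -> exists n, r%:R ^- n <= x.
  move=> x0; have : r%:R^-1 ^+ n @[n --> \oo] --> (0 : R).
    by apply: cvg_expr; rewrite ger0_norm ?invr_ge0 ?(ltW r0)// invf_lt1.
  move=> /cvgrPdist_le/(_ _ x0)[n _ /(_ n (leqnn n))].
  rewrite sub0r normrN ger0_norm ?exprn_ge0 ?invr_ge0 ?(ltW r0)// exprVn => h.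
  by exists n.
have [d_eq0|d_neq0] := eqVneq d 0.
  have [n hn] := small _ e0; exists n; split; last by right.
  by rewrite d_eq0 invr_ge0 exprn_ge0// ltW.
have dp : 0 < d by rewrite lt0r d_neq0.
have [n hn] : exists n, r%:R ^- n < d.
  by have [|n hn] := small (d / 2); [rewrite divr_gt0|exists n; lra].
have [m hm mmin] := ex_minnP (ex_intro (fun n => r%:R ^- n < d) n hn).
case: m hm mmin => [|m] hm mmin.
  by move: hm; rewrite expr0 invr1 => /(lt_le_trans)/(_ d1); rewrite ltxx.
exists m; split.
  by rewrite leNgt; apply/negP => /mmin; rewrite ltnn.
left; move: hm; rewrite exprS invfM mulrC ltr_pdivrMr// mulrC => /ltW; exact.
Qed.

Lemma sum_half_pow (R : realType) (x : R) : 0 <= x ->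
  (\sum_(0 <= i <oo) (x / (2 ^ i.+1)%:R)%:E <= x%:E)%E.
Proof.
move=> x0; apply: lime_le.
  by apply: is_cvg_nneseries => n _ _; rewrite lee_fin divr_ge0.
apply: nearW => n; rewrite sumEFin lee_fin.
suff -> : \sum_(0 <= i < n) x / (2 ^ i.+1)%:R = x - x / (2 ^ n)%:R.
  by rewrite gerBl divr_ge0.
elim: n => [|n IH]; first by rewrite big_geq// expn0 divr1 subrr.
rewrite big_nat_recr//= IH expnS natrM; field.
by rewrite pnatr_eq0 expn_eq0.
Qed.

Lemma mass_exponent (R : realType) (X1 P1 X2 P2 Y G h' h nT : R) :
  X1 <= P1 -> X2 <= P2 -> Y <= X1 -> Y + X2 = G - h' -> nT <= G -> h' <= h ->
  - (P1 + P2) <= h + - nT.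
Proof. lra. Qed.

Section dimension_lower_bound.
Variables (R : realType) (r1 r2 : nat) (A : {set 'I_r1 * 'I_r2}).
Variables (phit : torus R -> R) (M b h1 h2 : R).
Hypotheses (hr1 : (2 <= r1)%N) (hr12 : (r1 <= r2)%N).

Let phi : word r1 * word r2 -> R := phit \o @coding2 R r1 r2.
Let s : R := ln r1%:R / ln r2%:R.

Hypothesis phiM : forall z, symbolic_carpet A z -> `|phi z| <= M.
Hypothesis M0 : 0 <= M.
Hypotheses (h1_ge0 : 0 <= h1) (h2_ge0 : 0 <= h2).

Variables (W : nat -> block r1 r2) (kappa : nat -> nat).
Hypothesis W0 : forall i, (0 < block_len (W i))%N.
Hypothesis Wgood : forall i, let n := (block_len (W i))%:R in
  good_block A phi (W i) (n * b) (n * h1) (n * h2) (n * (kappa i).+1%:R^-1).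
Hypothesis kappa_len : forall i, (kappa i * block_len (W i) <= i)%N.
Hypothesis kappa_infty : forall k, exists i0, forall i, (i0 <= i)%N -> (k <= kappa i)%N.

Let hr2 : (2 <= r2)%N. Proof. exact: leq_trans hr12. Qed.
Let lr1 : 0 < ln r1%:R :> R. Proof. exact: ln_nat_gt0. Qed.
Let lr2 : 0 < ln r2%:R :> R. Proof. exact: ln_nat_gt0. Qed.
Let s_gt0 : 0 < s. Proof. by rewrite divr_gt0. Qed.
Let L := level r1 r2.
Let l i := block_len (W i).
Local Notation pos := (block_pos l).
Local Notation point := (fun v => coding2 R (code_word W v)).

(** The mass, in the product of uniform measures on codes, of a box that fixes all coordinates
    determined by an approximate square of level n. *)
Let mass n : R := \prod_(k < (L n).*2 | coded W (L n) n k) (code_size W k)%:R^-1.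

Lemma point_level v : valid_code W v -> birkhoff_level A phit b (point v).
Proof.
move=> hv; split.
  by exists (code_word W v) => //; exact: (code_word_carpet Wgood hv).
under eq_fun do rewrite birkhoff_sum_coding2//.
exact: (birkhoff_code phiM M0 W0 Wgood kappa_len kappa_infty hv).
Qed.

(** The mass is about exp(-(h1 L(n) + h2 n)), and L(n) is about n / s. *)
Lemma mass_decay (t : R) : t * ln r2%:R < (h1 + s * h2) / s ->
  exists2 c : R, 0 < c & forall n, mass n <= c * expR (- (n%:R * (t * ln r2%:R))).
Proof.
move=> tH; set H := (h1 + s * h2) / s in tH; set T := t * ln r2%:R in tH *.
have s_ge0 := ltW s_gt0.
have H0 : 0 <= H by rewrite /H divr_ge0// addr_ge0// mulr_ge0.
(* This [k] gives (1 - 1/k) H >= T: the incomplete last blocks, a proportion of at most 1/k, fit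
   into the gap. *)
have [k k0 hk] := exists_nat_ge (H / (H - T)).
have HT0 : 0 < H - T by rewrite subr_gt0.
have kR : 0 < k%:R :> R by rewrite ltr0n.
have kH : H / k%:R <= H - T by rewrite ler_pdivrMr// mulrC -ler_pdivrMr.
have [n0 hn0] := block_len_small W0 kappa_len kappa_infty k0.
have start p : (n0 <= p)%N -> (1 - k%:R^-1) * p%:R <= (block_start l (pos p).1)%:R :> R.
  move=> /hn0[small _]; have [pE off] := block_posP W0 p.
  have h : p%:R <= (block_start l (pos p).1)%:R + (l (pos p).1)%:R :> R.
    by rewrite -natrD ler_nat {1}pE leq_add2l ltnW.
  have h' : k%:R * (l (pos p).1)%:R <= p%:R :> R.
    by rewrite -natrM ler_nat (leq_trans small)// {2}pE leq_addr.
  have : (l (pos p).1)%:R <= p%:R / k%:R :> R by rewrite ler_pdivlMr// mulrC.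
  by rewrite mulrBl mul1r mulrC; lra.
have mass_le n : mass n <= expR (- (h1 * (block_start l (pos (L n)).1)%:R +
    h2 * (block_start l (pos n).1)%:R)).
  by apply: (coded_mass_le W0 Wgood); exact: leq_level.
have large n : (n0 <= n)%N -> mass n <= expR h1 * expR (- (n%:R * T)).
  move=> n0n; apply: (le_trans (mass_le n)); rewrite -expRD ler_expR.
  have nL : (n <= L n)%N by exact: leq_level.
  have := start n n0n; have := start (L n) (leq_trans n0n nL).
  set x := (block_start l (pos (L n)).1)%:R; set y := (block_start l (pos n).1)%:R => hx hy.
  have k1 : k%:R^-1 <= 1 :> R by rewrite invf_le1// ler1n.
  have k2 : 0 <= k%:R^-1 :> R by rewrite invr_ge0.
  have a1 : h1 * ((1 - k%:R^-1) * (L n)%:R) <= h1 * x by rewrite ler_wpM2l.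
  have a2 : h2 * ((1 - k%:R^-1) * n%:R) <= h2 * y by rewrite ler_wpM2l.
  have /andP[_ a3] : s * (L n)%:R <= n%:R <= s * (L n).+1%:R by exact: level_ratio.
  have a4 : n%:R / s - 1 <= (L n)%:R.
    by rewrite lerBlDr ler_pdivrMr// mulrC natr1.
  have a5 : h1 * ((1 - k%:R^-1) * (n%:R / s - 1)) <= h1 * ((1 - k%:R^-1) * (L n)%:R).
    by rewrite ler_wpM2l// ler_wpM2l// subr_ge0.
  have a6 : h1 * ((1 - k%:R^-1) * (n%:R / s - 1)) + h2 * ((1 - k%:R^-1) * n%:R) =
      n%:R * ((1 - k%:R^-1) * H) - h1 * (1 - k%:R^-1).
    by rewrite /H; field; rewrite !gt_eqF.
  have a7 : n%:R * T <= n%:R * ((1 - k%:R^-1) * H).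
    by rewrite ler_wpM2l// mulrBl mul1r mulrC; move: kH; lra.
  have a8 : h1 * (1 - k%:R^-1) <= h1 by rewrite ler_piMr// gerBl.
  exact: (mass_exponent a1 a2 a5 a6 a7 a8).
have mass1 n : mass n <= 1.
  apply: (le_trans (mass_le n)); rewrite -expR0 ler_expR oppr_le0.
  by rewrite addr_ge0// mulr_ge0.
(* The first summand covers n >= n0, with exp(h1) for the rounding of L(n); the second covers n <
   n0, where the mass is at most 1. *)
exists (expR h1 + expR (n0%:R * `|T|)); first by rewrite addr_gt0// expR_gt0.
move=> n; have [n0n|nn0] := leqP n0 n.
  by apply: (le_trans (large n n0n)); rewrite ler_pM2r ?expR_gt0// lerDl expR_ge0.
apply: (le_trans (mass1 n)); rewrite mulrDl -[leLHS]add0r lerD ?mulr_ge0 ?expR_ge0//.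
rewrite -expRD -[leLHS]expR0 ler_expR -normrN.
have : n%:R * T <= n%:R * `|T| by rewrite ler_wpM2l// ler_norm.
have : n%:R * `|T| <= n0%:R * `|T| by rewrite ler_wpM2r// ler_nat ltnW.
by rewrite normrN; lra.
Qed.

(** Relative to one reference point, the codes hitting such a set fall into at most 36 classes, each
    contained in one approximate square of level n. *)
Lemma close_codes (U : set (torus R)) n v0 v : (diameter U <= (r2%:R ^- n)%:E)%E ->
    U (point v0) -> U (point v) ->
  exists d : 'I_6 * 'I_6,
    (prefix_val (L n) (code_word W v).1 + 3 =
     prefix_val (L n) (code_word W v0).1 + d.1 %[mod r1 ^ L n])%N /\
    (prefix_val n (code_word W v).2 + 3 =
     prefix_val n (code_word W v0).2 + d.2 %[mod r2 ^ n])%N.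
Proof.
move=> dU U0 Uv.
have dist : mdist (point v : torus R) (point v0) <= r2%:R ^- n.
  rewrite -lee_fin; apply: le_trans dU; apply: ereal_sup_ubound.
  by exists (point v, point v0).
have r1L : r2%:R ^- n <= r1%:R ^- L n :> R.
  rewrite lef_pV2 ?posrE ?exprn_gt0 ?ltr0n ?(leq_trans _ hr1) ?(leq_trans _ hr2)//.
  by rewrite -!natrX ler_nat; have /andP[] := level_bounds hr1 hr12 n.
have [d1 hd1] := close_coding_prefix hr1 (le_trans (le_trans (mdist_torus_ge1 _ _) dist) r1L).
have [d2 hd2] := close_coding_prefix hr2 (le_trans (mdist_torus_ge2 _ _) dist).
by exists (d1, d2).
Qed.

Lemma same_class_codes n v v' (d : 'I_6 * 'I_6) (x y : nat) : valid_code W v -> valid_code W v' ->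
    (prefix_val (L n) (code_word W v).1 + 3 = x + d.1 %[mod r1 ^ L n])%N ->
    (prefix_val n (code_word W v).2 + 3 = y + d.2 %[mod r2 ^ n])%N ->
    (prefix_val (L n) (code_word W v').1 + 3 = x + d.1 %[mod r1 ^ L n])%N ->
    (prefix_val n (code_word W v').2 + 3 = y + d.2 %[mod r2 ^ n])%N ->
  forall k, coded W (L n) n k -> v k = v' k.
Proof.
move=> hv hv' e1 e2 e1' e2'.
have same r m (w w' : word r) : (prefix_val m w + 3 = prefix_val m w' + 3 %[mod r ^ m])%N ->
    forall k, (k < m)%N -> w k = w' k.
  move=> /eqP; rewrite eqn_modDr => /eqP; rewrite !modn_small ?prefix_val_lt//.
  exact: prefix_val_inj.
apply: (code_word_inj W0 Wgood (leq_level hr1 hr12 n) hv hv').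
  by apply: same; rewrite e1 e1'.
by apply: same; rewrite e2 e2'.
Qed.

(** At a level comparable to the diameter d, the mass is at most a constant times d^u, hence times
    d^t as d <= 1. The term [eps] serves empty sets and sets of diameter 0. *)
Lemma good_level (t u c eps : R) (U : set (torus R)) : 0 <= t -> t < u -> 0 < c -> 0 < eps ->
    (forall n, mass n <= c * expR (- (n%:R * (u * ln r2%:R)))) -> (diameter U <= 1%:E)%E ->
  exists n, (diameter U <= (r2%:R ^- n)%:E)%E /\
    ((mass n)%:E <= (c * r2%:R `^ u)%:E * hausdorff_gauge t U + eps%:E)%E.
Proof.
move=> t0 tu c0 eps0 hc U1; have u0 : 0 < u by exact: le_lt_trans tu.
have r2_gt0 : 0 < r2%:R :> R by rewrite ltr0n (leq_trans _ hr2).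
have massE n : mass n <= c * (r2%:R ^- n) `^ u.
  apply: le_trans (hc n) _.
  rewrite /powR gt_eqF ?invr_gt0 ?exprn_gt0// lnV ?posrE ?exprn_gt0// lnXn// -mulr_natl.
  by rewrite ler_pM2l// ler_expR; lra.
have [d [d0 d1 Ud gd]] : exists d : R, [/\ 0 <= d, d <= 1, (diameter U <= d%:E)%E &
    0 < d -> ((d `^ t)%:E <= hausdorff_gauge t U)%E].
  have [->|/set0P[z Uz]] := eqVneq U set0.
    exists 0; rewrite lexx ler01 ltxx; split=> //.
    rewrite /diameter [X in ereal_sup X](_ : _ = set0) ?ereal_sup0 ?leNye//.
    by rewrite -subset0 => x [p [[]]].
  have D0 := diameter_ge0 Uz.
  have Dfin : diameter U \is a fin_num by rewrite ge0_fin_numE// (le_lt_trans U1)// ltry.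
  exists (fine (diameter U)); rewrite fine_ge0// fineK// lexx; split=> //.
    by rewrite -lee_fin fineK.
  move=> _; rewrite /hausdorff_gauge ifF; first by rewrite -poweR_EFin fineK.
  by apply/negP => /eqP U0; move: Uz; rewrite U0.
(* Chosen so that c e^u = eps. *)
pose e := (eps / c) `^ u^-1.
have e0 : 0 < e by rewrite powR_gt0// divr_gt0.
have [n [dn hn]] := diameter_le1_level hr2 e0 (introT andP (conj d0 d1)).
exists n; split; first by apply: le_trans Ud _; rewrite lee_fin.
have rn0 : 0 < r2%:R ^- n :> R by rewrite invr_gt0 exprn_gt0.
have g0 := hausdorff_gauge_ge0 t U.
have cr0 : 0 <= c * r2%:R `^ u by rewrite mulr_ge0 ?powR_ge0 ?ltW.
case: hn => hn.
  have dp : 0 < d by rewrite -(pmulr_rgt0 _ r2_gt0) (lt_le_trans rn0).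
  apply: (@le_trans _ _ ((c * r2%:R `^ u)%:E * hausdorff_gauge t U)%E); last first.
    by rewrite leeDl// lee_fin ltW.
  apply: (@le_trans _ _ ((c * r2%:R `^ u)%:E * (d `^ t)%:E)%E); last first.
    by apply: lee_wpmul2l => //; exact: gd.
  rewrite -EFinM lee_fin (le_trans (massE n))// -mulrA ler_pM2l//.
  apply: (@le_trans _ _ ((r2%:R * d) `^ u)).
    by apply: ge0_ler_powR; rewrite ?nnegrE ?mulr_ge0 ?(ltW u0) ?(ltW rn0) ?(ltW r2_gt0).
  rewrite powRM ?(ltW r2_gt0)// ler_pM2l ?powR_gt0//.
  by rewrite /powR gt_eqF// ler_expR; have := ln_le0 d1; move: tu; nra.
apply: (@le_trans _ _ eps%:E); last first.
  by rewrite leeDr// mule_ge0.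
rewrite lee_fin (le_trans (massE n))// mulrC -ler_pdivlMr//.
apply: (@le_trans _ _ (e `^ u)).
  by apply: ge0_ler_powR; rewrite ?nnegrE ?(ltW u0) ?(ltW rn0) ?(ltW e0).
by rewrite /e -powRrM mulVf ?gt_eqF// powRr1// divr_ge0// ltW.
Qed.

(** Mass distribution principle. A cover of very small total gauge would yield boxes of total mass
    below 1; a code avoiding all of them gives a point of the level set outside the cover. *)
Lemma hausdorff_measure_neq0 (t : R) : 0 <= t -> t * ln r2%:R < (h1 + s * h2) / s ->
  hausdorff_measure t (birkhoff_level A phit b) <> 0%E.
Proof.
move=> t0 tH E0.
pose u := (t * ln r2%:R + (h1 + s * h2) / s) / 2 / ln r2%:R.
have uE : u * ln r2%:R = (t * ln r2%:R + (h1 + s * h2) / s) / 2 by rewrite /u divfK// gt_eqF.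
have tu : t < u by rewrite -(ltr_pM2r lr2) uE; lra.
have uH : u * ln r2%:R < (h1 + s * h2) / s by rewrite uE; lra.
have u0 : 0 < u by exact: le_lt_trans tu.
have [c c0 hc] := mass_decay uH.
have r2_gt0 : 0 < r2%:R :> R by rewrite ltr0n (leq_trans _ hr2).
pose c' : R := c * r2%:R `^ u.
have c'0 : 0 < c' by rewrite mulr_gt0// powR_gt0.
pose B : R := #|{: 'I_6 * 'I_6}|%:R.
have B0 : 0 < B by rewrite ltr0n card_prod card_ord.
have pre0 : hausdorff_premeasure t 1 (birkhoff_level A phit b) = 0%E.
  apply/eqP; rewrite eq_le; apply/andP; split.
    by rewrite -E0; apply: ereal_sup_ubound; exists 1 => /=.
  apply: le_ereal_inf_tmp => _ [V _ <-]; apply: nneseries_ge0 => i _ _.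
  exact: hausdorff_gauge_ge0.
have [U [cover diam] sumU] : exists2 U : nat -> set (torus R),
    birkhoff_level A phit b `<=` \bigcup_i U i /\ (forall i, (diameter (U i) <= 1%:E)%E) &
    (\sum_(0 <= i <oo) hausdorff_gauge t (U i) < (4^-1 / (B * c'))%:E)%E.
  have : (hausdorff_premeasure t 1 (birkhoff_level A phit b) < (4^-1 / (B * c'))%:E)%E.
    rewrite pre0 lte_fin; apply: divr_gt0; last exact: mulr_gt0.
    by rewrite invr_gt0.
  by move=> /ereal_inf_lt[_ [U hU <-] ltU]; exists U.
have /choice[n hn] i : exists n, (diameter (U i) <= (r2%:R ^- n)%:E)%E /\
    ((mass n)%:E <= c'%:E * hausdorff_gauge t (U i) + (4^-1 / B / (2 ^ i.+1)%:R)%:E)%E.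
  set eps := 4^-1 / B / (2 ^ i.+1)%:R.
  have eps0 : 0 < eps by rewrite !divr_gt0// ltr0n expn_gt0.
  exact: good_level.
(* Each set of the cover gets a reference code [v0 i], and each nonempty class of codes hitting it a
   representative [rho i d], whose determined coordinates define the box. *)
pose hit i v := valid_code W v /\ U i (point v).
pose v0 i := xget (fun=> 0%N) (hit i).
pose class i (d : 'I_6 * 'I_6) v := [/\ hit i v,
  (prefix_val (L (n i)) (code_word W v).1 + 3 =
     prefix_val (L (n i)) (code_word W (v0 i)).1 + d.1 %[mod r1 ^ L (n i)])%N &
  (prefix_val (n i) (code_word W v).2 + 3 =
     prefix_val (n i) (code_word W (v0 i)).2 + d.2 %[mod r2 ^ n i])%N].
pose rho i d := xget (fun=> 0%N) (class i d).
pose act i d := `[< exists v, class i d v >].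
have rhoP i d : act i d -> class i d (rho i d) by move=> /asboolP ex; exact: xgetPex ex.
have [|i k|i d k||v [hv out]] := @box_cover_mass R (code_size W) _ act
    (fun i => coded W (L (n i)) (n i)) (fun i => (L (n i)).*2) rho.
- exact: (code_size_gt0 Wgood).
- by apply: (coded_lt W0); exact: leq_level.
- by move=> /rhoP[[hv _] _ _]; exact: hv.
(* A quarter comes from the gauges of the cover, a quarter from the geometric errors in
   [good_level]. *)
- apply: (@le_lt_trans _ _ (4^-1 + 4^-1)%:E); last by rewrite lte_fin; lra.
  apply: (@le_trans _ _ (\sum_(0 <= i <oo)
      ((B * c')%:E * hausdorff_gauge t (U i) + (4^-1 / (2 ^ i.+1)%:R)%:E))%E).
    apply: lee_nneseries => i _.
      move=> _; rewrite lee_fin; apply: sumr_ge0 => d _; apply: prodr_ge0 => k _.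
      by rewrite invr_ge0.
    apply: (@le_trans _ _ (B%:E * (mass (n i))%:E)%E).
      rewrite -EFinM lee_fin mulr_natl -sumr_const big_mkcond /=; apply: ler_sum => d _.
      by case: ifP => // _; apply: prodr_ge0 => k _; rewrite invr_ge0.
    apply: (le_trans (lee_wpmul2l _ (hn i).2)); first by rewrite lee_fin ltW.
    rewrite ge0_muleDr ?mule_ge0 ?lee_fin ?(ltW c'0) ?hausdorff_gauge_ge0//; last first.
      by rewrite !divr_ge0// ltW.
    rewrite muleA -EFinM -EFinM leeD2l// lee_fin.
    rewrite (_ : B * _ = 4^-1 / (2 ^ i.+1)%:R)//.
    by rewrite mulrA [B * _]mulrC divfK// gt_eqF.
  rewrite nneseriesD; last 2 first.
    by move=> i _ _; rewrite mule_ge0 ?hausdorff_gauge_ge0// lee_fin mulr_ge0 ?ltW.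
    by move=> i _ _; rewrite lee_fin divr_ge0.
  rewrite nneseriesZl; last by move=> i _; exact: hausdorff_gauge_ge0.
  rewrite EFinD; apply: leeD; last exact: sum_half_pow.
  apply: (le_trans (lee_wpmul2l _ (ltW sumU))); first by rewrite lee_fin mulr_ge0 ?ltW.
  by rewrite -EFinM lee_fin mulrC divfK// gt_eqF// mulr_gt0.
have [i _ Uv] := cover _ (point_level hv).
have hit0 : hit i (v0 i) by apply: (@xgetPex _ (fun=> 0%N) (hit i)); exists v.
have [d [e1 e2]] := close_codes (hn i).1 hit0.2 Uv.
have dv : act i d by apply/asboolP; exists v.
have [k ck] := out i d dv; apply.
have [[hr _] e1' e2'] := rhoP i d dv.
exact: same_class_codes hv hr e1 e2 e1' e2' k ck.
Qed.

End dimension_lower_bound.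

(** * Conclusion: the dimension formula *)

Lemma normalized_rate (R : realType) (P q b x1 x2 : R) : 0 < x1 -> 0 < x2 ->
  - b / x2 * q - - x1^-1 * P = (P / (x1 / x2) - q * b) / x2.
Proof. by move=> x10 x20; field; rewrite !gt_eqF. Qed.

Theorem theorem3p3 (R : realType) (r1 r2 : nat) (hr1 : (2 <= r1)%N)
    (hr12 : (r1 <= r2)%N) (A : {set 'I_r1 * 'I_r2}) (hA : (2 <= #|A|)%N)
    (phit : torus R -> R)
    (phit_cont : {within carpet R A, continuous phit})
    (phit_dini : dini (carpet R A) phit)
    (phit_norm : pressure A (phit \o @coding2 R r1 r2) = 0)
    (beta : R) :
  let T := tau A (phit \o @coding2 R r1 r2) in
  let Tstar := legendre T (- beta / ln r2%:R) in
  ((0 < Tstar)%E -> hausdorff_dim (birkhoff_level A phit beta) = Tstar) /\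
  ((Tstar < 0)%E -> birkhoff_level A phit beta = set0).
Proof.
pose phi : word r1 * word r2 -> R := phit \o @coding2 R r1 r2.
move=> T Tstar.
have hr2 := leq_trans hr1 hr12.
have l1 := @ln_nat_gt0 R _ hr1; have l2 := @ln_nat_gt0 R _ hr2.
have [a0 a0A] : exists a, a \in A by apply/card_gt0P; exact: leq_trans hA.
have [C [C0 osc dist]] := bounded_distortion hr1 hr12 phit_dini.
pose z0 : word r1 * word r2 := (fun=> a0.1, fun=> a0.2).
have Kz0 : symbolic_carpet A z0 by move=> k; rewrite /= -surjective_pairing.
pose M := `|phi z0| + C; have M0 : 0 <= M by rewrite addr_ge0.
have phiM z : symbolic_carpet A z -> `|phi z| <= M.
  move=> Kz; rewrite -(subrK (phi z0) (phi z)) (le_trans (ler_normD _ _))// addrC lerD2l.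
  exact: osc.
have s01 := ln_ratio01 R hr1 hr12; set s := ln r1%:R / ln r2%:R in s01.
have s0 : 0 < s by rewrite divr_gt0.
have [P hP] := partition_sum_rate a0A C0 s01 dist.
have PP q n : `|ln (partition_sum A phi a0 s q n) - n%:R * P q| <= `|q| * C by exact: (hP q).2.
pose val q : R := (P q / s - q * beta) / ln r2%:R.
have TstarE : Tstar = ereal_inf [set (val q)%:E | q in [set: R]].
  rewrite /Tstar /legendre; congr ereal_inf; apply: eq_imagel => q _.
  by rewrite /T /tau (cvg_lim _ (hP q).1)// normalized_rate.
have Tstar_le q : (Tstar <= (val q)%:E)%E by rewrite TstarE; apply: ereal_inf_lbound; exists q.
have le_Tstar x : (forall q, (x <= (val q)%:E)%E) -> (x <= Tstar)%E.
  by move=> h; rewrite TstarE; apply: le_ereal_inf_tmp => _ [q _ <-].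
split=> [Tstar_gt0|Tstar_lt0]; last first.
  (* A point of the level set makes every [val q] nonnegative by [pressure_ge], hence also their
     infimum. *)
  rewrite -subset0 => _ [[z Kz <-]].
  under eq_fun do rewrite birkhoff_sum_coding2//.
  move=> Sz; move: Tstar_lt0; rewrite ltNge => /negP; apply; apply: le_Tstar => q.
  rewrite lee_fin divr_ge0 ?(ltW l2)// subr_ge0 ler_pdivlMr//.
  by rewrite mulrAC; exact: (pressure_ge a0A s01 dist PP q Kz Sz).
apply/eqP; rewrite eq_le; apply/andP; split.
  (* Upper bound: each q separately gives measure 0 in dimension [val q + e]. *)
  apply: le_Tstar => q; apply/lee_addgt0Pr => e e0.
  have val0 : 0 < val q by rewrite -lte_fin (lt_le_trans Tstar_gt0).
  rewrite -EFinD; apply: ereal_inf_lbound; exists (val q + e) => //; split=> /=.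
    by rewrite addr_ge0// ltW.
  apply: (hausdorff_measure_level0 hr1 hr12 a0A dist phiM PP (q := q)).
    by rewrite addr_ge0// ltW.
  by rewrite mulrDl /val divfK ?gt_eqF// ltrDl mulr_gt0.
(* Lower bound: measure 0 in a dimension [t] below [Tstar] is refuted by blocks of rate close to V =
   [ln r1 * Tstar]. *)
apply: le_ereal_inf_tmp => _ [t [t0 mt] <-]; rewrite leNgt; apply/negP => tT.
have Tfin : Tstar \is a fin_num.
  by rewrite ge0_fin_numE ?(ltW Tstar_gt0)// (le_lt_trans (Tstar_le 0))// ltry.
set x := fine Tstar; have xE : Tstar = x%:E by rewrite /x fineK.
have x0 : 0 <= x by rewrite -lee_fin -xE ltW.
have tx : t < x by rewrite -lte_fin -xE.
have V0 : 0 <= ln r1%:R * x by rewrite mulr_ge0// ltW.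
have PV q : ln r1%:R * x <= P q - q * s * beta.
  have : x <= val q by rewrite -lee_fin -xE.
  rewrite /val -(ler_pM2l l1) => /le_trans; apply.
  by rewrite le_eqVlt /s; apply/orP; left; apply/eqP; field; rewrite !gt_eqF.
have /andP[_ s1] := s01.
(* With this loss the blocks still reach the rate [ln r1 * (x + t) / 2], strictly above
   [ln r1 * t]. *)
have eta0 : 0 < ln r1%:R * ((x - t) / 2) by rewrite mulr_gt0// divr_gt0// subr_gt0.
have [h1 [h2 [h10 h20 hV blocks]]] :=
  near_optimal_rates a0A C0 s0 s1 dist phiM PP V0 PV eta0.
have [W [kappa [W0 Wgood klen kinf]]] := block_sequence blocks.
apply: (hausdorff_measure_neq0 hr1 hr12 phiM M0 h10 h20 W0 Wgood klen kinf t0 _ mt).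
apply: (@lt_le_trans _ _ ((x + t) / 2 * ln r2%:R)); first by rewrite ltr_pM2r//; lra.
rewrite -/s ler_pdivlMr// (_ : _ * s = ln r1%:R * x - ln r1%:R * ((x - t) / 2))//.
by rewrite /s; field; rewrite gt_eqF.
Qed.
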